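(* Let $Q$ be a finite acyclic quiver with vertices $1,\dots,n$, let $(A_i,\le_i)$ be a quasi-hereditary $k$-algebra for each $1\le i\le n$, let $((A_i)_{i},(M_\alpha)_{\alpha})$ be a species on $Q$, and let $A$ be its tensor algebra, with the partial order $\le_A$ on $\operatorname{Sim}(A)$. Suppose that for every arrow $\alpha$ of $Q$: - $M_\alpha$ is projective as a right $A_{s(\alpha)}$-module whenever there is a path $p$ in $Q$ with $\max(p)=s(p)$ such that $\alpha$ appears in $p$; and - $M_\alpha$ is projective as a left $A_{t(\alpha)}$-module whenever there is a path $p$ in $Q$ with $\max(p)=t(p)$ such that $\alpha$ appears in $p$. Then $(A,\le_A)$ is quasi-hereditary.
   Context: Conventions: $k$ is an algebraically closed field; all algebras are nonzero finite-dimensional associative unital $k$-algebras, all vector spaces (in particular bimodules) are finite-dimensional over $k$, $k$ acts centrally on bimodules, and modules are left modules unless stated otherwise. $\operatorname{Sim}(A)$ is a set of representatives of the isomorphism classes of simple $A$-modules, and $P(L)$ is the projective cover of $L$. Quasi-hereditary algebras: for a partial order $\le_A$ on $\operatorname{Sim}(A)$ and $L\in\operatorname{Sim}(A)$, the standard module is $\Delta(L)=P(L)/\sum_{L'\not\le_A L,\ f\in\operatorname{Hom}_A(P(L'),P(L))}\operatorname{im}(f)$. The pair $(A,\le_A)$ is quasi-hereditary if for every $L\in \operatorname{Sim}(A)$ one has $\operatorname{End}_A(\Delta(L))\cong k$ and the kernel of $P(L)\to\Delta(L)$ has a finite filtration whose subquotients are isomorphic to standard modules $\Delta(L')$ with $L'>_A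 L$. Paths: $s(p)$ and $t(p)$ are the start and terminal vertex of a path $p$; paths are written $p=\alpha_m\cdots\alpha_1$ with $\alpha_1$ traversed first; $e_i$ is the trivial path at $i$; $\max(p)$ is the largest vertex (in the natural order on $\{1,\dots,n\}$) that $p$ passes through, including $s(p)$ and $t(p)$. Species: a species on $Q$ consists of an algebra $A_i$ for every vertex $i$ and an $A_{t(\alpha)}$-$A_{s(\alpha)}$-bimodule $M_\alpha$ for every arrow $\alpha$. Put $M_{e_i}=A_i$ and $M_p=M_{\alpha_m}\otimes_{A_{s(\alpha_m)}}M_{\alpha_{m-1}}\otimes\cdots\otimes_{A_{s(\alpha_2)}}M_{\alpha_1}$ for $p=\alpha_m\cdots\alpha_1$. The tensor algebra is $A=\bigoplus_{p\text{ path in }Q}M_p$, with multiplication $M_p\times M_q\to M_{pq}$ given by the tensor product (respectively by the bimodule action or the multiplication of $A_i$ if $p$ or $q$ is trivial) if $s(p)=t(q)$, and zero if $s(p)\ne t(q)$. The order $\le_A$: the projection $A\to\prod_{i=1}^nA_i$ that kills all $M_p$ with $p$ nontrivial induces a bijection $\bigsqcup_i\operatorname{Sim}(A_i)\to\operatorname{Sim}(A)$. For $L\in\operatorname{Sim}(A_i)$ and $L'\in\operatorname{Sim}(A_j)$, viewed as simple $A$-modules, $L\le_A L'$ if and only if $i<j$, or $i=j$ and $L\le_i L'$. *)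

(* Defs.v *)
From HB Require Import structures.
From mathcomp Require Import all_boot all_order all_algebra all_field.

Set Implicit Arguments.
Unset Strict Implicit.
Unset Printing Implicit Defensive.

Import Order.TTheory GRing.Theory.
Local Open Scope ring_scope.

Section LinearAlgebra.
Variable K : fieldType.

Lemma linfunE (V W : vectType K) (f : V -> W) : linear f -> linfun f =1 f.
Proof.
move=> lf; pose fM := GRing.isLinear.Build _ _ _ _ f lf.
by pose fL : {linear V -> W} := HB.pack f fM; exact: (lfunE fL).
Qed.

Lemma linear0_of (V W : vectType K) (f : V -> W) : linear f -> f 0 = 0.
Proof. by move=> lf; rewrite -(linfunE lf) linear0. Qed.

Lemma linear_sumf (V W : vectType K) (J : finType) (F : J -> V -> W) :
  (forall j, linear (F j)) -> linear (fun x => \sum_j F j x).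
Proof.
move=> lF c x y; rewrite scaler_sumr -big_split.
by apply: eq_bigr => j _; rewrite lF.
Qed.

Lemma linear_comb (V W : vectType K) (f : V -> W) (I : finType) (c : I -> K) v :
  linear f -> f (\sum_i c i *: v i) = \sum_i c i *: f (v i).
Proof.
move=> lf; rewrite -(linfunE lf) linear_sum; apply: eq_bigr => i _.
by rewrite linearZ /= linfunE.
Qed.

Lemma linear_lincomb (V W : vectType K) (c : K) (f g : V -> W) :
  linear f -> linear g -> linear (fun x => c *: f x + g x).
Proof.
move=> lf lg e u v; rewrite lf lg !scalerDr !scalerA mulrC -!addrA.
by congr (_ + _); rewrite addrCA.
Qed.

Definition is_bilinear (V W U : vectType K) (f : V -> W -> U) : Prop :=
  (forall x, linear (f x)) /\ (forall y, linear (f^~ y)).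

Section Quotient.
Variables (V : vectType K) (U : {vspace V}).

(* V / U is realised on a complement of U in V; [quot_pi] is the projection
   onto this complement with kernel U, and [quot_repr] picks representatives. *)
Definition quotv : vectType K := subvs_of U^C%VS.
Definition quot_pi : 'Hom(V, quotv) :=
  (linfun (vsproj (U^C)%VS) \o daddv_pi (U^C)%VS U)%VF.
Definition quot_repr : 'Hom(quotv, V) := linfun vsval.

Lemma quot_reprK q : quot_pi (quot_repr q) = q.
Proof.
rewrite /quot_pi /quot_repr comp_lfunE !lfunE /= daddv_pi_id ?vsvalK //.
  by rewrite capvC capv_compl.
exact: subvsP.
Qed.

Lemma quot_piK v : v - quot_repr (quot_pi v) \in U.
Proof.
rewrite /quot_pi /quot_repr comp_lfunE !lfunE /= vsprojK ?memv_pi //.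
rewrite -{1}(@daddv_pi_add _ _ U (U^C)%VS v) ?capv_compl ?addv_complf ?memvf //.
by rewrite addrK memv_pi.
Qed.

Lemma lker_quot_pi : lker quot_pi = U.
Proof.
apply/vspaceP => v; rewrite memv_ker; apply/eqP/idP => [pv0|vU].
  by have := quot_piK v; rewrite pv0 linear0 subr0.
rewrite /quot_pi comp_lfunE lfunE /=.
suff -> : daddv_pi (U^C)%VS U v = 0 by rewrite linear0.
apply: (addrI v); rewrite addr0 -{1}(daddv_pi_id (capv_compl U) vU).
by rewrite daddv_pi_add ?capv_compl ?addv_complf ?memvf.
Qed.

Lemma quot_pi_eq u v : u - v \in U -> quot_pi u = quot_pi v.
Proof.
by rewrite -{1}lker_quot_pi memv_ker linearB subr_eq0 => /eqP.
Qed.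

End Quotient.

Section Tensor.
Variables V W : vectType K.

(* A tensor is stored as the matrix of its coordinates on the basis b_i ⊗ c_j,
   where b = vbasis {:V} and c = vbasis {:W}. *)
Definition tensk : vectType K := 'M[K]_(\dim {:V}, \dim {:W}).

Definition tensk_pure (x : V) (y : W) : tensk :=
  \matrix_(i, j) (coord (vbasis {:V}) i x * coord (vbasis {:W}) j y).

Definition tensk_lift (U : vectType K) (f : V -> W -> U) : 'Hom(tensk, U) :=
  linfun (fun X : 'M[K]_(\dim {:V}, \dim {:W}) =>
    \sum_i \sum_j X i j *: f (vbasis {:V})`_i (vbasis {:W})`_j).

Lemma tensk_pureP : is_bilinear tensk_pure.
Proof.
split=> [x a y y'|y a x x']; apply/matrixP => i j; rewrite !mxE linearP /=.
  by rewrite mulrDr mulrCA.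
by rewrite mulrDl mulrA.
Qed.

Lemma tensk_liftE (U : vectType K) (f : V -> W -> U) (X : tensk) :
  tensk_lift f X =
  \sum_i \sum_j (X : 'M[K]_(_, _)) i j *: f (vbasis {:V})`_i (vbasis {:W})`_j.
Proof.
rewrite /tensk_lift linfunE // => a Y Z.
rewrite scaler_sumr -big_split; apply: eq_bigr => i _ /=.
rewrite scaler_sumr -big_split; apply: eq_bigr => j _ /=.
by rewrite !mxE scalerDl scalerA.
Qed.

Lemma tensk_lift_pure (U : vectType K) (f : V -> W -> U) : is_bilinear f ->
  forall x y, tensk_lift f (tensk_pure x y) = f x y.
Proof.
move=> [fr fl] x y; rewrite tensk_liftE.
rewrite {2}(coord_vbasis (memvf x)) (linear_comb _ _ (fl y)).
apply: eq_bigr => i _; rewrite {2}(coord_vbasis (memvf y)) (linear_comb _ _ (fr _)).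
by rewrite scaler_sumr; apply: eq_bigr => j _; rewrite mxE scalerA.
Qed.

Lemma tensk_ext (U : vectType K) (f g : 'Hom(tensk, U)) :
  (forall x y, f (tensk_pure x y) = g (tensk_pure x y)) -> f = g.
Proof.
move=> fg; apply/lfunP => X.
have -> : X = tensk_lift tensk_pure X.
  rewrite tensk_liftE; apply/matrixP => i j.
  rewrite summxE (bigD1 i) //= summxE (bigD1 j) //= !mxE !coord_free ?(basis_free (vbasisP _)) //.
  rewrite !eqxx !mulr1 !big1 ?addr0 // => [l li|l lj].
    rewrite summxE big1 // => m _; rewrite !mxE.
    by rewrite !coord_free ?(basis_free (vbasisP _)) // (negPf li) mul0r mulr0.
  by rewrite !mxE !coord_free ?(basis_free (vbasisP _)) // (negPf lj) !mulr0.
rewrite tensk_liftE !linear_sum; apply: eq_bigr => i _.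
by rewrite !linear_sum; apply: eq_bigr => j _; rewrite !linearZ /= fg.
Qed.

End Tensor.
End LinearAlgebra.

Section Converse.
Variables (K : fieldType) (A : falgType K).

HB.instance Definition _ := GRing.Lmodule.copy A^c A.

Fact converse_scalerAl (a : K) (x y : A^c) :
  a *: (x * y : A^c) = (a *: x : A^c) * y :> A^c.
Proof. exact: (@scalerAr _ A a y x). Qed.
HB.instance Definition _ :=
  GRing.Lmodule_isLalgebra.Build K A^c converse_scalerAl.

Fact converse_scalerAr (a : K) (x y : A^c) :
  a *: (x * y : A^c) = x * (a *: y : A^c) :> A^c.
Proof. exact: (@scalerAl _ A a y x). Qed.
HB.instance Definition _ :=
  GRing.Lalgebra_isAlgebra.Build K A^c converse_scalerAr.

HB.instance Definition _ := Vector.copy A^c A.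
HB.instance Definition _ := GRing.UnitRing.on A^c.

End Converse.
Record fdmodule (K : fieldType) (A : falgType K) := FDModule {
  fdmod_sort :> vectType K;
  act : A -> fdmod_sort -> fdmod_sort;
  act_bilinear : is_bilinear act;
  act1 : forall x, act 1 x = x;
  actM : forall a b x, act (a * b) x = act a (act b x) }.

Record submodule (K : fieldType) (A : falgType K) (M : fdmodule A) := SubModule {
  submod_space :> {vspace M};
  submodP : forall a x, x \in submod_space -> act a x \in submod_space }.

Section Modules.
Variables (K : fieldType) (A : falgType K).
Implicit Types M N P L : fdmodule A.

Definition act_fun M (a : A) : 'End(M) := linfun (@act K A M a).

Lemma act_funE M a : act_fun M a =1 act a.
Proof. exact/linfunE/(act_bilinear M).1. Qed.

Lemma actB M a (x y : M) : act a (x - y) = act a x - act a y.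
Proof. by rewrite -act_funE linearB /= !act_funE. Qed.

Section SubMod.
Variables (M : fdmodule A) (U : submodule M).

Definition sub_act (a : A) (x : subvs_of U) : subvs_of U :=
  Subvs (submodP a (subvsP x)).

Fact sub_act_bilinear : is_bilinear sub_act.
Proof.
have [mr ml] := act_bilinear M.
split=> [a c x y|x c a b]; apply: val_inj => /=; last exact: ml.
exact: mr.
Qed.
Fact sub_act1 x : sub_act 1 x = x.
Proof. by apply: val_inj; rewrite /= act1. Qed.
Fact sub_actM a b x : sub_act (a * b) x = sub_act a (sub_act b x).
Proof. by apply: val_inj; rewrite /= actM. Qed.

Definition sub_mod : fdmodule A :=
  FDModule sub_act_bilinear sub_act1 sub_actM.
End SubMod.

Section QuotMod.
Variables (M : fdmodule A) (U : submodule M).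

Definition quot_act (a : A) (q : quotv U) : quotv U :=
  quot_pi U (act a (quot_repr U q)).

Lemma quot_act_pi a x : quot_act a (quot_pi U x) = quot_pi U (act a x).
Proof.
apply: quot_pi_eq; rewrite -actB.
by apply: submodP; rewrite -opprB rpredN quot_piK.
Qed.

Fact quot_act_bilinear : is_bilinear quot_act.
Proof.
have [mr ml] := act_bilinear M.
split=> [a c x y|x c a b]; rewrite /quot_act; last by rewrite ml linearP.
by rewrite linearP mr linearP.
Qed.
Fact quot_act1 q : quot_act 1 q = q.
Proof. by rewrite /quot_act act1 quot_reprK. Qed.
Fact quot_actM a b q : quot_act (a * b) q = quot_act a (quot_act b q).
Proof. by rewrite [quot_act b q]/quot_act quot_act_pi /quot_act actM. Qed.

Definition quot_mod : fdmodule A :=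
  FDModule quot_act_bilinear quot_act1 quot_actM.
End QuotMod.

(* For submodules W <= U of M, the subquotient U / W; in general U / (U :&: W). *)
Section SubQuotMod.
Variables (M : fdmodule A) (U W : submodule M).

Definition sub_in_space : {vspace sub_mod U} := (linfun vsval @^-1: W)%VS.

Fact sub_in_stable a (x : sub_mod U) :
  x \in sub_in_space -> act a x \in sub_in_space.
Proof. by rewrite /sub_in_space -!memv_preim !lfunE /=; apply: submodP. Qed.

Definition subquot : fdmodule A := quot_mod (SubModule sub_in_stable).
End SubQuotMod.

Definition is_hom M N (f : 'Hom(M, N)) : Prop :=
  forall a x, f (act a x) = act a (f x).

Definition iso M N : Prop :=
  exists f : 'Hom(M, N), [/\ is_hom f, lker f = 0%VS & limg f = fullv].

Definition simple_module M : Prop :=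
  {:M}%VS <> 0%VS /\
  forall U : submodule M, U = 0%VS :> {vspace M} \/ U = fullv :> {vspace M}.

(* All modules are finite-dimensional, so projectivity is the lifting property
   in the category of finite-dimensional modules. *)
Definition projective P : Prop :=
  forall M N (g : 'Hom(M, N)) (f : 'Hom(P, N)),
    is_hom g -> limg g = fullv -> is_hom f ->
  exists2 h : 'Hom(P, M), is_hom h & f = (g \o h)%VF.

(* A projective module with a surjection onto L whose kernel is superfluous. *)
Definition projective_cover P L : Prop :=
  projective P /\
  exists p : 'Hom(P, L), [/\ is_hom p, limg p = fullv &
    forall U : submodule P, (U + lker p)%VS = fullv -> U = fullv :> {vspace P}].

(* Hom_A(M, N) as a subspace of Hom_K(M, N). *)
Definition homs M N : {vspace 'Hom(M, N)} :=
  (\bigcap_(i < \dim {:A})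
    lker (linfun (fun f : 'Hom(M, N) =>
      ((f \o act_fun M (vbasis {:A})`_i) - (act_fun N (vbasis {:A})`_i \o f))%VF)))%VS.

Lemma homsP M N (f : 'Hom(M, N)) : f \in homs M N <-> is_hom f.
Proof.
have lE i : linear (fun f : 'Hom(M, N) =>
    ((f \o act_fun M (vbasis {:A})`_i) - (act_fun N (vbasis {:A})`_i \o f))%VF).
  move=> c g h; rewrite comp_lfunDl -comp_lfunZl comp_lfunDr -comp_lfunZr.
  by rewrite scalerBr opprD addrACA.
have hE : f \in homs M N <-> forall i : 'I_(\dim {:A}), forall x,
    f (act (vbasis {:A})`_i x) = act (vbasis {:A})`_i (f x).
  rewrite /homs memvE; split=> [/subv_bigcapP fh i x|fh].
    have := fh i isT; rewrite -memvE memv_ker (linfunE (lE i)) subr_eq0 => /eqP.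
    by move/lfunP/(_ x); rewrite !comp_lfunE !act_funE.
  apply/subv_bigcapP => i _; rewrite -memvE memv_ker (linfunE (lE i)) subr_eq0.
  by apply/eqP/lfunP => x; rewrite !comp_lfunE !act_funE.
split=> [/hE fh a x|fh]; last by apply/hE => i x; apply: fh.
rewrite (coord_vbasis (memvf a)) (linear_comb _ _ ((act_bilinear M).2 x)).
rewrite (linear_comb _ _ ((act_bilinear N).2 (f x))) linear_sum.
by apply: eq_bigr => i _; rewrite linearZ /= fh.
Qed.

(* End_A(M) is isomorphic to K as a K-algebra. *)
Definition end_iso_field M : Prop :=
  exists psi : K -> 'End(M),
    [/\ forall c a b, psi (c * a + b) = c *: psi a + psi b,
        psi 1 = \1%VF, forall a b, psi (a * b) = (psi a \o psi b)%VF,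
        injective psi &
        forall f, is_hom f <-> exists a, f = psi a].

End Modules.

Section QuasiHereditary.
Variables (K : fieldType) (A : falgType K).

(* [L] is a complete irredundant family of simple A-modules, i.e. its index
   type stands for Sim(A). *)
Definition is_Sim (I : Type) (L : I -> fdmodule A) : Prop :=
  [/\ forall i, simple_module (L i),
      forall i j, iso (L i) (L j) -> i = j &
      forall M, simple_module M -> exists i, iso M (L i)].

Variables (d : Order.disp_t) (I : finPOrderType d).

Section Standard.
(* [P i] stands for the projective cover of the simple module with index i. *)
Variable P : I -> fdmodule A.

Definition trace_space (i : I) : {vspace P i} :=
  (\sum_(j | ~~ (j <= i)%O) \sum_(f <- vbasis (homs (P j) (P i))) limg f)%VS.

(* Summing over a basis of Hom_A(P j, P i) is the same as summing over all f. *)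
Lemma trace_spaceP (i : I) (U : {vspace P i}) :
  (trace_space i <= U)%VS <->
  forall j (f : 'Hom(P j, P i)), ~~ (j <= i)%O -> is_hom f -> (limg f <= U)%VS.
Proof.
split=> [/subv_sumP sU j f ji /homsP fh|sU].
  apply/subvP => _ /memv_imgP[x _ ->].
  rewrite (coord_vbasis fh) sum_lfunE; apply: rpred_sum => m _.
  rewrite scale_lfunE rpredZ // (subvP (sU j ji)) //.
  have mem : (vbasis (homs (P j) (P i)))`_m \in
    (vbasis (homs (P j) (P i)) : seq _) by rewrite mem_nth ?size_tuple.
  apply: (subvP _ _ (memv_img _ (memvf x))).
  by rewrite (big_rem _ mem) addvSl.
apply/subv_sumP => j ji; rewrite big_seq; elim/big_ind: _ => [|V W VU WU|f fB].
- exact: sub0v.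
- by rewrite subv_add VU.
- by apply: (sU j f ji); apply/homsP/vbasis_mem.
Qed.

Fact trace_stable (i : I) a x : x \in trace_space i -> act a x \in trace_space i.
Proof.
suff : (trace_space i <= act_fun (P i) a @^-1: trace_space i)%VS.
  by move/subvP => /(_ x) h /h; rewrite -memv_preim act_funE.
apply/trace_spaceP => j f ji fh; apply/subvP => _ /memv_imgP[y _ ->].
rewrite -memv_preim act_funE -fh; apply: (subvP _ _ (memv_img _ (memvf _))).
exact: (proj1 (trace_spaceP (trace_space i)) (subvv _) j f ji fh).
Qed.

Definition trace_submod (i : I) : submodule (P i) := SubModule (@trace_stable i).

Definition standard (i : I) : fdmodule A := quot_mod (trace_submod i).

(* Filtrations with subquotients standard modules of index > i. *)
Definition standard_filtered (i : I) (M : fdmodule A) (U : submodule M) : Prop :=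
  exists (m : nat) (F : nat -> submodule M),
    [/\ F 0%N = 0%VS :> {vspace M}, F m = U :> {vspace M} &
        forall r, (r < m)%N -> (F r <= F r.+1)%VS /\
          exists2 j, (i < j)%O & iso (subquot (F r.+1) (F r)) (standard j)].

End Standard.

(* The kernel of P i -> standard P i is trace_submod P i, by [lker_quot_pi].
   Projective covers are unique up to isomorphism, so that the choice of P is
   immaterial. *)
Definition quasi_hereditary (L : I -> fdmodule A) : Prop :=
  is_Sim L /\
  exists2 P : I -> fdmodule A, (forall i, projective_cover (P i) (L i)) &
    forall i, end_iso_field (standard P i) /\
              standard_filtered P i (trace_submod P i).

End QuasiHereditary.

Record bimodule (K : fieldType) (A B : falgType K) := Bimodule {
  bim_sort :> vectType K;
  lact : A -> bim_sort -> bim_sort;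
  ract : bim_sort -> B -> bim_sort;
  lact_bilinear : is_bilinear lact;
  lact1 : forall x, lact 1 x = x;
  lactM : forall a b x, lact (a * b) x = lact a (lact b x);
  ract_bilinear : is_bilinear ract;
  ract1 : forall x, ract x 1 = x;
  ractM : forall x a b, ract x (a * b) = ract (ract x a) b;
  lract : forall a x b, ract (lact a x) b = lact a (ract x b) }.

Section Bimodules.
Variable K : fieldType.

Definition left_mod (A B : falgType K) (M : bimodule A B) : fdmodule A :=
  FDModule (lact_bilinear M) (@lact1 _ _ _ M) (@lactM _ _ _ M).

(* A right B-module is a left module over the opposite algebra B^c. *)
Section RightMod.
Variables (A B : falgType K) (M : bimodule A B).

Definition right_act (b : B^c) (x : M) : M := ract x b.

Fact right_act_bilinear : is_bilinear right_act.
Proof.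
by split=> [b|x]; [apply: (ract_bilinear M).2 | apply: (ract_bilinear M).1].
Qed.
Fact right_act1 x : right_act 1 x = x. Proof. exact: ract1. Qed.
Fact right_actM a b x : right_act (a * b) x = right_act a (right_act b x).
Proof. exact: ractM. Qed.

Definition right_mod : fdmodule B^c :=
  FDModule right_act_bilinear right_act1 right_actM.
End RightMod.

Section Regular.
Variable A : falgType K.

Fact mul_bilinear : is_bilinear (fun x y : A => x * y).
Proof.
split=> [x c y z|x c y z]; first by rewrite mulrDr scalerAr.
by rewrite mulrDl scalerAl.
Qed.

Definition regular_bim : bimodule A A :=
  @Bimodule K A A A (fun x y => x * y) (fun x y => x * y)
    mul_bilinear (@mul1r A) (fun a b x => esym (mulrA a b x))
    mul_bilinear (@mulr1 A) (@mulrA A) (fun a x b => esym (mulrA a x b)).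
End Regular.

(* M ⊗_B N is the quotient of M ⊗_K N by the span of all (xb) ⊗ y - x ⊗ (by);
   the generators of this span are obtained as images of the linear maps
   x ⊗ y |-> (xb) ⊗ y - x ⊗ (by) with b in a basis of B. *)
Section TensorProduct.
Variables (A B C : falgType K) (M : bimodule A B) (N : bimodule B C).

Definition balanced (U : vectType K) (f : M -> N -> U) : Prop :=
  forall x b y, f (ract x b) y = f x (lact b y).

Definition tens_defect (b : B) : 'End(tensk M N) :=
  tensk_lift (fun x y => tensk_pure (ract x b) y - tensk_pure x (lact b y)).

Definition tens_rel : {vspace tensk M N} :=
  (\sum_(b <- vbasis {:B}) limg (tens_defect b))%VS.

Definition tens_space : vectType K := quotv tens_rel.

Definition tens_pure (x : M) (y : N) : tens_space :=
  quot_pi tens_rel (tensk_pure x y).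

Definition tens_lift (U : vectType K) (f : M -> N -> U) : 'Hom(tens_space, U) :=
  (tensk_lift f \o quot_repr tens_rel)%VF.

Lemma tens_defectE b x y : tens_defect b (tensk_pure x y) =
  tensk_pure (ract x b) y - tensk_pure x (lact b y).
Proof.
rewrite tensk_lift_pure //.
have [pr pl] := tensk_pureP M N.
have [rr rl] := ract_bilinear M; have [lr ll] := lact_bilinear N.
split=> [{}x c u v|{}y c u v].
  by rewrite lr !pr scalerBr opprD addrACA.
by rewrite rl !pl scalerBr opprD addrACA.
Qed.

Lemma tens_pure_bilinear : is_bilinear tens_pure.
Proof.
have [pr pl] := tensk_pureP M N.
by split=> [x c u v|y c u v]; rewrite /tens_pure ?pr ?pl linearP.
Qed.

Lemma tens_pure_balanced : balanced tens_pure.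
Proof.
move=> x b y; apply: quot_pi_eq.
have [pr pl] := tensk_pureP M N.
have [rr rl] := ract_bilinear M; have [lr ll] := lact_bilinear N.
rewrite (coord_vbasis (memvf b)) (linear_comb _ _ (rr x)).
rewrite (linear_comb _ _ (ll y)) (linear_comb _ _ (pl y)).
rewrite (linear_comb _ _ (pr x)) -sumrB; apply: rpred_sum => i _.
rewrite -scalerBr rpredZ // -tens_defectE.
apply: (subvP _ _ (memv_img _ (memvf _))).
have mem : (vbasis {:B})`_i \in (vbasis {:B} : seq _) by rewrite mem_nth ?size_tuple.
by rewrite /tens_rel (big_rem _ mem) addvSl.
Qed.

Lemma tens_liftE (U : vectType K) (f : M -> N -> U) :
  is_bilinear f -> balanced f ->
  forall x y, tens_lift f (tens_pure x y) = f x y.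
Proof.
move=> fbil fbal x y; rewrite comp_lfunE -(tensk_lift_pure fbil); apply/eqP.
rewrite eq_sym -subr_eq0 -linearB -memv_ker; apply: subvP (quot_piK _ _).
rewrite /tens_rel big_seq; elim/big_ind: _ => [|V W VU WU|b bB].
- exact: sub0v.
- by rewrite subv_add VU.
apply/subvP => _ /memv_imgP[z _ ->]; rewrite memv_ker -comp_lfunE.
suff -> : (tensk_lift f \o tens_defect b)%VF = 0 by rewrite lfunE.
apply: tensk_ext => u v; rewrite comp_lfunE tens_defectE linearB /=.
by rewrite !tensk_lift_pure // fbal subrr lfunE.
Qed.

Lemma tens_ext (U : vectType K) (f g : 'Hom(tens_space, U)) :
  (forall x y, f (tens_pure x y) = g (tens_pure x y)) -> f =1 g.
Proof.
move=> fg q; have e : (f \o quot_pi tens_rel)%VF = (g \o quot_pi tens_rel)%VF.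
  apply: tensk_ext => x y; rewrite comp_lfunE [RHS]comp_lfunE; exact: fg.
move/lfunP/(_ (quot_repr _ q)): e.
by rewrite comp_lfunE [RHS]comp_lfunE quot_reprK.
Qed.

Lemma tens_ext_lin (U : vectType K) (f g : tens_space -> U) :
  linear f -> linear g ->
  (forall x y, f (tens_pure x y) = g (tens_pure x y)) -> f =1 g.
Proof.
move=> lf lg fg q; rewrite -(linfunE lf) -(linfunE lg).
by apply: tens_ext => x y; rewrite !linfunE.
Qed.

Definition tens_lact (a : A) : tens_space -> tens_space :=
  tens_lift (fun x y => tens_pure (lact a x) y).
Definition tens_ract (t : tens_space) (c : C) : tens_space :=
  tens_lift (fun x y => tens_pure x (ract y c)) t.

Lemma tens_lactE a x y : tens_lact a (tens_pure x y) = tens_pure (lact a x) y.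
Proof.
have [pr pl] := tens_pure_bilinear; have [lr ll] := lact_bilinear M.
rewrite /tens_lact tens_liftE //; first split=> [u|v c u u'] /=.
- exact: pr.
- by rewrite lr pl.
- by move=> u b v; rewrite -lract tens_pure_balanced.
Qed.

Lemma tens_ractE x y c : tens_ract (tens_pure x y) c = tens_pure x (ract y c).
Proof.
have [pr pl] := tens_pure_bilinear; have [rr rl] := ract_bilinear N.
rewrite /tens_ract tens_liftE //; first split=> [u e v v'|v] /=.
- by rewrite rl pr.
- exact: pl.
- by move=> u b v; rewrite lract tens_pure_balanced.
Qed.

Fact tens_lact_bilinear : is_bilinear tens_lact.
Proof.
split=> [a|t c a b]; first exact: linearP.
move: t; apply: tens_ext_lin => [e u v||x y].
- by rewrite /tens_lact linearP.
- by apply: linear_lincomb => ? ? ?; rewrite /tens_lact linearP.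
- by rewrite !tens_lactE (lact_bilinear M).2 (tens_pure_bilinear).2.
Qed.
Fact tens_lact1 t : tens_lact 1 t = t.
Proof.
by move: t; apply: tens_ext_lin => // [|x y]; [exact: linearP | rewrite tens_lactE lact1].
Qed.
Fact tens_lactM a b t : tens_lact (a * b) t = tens_lact a (tens_lact b t).
Proof.
move: t; apply: tens_ext_lin => [e u v|e u v|x y]; last by rewrite !tens_lactE lactM.
  by rewrite /tens_lact linearP.
by rewrite /tens_lact !linearP.
Qed.
Fact tens_ract_bilinear : is_bilinear tens_ract.
Proof.
split=> [t c a b|a]; last exact: linearP.
move: t; apply: tens_ext_lin => [e u v||x y].
- by rewrite /tens_ract linearP.
- by apply: linear_lincomb => ? ? ?; rewrite /tens_ract linearP.
- by rewrite !tens_ractE (ract_bilinear N).1 (tens_pure_bilinear).1.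
Qed.
Fact tens_ract1 t : tens_ract t 1 = t.
Proof.
by move: t; apply: tens_ext_lin => // [|x y]; [exact: linearP | rewrite tens_ractE ract1].
Qed.
Fact tens_ractM t a b : tens_ract t (a * b) = tens_ract (tens_ract t a) b.
Proof.
move: t; apply: tens_ext_lin => [e u v|e u v|x y]; last by rewrite !tens_ractE ractM.
  by rewrite /tens_ract linearP.
by rewrite /tens_ract !linearP.
Qed.
Fact tens_lract a t c : tens_ract (tens_lact a t) c = tens_lact a (tens_ract t c).
Proof.
move: t; apply: tens_ext_lin => [e u v|e u v|x y].
- by rewrite /tens_ract /tens_lact !linearP.
- by rewrite /tens_ract /tens_lact !linearP.
- by rewrite tens_lactE !tens_ractE tens_lactE.
Qed.

Definition tens : bimodule A C :=
  Bimodule tens_lact_bilinear tens_lact1 tens_lactM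
    tens_ract_bilinear tens_ract1 tens_ractM tens_lract.

End TensorProduct.
End Bimodules.

Record quiver (n : nat) := Quiver {
  arrow :> finType;
  source : arrow -> 'I_n;
  target : arrow -> 'I_n }.

(* [qpath Q i j] is the type of paths from i to j; [qcons a p] is the path
   traversing first p and then a. *)
Inductive qpath (n : nat) (Q : quiver n) (i : 'I_n) : 'I_n -> Type :=
| qtriv : qpath Q i i
| qcons (a : Q) (p : qpath Q i (source a)) : qpath Q i (target a).

Arguments qtriv {n Q}.
Arguments qcons {n Q i}.

Section Paths.
Variables (n : nat) (Q : quiver n).

Fixpoint arrows i j (p : qpath Q i j) : seq Q :=
  if p is qcons a q then a :: arrows q else [::].

Fixpoint path_max i j (p : qpath Q i j) : nat :=
  if p is qcons a q then maxn (target a) (path_max q) else i.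

(* [qcat p q] is the path pq, which traverses first q and then p. *)
Fixpoint qcat i j l (p : qpath Q j l) : qpath Q i j -> qpath Q i l :=
  match p in qpath _ _ l return qpath Q i j -> qpath Q i l with
  | qtriv => fun q => q
  | qcons a p' => fun q => qcons a (qcat p' q)
  end.

Lemma qcatA i j l m (p : qpath Q l m) (q : qpath Q j l) (r : qpath Q i j) :
  qcat p (qcat q r) = qcat (qcat p q) r.
Proof. by elim: p => //= a p' IH; rewrite IH. Qed.

Lemma qcat_triv i j (p : qpath Q i j) : qcat p (qtriv i) = p.
Proof. by elim: p => //= a p' IH; rewrite IH. Qed.

(* There are no oriented cycles: closed paths are trivial. *)
Definition acyclic : Prop :=
  forall i (p : qpath Q i i), arrows p = [::].

Fixpoint decode_from (i : 'I_n) (w : seq Q) : option {j : 'I_n & qpath Q i j} :=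
  if w is a :: w' then
    if decode_from i w' is Some (existT j q) then
      match j =P source a with
      | ReflectT e => Some (existT _ (target a) (qcons a (ecast j (qpath Q i j) e q)))
      | ReflectF _ => None
      end
    else None
  else Some (existT _ i (qtriv i)).

Lemma decode_fromK i j (p : qpath Q i j) : decode_from i (arrows p) = Some (existT _ j p).
Proof.
elim: p => //= a p ->; case: eqP => // e.
by rewrite (eq_axiomK e).
Qed.

Definition decode (i j : 'I_n) (w : seq Q) : option (qpath Q i j) :=
  if decode_from i w is Some (existT l q) then
    match l =P j with
    | ReflectT e => Some (ecast l (qpath Q i l) e q)
    | ReflectF _ => None
    end
  else None.

Lemma decodeK i j (p : qpath Q i j) : decode i j (arrows p) = Some p.
Proof.
by rewrite /decode decode_fromK; case: eqP => // e; rewrite (eq_axiomK e).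
Qed.

Fixpoint vertices i j (p : qpath Q i j) : seq 'I_n :=
  if p is qcons a q then target a :: vertices q else [:: i].

Lemma size_vertices i j (p : qpath Q i j) : size (vertices p) = (size (arrows p)).+1.
Proof. by elim: p => //= a p ->. Qed.

Lemma vertices_subpath i j (p : qpath Q i j) v :
  v \in vertices p -> exists q : qpath Q v j, True.
Proof.
elim: p => [|a p IH] /=; first by rewrite inE => /eqP ->; exists (qtriv i).
rewrite inE => /orP[/eqP ->|/IH [q _]]; first by exists (qtriv (target a)).
by exists (qcons a q).
Qed.

Lemma acyclic_size : acyclic -> forall i j (p : qpath Q i j), (size (arrows p) <= n)%N.
Proof.
move=> acQ i j p; have : uniq (vertices p).
  elim: p => //= a p ->; rewrite andbT; apply/negP => /vertices_subpath[q _].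
  by have := acQ _ (qcons a q).
move/card_uniqP => e; have := max_card (mem (vertices p)).
by rewrite e card_ord size_vertices => /ltnW.
Qed.

End Paths.

Record acyclic_quiver (n : nat) := AcyclicQuiver {
  aq_quiver :> quiver n;
  aq_acyclic : acyclic aq_quiver }.

Section FinPaths.
Variables (n : nat) (Q : acyclic_quiver n) (i j : 'I_n).

Definition encode (p : qpath Q i j) : n.-bseq Q :=
  Bseq (acyclic_size (@aq_acyclic n Q) p).

Lemma encodeK : pcancel encode (fun w => decode i j w).
Proof. exact: decodeK. Qed.

HB.instance Definition _ := Finite.copy (qpath Q i j) (pcan_type encodeK).
End FinPaths.


Section DirectSum.
Variables (K : fieldType) (P : finType) (V : P -> vectType K).

Definition dsum : Type := {dffun forall p : P, V p}.

HB.instance Definition _ := Choice.on dsum.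

Definition dsum_mk (x : forall p, V p) : dsum := [ffun p => x p].
Definition dsum_val (x : dsum) : forall p, V p := fun p => x p.

Lemma dsum_mkE x p : dsum_val (dsum_mk x) p = x p.
Proof. by rewrite /dsum_val ffunE. Qed.

Lemma dsumP (x y : dsum) : (forall p, dsum_val x p = dsum_val y p) -> x = y.
Proof. by move=> xy; apply/ffunP. Qed.

Definition dsum_add (x y : dsum) := dsum_mk (fun p => dsum_val x p + dsum_val y p).
Definition dsum_opp (x : dsum) := dsum_mk (fun p => - dsum_val x p).
Definition dsum_zero := dsum_mk (fun p => 0).
Definition dsum_scale (c : K) (x : dsum) := dsum_mk (fun p => c *: dsum_val x p).

Fact dsum_addA : associative dsum_add.
Proof. by move=> x y z; apply: dsumP => p; rewrite !dsum_mkE addrA. Qed.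
Fact dsum_addC : commutative dsum_add.
Proof. by move=> x y; apply: dsumP => p; rewrite !dsum_mkE addrC. Qed.
Fact dsum_add0 : left_id dsum_zero dsum_add.
Proof. by move=> x; apply: dsumP => p; rewrite !dsum_mkE add0r. Qed.
Fact dsum_addN : left_inverse dsum_zero dsum_opp dsum_add.
Proof. by move=> x; apply: dsumP => p; rewrite !dsum_mkE addNr. Qed.
HB.instance Definition _ :=
  GRing.isZmodule.Build dsum dsum_addA dsum_addC dsum_add0 dsum_addN.

Fact dsum_scaleA a b x : dsum_scale a (dsum_scale b x) = dsum_scale (a * b) x.
Proof. by apply: dsumP => p; rewrite !dsum_mkE scalerA. Qed.
Fact dsum_scale1 : left_id 1 dsum_scale.
Proof. by move=> x; apply: dsumP => p; rewrite !dsum_mkE scale1r. Qed.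
Fact dsum_scaleDr : right_distributive dsum_scale +%R.
Proof. by move=> c x y; apply: dsumP => p; rewrite !dsum_mkE scalerDr. Qed.
Fact dsum_scaleDl x : {morph dsum_scale^~ x : a b / a + b}.
Proof. by move=> a b; apply: dsumP => p; rewrite !dsum_mkE scalerDl. Qed.
HB.instance Definition _ := GRing.Zmodule_isLmodule.Build K dsum
  dsum_scaleA dsum_scale1 dsum_scaleDr dsum_scaleDl.

Lemma dsum_val_linear p : linear (fun x : dsum => dsum_val x p).
Proof. by move=> c x y; rewrite !dsum_mkE. Qed.

Fact dsum_vect_iso :
  Vector.axiom #|{: {p : P & 'I_(\dim {:V p})}}| dsum.
Proof.
pose T : finType := {p : P & 'I_(\dim {:V p})}.
pose f (x : dsum) : 'rV[K]_#|T| := \row_(t < #|T|)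
  coord (vbasis {:V (tag (enum_val t))}) (tagged (enum_val t))
        (dsum_val x (tag (enum_val t))).
pose g (r : 'rV[K]_#|T|) : dsum := dsum_mk (fun p =>
  \sum_j r 0 (enum_rank (existT (fun p => 'I_(\dim {:V p})) p j)) *:
         (vbasis {:V p})`_j).
exists f => [c x y|].
  by apply/rowP => t; rewrite !mxE dsum_val_linear linearP.
exists g => [x|r].
  apply: dsumP => p; rewrite dsum_mkE [RHS](coord_vbasis (memvf _)).
  by apply: eq_bigr => j _; rewrite mxE enum_rankK.
apply/rowP => t; rewrite mxE dsum_mkE coord_sum_free ?(basis_free (vbasisP _)) //.
by rewrite -[in RHS](enum_valK t); congr (r 0 (enum_rank _)); case: (enum_val t).
Qed.
HB.instance Definition _ := Lmodule_hasFinDim.Build K dsum dsum_vect_iso.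

Definition dsum_inj (p : P) (x : V p) : dsum := dsum_mk (fun q =>
  if p =P q is ReflectT e then ecast q (V q) e x else 0).

Lemma dsum_inj_id p x : dsum_val (dsum_inj x) p = x.
Proof. by rewrite dsum_mkE; case: eqP => // e; rewrite (eq_axiomK e). Qed.

Lemma dsum_inj_neq p q (x : V p) : p != q -> dsum_val (dsum_inj x) q = 0.
Proof. by rewrite dsum_mkE; case: eqP. Qed.

Lemma dsum_inj_linear p : linear (@dsum_inj p).
Proof.
move=> c x y; apply: dsumP => q; rewrite dsum_val_linear.
have [e|pq] := eqVneq p q; last by rewrite !dsum_inj_neq // scaler0 addr0.
by case: q / e; rewrite !dsum_inj_id.
Qed.

Lemma dsum_sum (J : finType) (F : J -> dsum) p :
  dsum_val (\sum_j F j) p = \sum_j dsum_val (F j) p.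
Proof.
have := @linear_comb K dsum (V p) _ J (fun=> 1) F (@dsum_val_linear p).
by under eq_bigr do rewrite scale1r; under [RHS]eq_bigr do rewrite scale1r.
Qed.

Lemma dsum_decomp (x : dsum) : x = \sum_p dsum_inj (dsum_val x p).
Proof.
apply: dsumP => q; rewrite dsum_sum (bigD1 q) //= dsum_inj_id big1 ?addr0 //.
by move=> p pq; rewrite dsum_inj_neq.
Qed.

Lemma dsum_ext (W : vectType K) (f g : dsum -> W) : linear f -> linear g ->
  (forall p (x : V p), f (dsum_inj x) = g (dsum_inj x)) -> f =1 g.
Proof.
move=> lf lg fg x; rewrite -(linfunE lf) -(linfunE lg) (dsum_decomp x) !linear_sum.
by apply: eq_bigr => p _ /=; rewrite !linfunE.
Qed.

End DirectSum.

Record species (K : fieldType) (n : nat) (Q : quiver n) := Species {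
  sp_alg :> 'I_n -> falgType K;
  sp_bim : forall a : Q, bimodule (sp_alg (target a)) (sp_alg (source a)) }.

Section PathBimodules.
Variables (K : fieldType) (n : nat) (Q : quiver n) (S : species K Q).

(* [ext_bim N p X] is N if p is trivial and N ⊗ X otherwise; it is used with
   X = M_p, so as to have M_(a p) = M_a when p is trivial. *)
Definition ext_bim i j l (N : bimodule (S l) (S j)) (p : qpath Q i j)
    (X : bimodule (S j) (S i)) : bimodule (S l) (S i) :=
  match p in qpath _ _ j
    return bimodule (S l) (S j) -> bimodule (S j) (S i) -> bimodule (S l) (S i)
  with
  | qtriv => fun N _ => N
  | qcons _ _ => fun N X => tens N X
  end N X.

Fixpoint path_bim i j (p : qpath Q i j) : bimodule (S j) (S i) :=
  match p in qpath _ _ j return bimodule (S j) (S i) with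
  | qtriv => regular_bim (S i)
  | qcons a q => ext_bim (sp_bim S a) q (path_bim q)
  end.

(* The element x ⊗ y of N ⊗ M_p, or x y of N if p is trivial. *)
Definition ext_pure i j l (p : qpath Q i j) : forall N : bimodule (S l) (S j),
    N -> path_bim p -> ext_bim N p (path_bim p) :=
  match p in qpath _ _ j return forall N : bimodule (S l) (S j),
    N -> path_bim p -> ext_bim N p (path_bim p)
  with
  | qtriv => fun N x y => ract x y
  | qcons a q => fun N x y => tens_pure x y
  end.

(* The linear map with x ⊗ y |-> f x y, for f bilinear and balanced. *)
Definition ext_lift (W : vectType K) i j l (p : qpath Q i j) :
    forall N : bimodule (S l) (S j),
    (N -> path_bim p -> W) -> ext_bim N p (path_bim p) -> W :=
  match p in qpath _ _ j return forall N : bimodule (S l) (S j),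
    (N -> path_bim p -> W) -> ext_bim N p (path_bim p) -> W
  with
  | qtriv => fun N f x => f x 1
  | qcons a q => fun N f x => tens_lift f x
  end.

Section Ext.
Variables (i j l : 'I_n) (N : bimodule (S l) (S j)) (p : qpath Q i j).
Local Notation NX := (ext_bim N p (path_bim p)).

Lemma ext_pure_bilinear : is_bilinear (@ext_pure i j l p N).
Proof.
case: p N => [|a q] N' /=; last exact: tens_pure_bilinear.
exact: ract_bilinear.
Qed.

Lemma ext_pure_balanced : balanced (@ext_pure i j l p N).
Proof.
case: p N => [|a q] N' /=; last exact: tens_pure_balanced.
by move=> x b y; rewrite /= ractM.
Qed.

Lemma ext_lact a x y :
  lact a (ext_pure x y : NX) = ext_pure (lact a x) y.
Proof.
case: p N x y => [|? q] N' /= x y; last exact: tens_lactE.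
by rewrite lract.
Qed.

Lemma ext_ract x y b :
  ract (ext_pure x y : NX) b = ext_pure x (ract y b).
Proof.
case: p N x y => [|? q] N' /= x y; last exact: tens_ractE.
by rewrite ractM.
Qed.

Lemma ext_liftE (W : vectType K) (f : N -> path_bim p -> W) :
  is_bilinear f -> balanced f -> forall x y, ext_lift f (ext_pure x y) = f x y.
Proof.
case: p N f => [|a q] N' /= f fbil fbal x y; last exact: tens_liftE.
by rewrite fbal /= mulr1.
Qed.

Lemma ext_lift_linear (W : vectType K) (f : N -> path_bim p -> W) :
  is_bilinear f -> linear (ext_lift f).
Proof.
case: p N f => [|a q] N' /= f fbil c x y; last exact: linearP.
by rewrite fbil.2.
Qed.

Lemma ext_ext (W : vectType K) (f g : NX -> W) : linear f -> linear g ->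
  (forall x y, f (ext_pure x y) = g (ext_pure x y)) -> f =1 g.
Proof.
case: p N f g => [|a q] N' /= f g lf lg fg; last exact: tens_ext_lin.
by move=> x; have := fg x 1; rewrite ract1.
Qed.

End Ext.

(* The product M_p x M_q -> M_(pq); see [path_mul_triv], [path_mul_cons] and
   [path_mul_trivr] for its characterisation. *)
Fixpoint path_mul i j l (p : qpath Q j l) : forall q : qpath Q i j,
    path_bim p -> path_bim q -> path_bim (qcat p q) :=
  match p in qpath _ _ l return forall q : qpath Q i j,
    path_bim p -> path_bim q -> path_bim (qcat p q)
  with
  | qtriv => fun q x y => lact x y
  | qcons a p' => fun q z y =>
      ext_lift (fun m x => ext_pure m (path_mul x y)
                  : path_bim (qcat (qcons a p') q)) z
  end.

Lemma path_mul_triv i j (q : qpath Q i j) (x : S j) (y : path_bim q) :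
  path_mul (x : path_bim (qtriv j)) y = lact x y.
Proof. by []. Qed.

Fact path_mul_spec i j l (p : qpath Q j l) (q : qpath Q i j) :
  is_bilinear (@path_mul i j l p q) /\
  forall b x y, path_mul (lact b x) y = lact b (path_mul x y) :> path_bim (qcat p q).
Proof.
elim: p q => [|a p IH] q /=.
  by split=> [|b x y]; [exact: lact_bilinear | exact: lactM].
have [[mr ml] mb] := IH q.
have [pr pl] := ext_pure_bilinear (sp_bim S a) (qcat p q).
have [qr ql] := ext_pure_bilinear (sp_bim S a) p.
pose F y (m : sp_bim S a) x : path_bim (qcat (qcons a p) q) :=
  ext_pure m (path_mul x y).
have Fbil y : is_bilinear (F y).
  by split=> [m c u v|u c m m']; rewrite /F ?ml ?pr ?pl.
have Fbal y : balanced (F y).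
  by move=> m b x; rewrite /F ext_pure_balanced mb.
have Flin y := ext_lift_linear (Fbil y).
split=> [|b z y].
  split=> [z c u v|y]; last exact: Flin.
  move: z; apply: ext_ext => [||m x]; first exact: Flin.
    by apply: linear_lincomb; apply: Flin.
  by rewrite !(ext_liftE (Fbil _) (Fbal _)) /F mr pr.
move: z; apply: ext_ext => [c u v|c u v|m x].
- by rewrite (lact_bilinear _).1 Flin.
- by rewrite Flin (lact_bilinear _).1.
- by rewrite ext_lact !(ext_liftE (Fbil y) (Fbal y)) /F ext_lact.
Qed.

Lemma path_mul_bilinear i j l (p : qpath Q j l) (q : qpath Q i j) :
  is_bilinear (@path_mul i j l p q).
Proof. by case: (path_mul_spec p q). Qed.

Lemma path_mul_cons i j a (p : qpath Q j (source a)) (q : qpath Q i j)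
    (m : sp_bim S a) (x : path_bim p) (y : path_bim q) :
  path_mul (ext_pure m x : path_bim (qcons a p)) y = ext_pure m (path_mul x y).
Proof.
have [[mr ml] mb] := path_mul_spec p q.
have [pr pl] := ext_pure_bilinear (sp_bim S a) (qcat p q).
rewrite /= ext_liftE //.
  by split=> [u c v w|v c u w] /=; rewrite ?ml ?pr ?pl.
by move=> u b v /=; rewrite ext_pure_balanced mb.
Qed.

End PathBimodules.

Section TensorAlgebra.
Variables (K : fieldType) (n : nat) (Q : acyclic_quiver n.+1) (S : species K Q).

Definition pcast i j (p q : qpath Q i j) (e : p = q) (x : path_bim S p) :
  path_bim S q := ecast p (path_bim S p) e x.

Lemma pcast_linear i j (p q : qpath Q i j) (e : p = q) : linear (pcast e).
Proof. by case: q / e. Qed.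

Lemma pcast_lact i j (p q : qpath Q i j) (e : p = q) b x :
  pcast e (lact b x) = lact b (pcast e x).
Proof. by case: q / e. Qed.

Lemma pcast_ext_pure i a (p q : qpath Q i (source a)) (e : p = q)
    (e' : qcons a p = qcons a q) (m : sp_bim S a) x :
  pcast e' (ext_pure m x : path_bim S (qcons a p)) = ext_pure m (pcast e x).
Proof. by case: q / e e' => e'; rewrite (eq_axiomK e'). Qed.

Lemma path_mulA i j l m (p : qpath Q l m) (q : qpath Q j l) (r : qpath Q i j)
    (e : qcat p (qcat q r) = qcat (qcat p q) r)
    (x : path_bim S p) (y : path_bim S q) (z : path_bim S r) :
  pcast e (path_mul x (path_mul y z)) = path_mul (path_mul x y) z.
Proof.
elim: p q e x y => [|a p IH] q e x y.
  rewrite (eq_axiomK e) /=; symmetry; exact: (path_mul_spec S q r).2.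
move: x; apply: ext_ext => [c u v|c u v|m' x].
- by rewrite (path_mul_bilinear S (qcons a p) _).2 pcast_linear.
- by rewrite (path_mul_bilinear S (qcons a p) _).2 (path_mul_bilinear S (qcat (qcons a p) _) _).2.
rewrite !path_mul_cons (pcast_ext_pure (qcatA p q r)) IH.
by rewrite -path_mul_cons.
Qed.

(* If q is trivial, the product is given by the right action. *)
Lemma path_mul_trivr i j (p : qpath Q i j) (e : qcat p (qtriv i) = p)
    (x : path_bim S p) (b : S i) :
  pcast e (path_mul x (b : path_bim S (qtriv i))) = ract x b.
Proof.
elim: p e x => [|a p IH] e x; first by rewrite (eq_axiomK e).
move: x; apply: ext_ext => [c u v|c u v|m x].
- by rewrite (path_mul_bilinear S (qcons a p) _).2 pcast_linear.
- by rewrite (ract_bilinear _).2.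
rewrite path_mul_cons (pcast_ext_pure (qcat_triv p)) IH.
by rewrite ext_ract.
Qed.

Definition tensor_algebra : Type :=
  @dsum K {ij : 'I_n.+1 * 'I_n.+1 & qpath Q ij.1 ij.2}
    (fun p => bim_sort (path_bim S (tagged p))).

HB.instance Definition _ := Vector.on tensor_algebra.

Definition ta_inj i j (p : qpath Q i j) (x : path_bim S p) : tensor_algebra :=
  @dsum_inj K {ij : 'I_n.+1 * 'I_n.+1 & qpath Q ij.1 ij.2}
    (fun p => bim_sort (path_bim S (tagged p)))
    (existT (fun ij => qpath Q ij.1 ij.2) (i, j) p) x.

Definition ta_proj i j (p : qpath Q i j) (x : tensor_algebra) : path_bim S p :=
  dsum_val x (existT (fun ij => qpath Q ij.1 ij.2) (i, j) p).

(* M_p * M_q is contained in M_(pq) and given by path_mul when the start of p is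
   the end of q, see [ta_mul_inj]; otherwise it vanishes, see [ta_mul_inj0]. *)
Definition ta_mul (x y : tensor_algebra) : tensor_algebra :=
  \sum_i \sum_j \sum_l \sum_(p : qpath Q j l) \sum_(q : qpath Q i j)
    ta_inj (path_mul (ta_proj p x) (ta_proj q y)).

Definition ta_one : tensor_algebra :=
  \sum_i ta_inj (p := qtriv i) (1 : S i).

Local Notation TA := tensor_algebra.
Local Notation tagp p :=
  (existT (fun ij : 'I_n.+1 * 'I_n.+1 => qpath Q ij.1 ij.2) (_, _) p).

Local Notation TV := (fun t : {ij : 'I_n.+1 * 'I_n.+1 & qpath Q ij.1 ij.2} =>
  bim_sort (path_bim S (tagged t))).

Lemma ta_injK i j (p : qpath Q i j) x : ta_proj p (ta_inj x) = x.
Proof. exact: (@dsum_inj_id K _ TV (tagp p)). Qed.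

Lemma ta_inj_neq i j (p : qpath Q i j) i' j' (p' : qpath Q i' j') x :
  tagp p != tagp p' -> ta_proj p' (ta_inj (p := p) x) = 0.
Proof. exact: (@dsum_inj_neq K _ TV (tagp p) (tagp p')). Qed.

Lemma ta_inj_linear i j (p : qpath Q i j) : linear (@ta_inj i j p).
Proof. exact: (@dsum_inj_linear K _ TV (tagp p)). Qed.

Lemma ta_proj_linear i j (p : qpath Q i j) : linear (@ta_proj i j p).
Proof. exact: (@dsum_val_linear K _ TV (tagp p)). Qed.

Lemma ta_proj_sum (J : finType) (F : J -> TA) i j (p : qpath Q i j) :
  ta_proj p (\sum_t F t) = \sum_t ta_proj p (F t).
Proof. exact: (@dsum_sum K _ TV J F (tagp p)). Qed.

Lemma ta_inj_pcast i j (p q : qpath Q i j) (e : p = q) x :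
  ta_inj (pcast e x) = ta_inj x.
Proof. by case: q / e. Qed.

Lemma ta_ext (W : vectType K) (f g : TA -> W) : linear f -> linear g ->
  (forall i j (p : qpath Q i j) x, f (ta_inj (p := p) x) = g (ta_inj x)) ->
  f =1 g.
Proof.
move=> lf lg fg; apply: dsum_ext => // -[[i j] p] x; exact: fg.
Qed.

Lemma ta_term0 i j l (p : qpath Q j l) (q : qpath Q i j)
    i0 j0 j1 l0 (p0 : qpath Q j1 l0) (q0 : qpath Q i0 j0) x y :
  tagp p0 != tagp p \/ tagp q0 != tagp q ->
  ta_inj (path_mul (ta_proj p (ta_inj (p := p0) x))
                   (ta_proj q (ta_inj (p := q0) y))) = 0.
Proof.
have [mr ml] := path_mul_bilinear S p q.
case=> ne; rewrite (ta_inj_neq _ ne).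
  by rewrite (linear0_of (ml _)) (linear0_of (@ta_inj_linear _ _ _)).
by rewrite (linear0_of (mr _)) (linear0_of (@ta_inj_linear _ _ _)).
Qed.

Lemma ta_mul_inj i j l (p : qpath Q j l) (q : qpath Q i j) x y :
  ta_mul (ta_inj (p := p) x) (ta_inj (p := q) y) = ta_inj (path_mul x y).
Proof.
rewrite /ta_mul (bigD1 i) //= (bigD1 j) //= (bigD1 l) //= (bigD1 p) //= (bigD1 q) //=.
rewrite !big1 ?addr0; try by rewrite !ta_injK.
- move=> i' ne; do 4?[rewrite big1 // => ? _].
  by apply: ta_term0; right; apply: contraNneq ne => /(congr1 (fun t => (tag t).1)) /= ->.
- move=> j' ne; do 3?[rewrite big1 // => ? _].
  by apply: ta_term0; right; apply: contraNneq ne => /(congr1 (fun t => (tag t).2)) /= ->.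
- move=> l' ne; do 2?[rewrite big1 // => ? _].
  by apply: ta_term0; left; apply: contraNneq ne => /(congr1 (fun t => (tag t).2)) /= ->.
- move=> p' ne; rewrite big1 // => q' _.
  by apply: ta_term0; left; rewrite -tag_eqE /tag_eq eqxx /= tagged_asE eq_sym.
- move=> q' ne.
  by apply: ta_term0; right; rewrite -tag_eqE /tag_eq eqxx /= tagged_asE eq_sym.
Qed.

Lemma ta_mul_inj0 i j j' l (p : qpath Q j l) (q : qpath Q i j') x y : j != j' ->
  ta_mul (ta_inj (p := p) x) (ta_inj (p := q) y) = 0.
Proof.
move=> ne; rewrite /ta_mul big1 // => i1 _; rewrite big1 // => j1 _.
rewrite big1 // => l1 _; rewrite big1 // => p1 _; rewrite big1 // => q1 _.
apply: ta_term0; have [ej|nej] := eqVneq j j1.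
  right; apply: contraNneq ne => /(congr1 (fun t => (tag t).2)) /= ->.
  by rewrite ej.
by left; apply: contraNneq nej => /(congr1 (fun t => (tag t).1)) /= ->.
Qed.

Lemma ta_mul_bilinear : is_bilinear ta_mul.
Proof.
split=> [x|y]; rewrite /ta_mul; do 5![apply: linear_sumf => ?] => c u v.
  by rewrite ta_proj_linear (path_mul_bilinear S _ _).1 ta_inj_linear.
by rewrite ta_proj_linear (path_mul_bilinear S _ _).2 ta_inj_linear.
Qed.

Fact ta_mulA : associative ta_mul.
Proof.
have [mr ml] := ta_mul_bilinear.
move=> x y z; move: x; apply: ta_ext => [c u v|c u v|j l p x].
- by rewrite ml.
- by rewrite !ml.
move: y; apply: ta_ext => [c u v|c u v|i j' q y].
- by rewrite ml mr.
- by rewrite mr ml.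
move: z; apply: ta_ext => [c u v|c u v|h i' r z].
- by rewrite !mr.
- by rewrite mr.
have [ei|ni] := eqVneq i i'.
  case: i' / ei r z => r z; rewrite ta_mul_inj.
  have [ej|nj] := eqVneq j j'.
    case: j' / ej q y => q y; rewrite !ta_mul_inj.
    by rewrite -(path_mulA (qcatA p q r)) ta_inj_pcast.
  by rewrite !ta_mul_inj0 // (linear0_of (ml _)).
rewrite (ta_mul_inj0 (p := q)) // (linear0_of (mr _)).
have [ej|nj] := eqVneq j j'.
  by case: j' / ej q y => q y; rewrite ta_mul_inj ta_mul_inj0.
by rewrite ta_mul_inj0 // (linear0_of (ml _)).
Qed.

Fact ta_mul1 : left_id ta_one ta_mul.
Proof.
have [mr ml] := ta_mul_bilinear.
apply: ta_ext => [c u v|//|i j p x]; first by rewrite mr.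
rewrite -(linfunE (ml _)) /ta_one linear_sum (bigD1 j) //= linfunE // ta_mul_inj.
rewrite path_mul_triv lact1 big1 ?addr0 // => l lj.
by rewrite linfunE // ta_mul_inj0.
Qed.

Fact ta_mulr1 : right_id ta_one ta_mul.
Proof.
have [mr ml] := ta_mul_bilinear.
apply: ta_ext => [c u v|//|i j p x]; first by rewrite ml.
rewrite -(linfunE (mr _)) /ta_one linear_sum (bigD1 i) //= linfunE // ta_mul_inj.
rewrite -(ta_inj_pcast (qcat_triv p)) path_mul_trivr ract1 big1 ?addr0 // => l li.
by rewrite linfunE // ta_mul_inj0 // eq_sym.
Qed.

Fact ta_mulDl : left_distributive ta_mul +%R.
Proof. by move=> x y z; have := ta_mul_bilinear.2 z 1 x y; rewrite !scale1r. Qed.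
Fact ta_mulDr : right_distributive ta_mul +%R.
Proof. by move=> z x y; have := ta_mul_bilinear.1 z 1 x y; rewrite !scale1r. Qed.

Fact ta_one_neq0 : ta_one != 0 :> TA.
Proof.
apply/eqP => /(congr1 (ta_proj (qtriv ord0))) /eqP.
rewrite /ta_one ta_proj_sum (bigD1 ord0) //= ta_injK big1 ?addr0 => [|i i0].
  by rewrite (linear0_of (@ta_proj_linear _ _ _)) oner_eq0.
have ne : tagp (qtriv (Q := Q) i) != tagp (qtriv ord0).
  by apply: contraNneq i0 => /(congr1 (fun t => (tag t).1)) /= ->.
have E := @ta_inj_neq _ _ (qtriv i) _ _ (qtriv ord0) (1 : S i) ne.
exact E.
Qed.

HB.instance Definition _ := GRing.Zmodule_isNzRing.Build TA
  ta_mulA ta_mul1 ta_mulr1 ta_mulDl ta_mulDr ta_one_neq0.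

Fact ta_scalerAl (c : K) (x y : TA) : c *: (x * y) = c *: x * y.
Proof.
have := ta_mul_bilinear.2 y c x 0.
by rewrite !addr0 (linear0_of (ta_mul_bilinear.2 y)) addr0.
Qed.
HB.instance Definition _ := GRing.Lmodule_isLalgebra.Build K TA ta_scalerAl.

Fact ta_scalerAr (c : K) (x y : TA) : c *: (x * y) = x * (c *: y).
Proof.
have := ta_mul_bilinear.1 x c y 0.
by rewrite !addr0 (linear0_of (ta_mul_bilinear.1 x)) addr0.
Qed.
HB.instance Definition _ := GRing.Lalgebra_isAlgebra.Build K TA ta_scalerAr.
HB.instance Definition _ := Algebra_isFalgebra.Build K TA.

(* The component at i of the projection killing all M_p with p nontrivial; it
   is an algebra morphism by [ta_vertex1] and [ta_vertexM]. *)
Definition ta_vertex (i : 'I_n.+1) (x : TA) : S i := ta_proj (qtriv i) x.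

Lemma ta_vertex_linear i : linear (@ta_vertex i).
Proof. exact: (@ta_proj_linear i i (qtriv i)). Qed.

Lemma ta_vertex_inj i (x : S i) : ta_vertex i (ta_inj (p := qtriv i) x) = x.
Proof. exact: (@ta_injK i i (qtriv i)). Qed.

Lemma ta_vertex_inj0 i j l (p : qpath Q j l) x :
  tagp p != tagp (qtriv (Q := Q) i) -> ta_vertex i (ta_inj (p := p) x) = 0.
Proof. by move=> ne; have E := @ta_inj_neq _ _ p _ _ (qtriv i) x ne; exact E. Qed.

Lemma tagp_triv i j : i != j -> tagp (qtriv (Q := Q) i) != tagp (qtriv (Q := Q) j).
Proof. by apply: contraNneq => /(congr1 (fun t => (tag t).1)) /= ->. Qed.

Lemma tagp_cons i j a (p : qpath Q j (source a)) :
  tagp (qcons a p) != tagp (qtriv (Q := Q) i).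
Proof. by apply/eqP => /(congr1 (fun t => size (arrows (tagged t)))). Qed.

Lemma ta_vertex1 i : ta_vertex i 1 = 1.
Proof.
rewrite -[1 in LHS]/ta_one -(linfunE (@ta_vertex_linear i)) linear_sum (bigD1 i) //= big1 => [|j ji].
  by rewrite addr0 (linfunE (@ta_vertex_linear i)) ta_vertex_inj.
rewrite (linfunE (@ta_vertex_linear i)); apply: ta_vertex_inj0; exact: tagp_triv.
Qed.

Lemma ta_vertexM i (x y : TA) : ta_vertex i (x * y) = ta_vertex i x * ta_vertex i y.
Proof.
have [mr ml] := ta_mul_bilinear; have vl := @ta_vertex_linear i.
have v0 := linear0_of vl; rewrite -[x * y]/(ta_mul x y).
move: x; apply: ta_ext => [c u v|c u v|j l p x].
- by rewrite ml vl.
- by rewrite vl mulrDl scalerAl.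
move: y; apply: ta_ext => [c u v|c u v|h j' q y].
- by rewrite mr vl.
- by rewrite vl mulrDr scalerAr.
have [ej|nj] := eqVneq j j'; last first.
  rewrite ta_mul_inj0 // v0.
  have [pi|pi] := eqVneq (tagp p) (tagp (qtriv i)); last first.
    by rewrite (ta_vertex_inj0 _ pi) mul0r.
  rewrite [X in _ * X]ta_vertex_inj0 ?mulr0 //.
  apply: contraNneq nj => /(congr1 (fun t => (tag t).2)) /= ->.
  by move/(congr1 (fun t => (tag t).1)): pi => /= ->.
case: j' / ej q y => q y; rewrite ta_mul_inj.
case: p x => [|a p] x; last first.
  rewrite (ta_vertex_inj0 x (tagp_cons _ _)) mul0r.
  have E := @ta_vertex_inj0 i _ _ (qcons a (qcat p q)) (path_mul x y) (tagp_cons _ _).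
  exact E.
case: q x y => [|a q] x y; last first.
  rewrite (ta_vertex_inj0 y (tagp_cons _ _)) mulr0.
  have E := @ta_vertex_inj0 i _ _ (qcons a q) (path_mul (x : path_bim S (qtriv _)) y)
    (tagp_cons _ _).
  exact E.
have [hi|hi] := eqVneq h i.
  case: i / hi {vl v0} => {mr ml}.
  have E := ta_vertex_inj (x * y : S h).
  by rewrite [X in _ = X * _]ta_vertex_inj [X in _ = _ * X]ta_vertex_inj; exact E.
by rewrite !(ta_vertex_inj0 _ (tagp_triv hi)) mul0r.
Qed.

Section Inflation.
Variables (i : 'I_n.+1) (M : fdmodule (S i)).

Definition infl_act (x : TA) (m : M) : M := act (ta_vertex i x) m.

Fact infl_act_bilinear : is_bilinear infl_act.
Proof.
have [mr ml] := act_bilinear M.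
by split=> [x|m c x y]; [exact: mr | rewrite /infl_act ta_vertex_linear ml].
Qed.
Fact infl_act1 m : infl_act 1 m = m.
Proof. by rewrite /infl_act ta_vertex1 act1. Qed.
Fact infl_actM x y m : infl_act (x * y) m = infl_act x (infl_act y m).
Proof. by rewrite /infl_act ta_vertexM actM. Qed.

Definition inflate : fdmodule TA :=
  FDModule infl_act_bilinear infl_act1 infl_actM.
End Inflation.

End TensorAlgebra.

(* If I i indexes Sim(A_i), then {i : 'I_n & I i} indexes Sim(A); the order on
   Sim(A) is the canonical (lexicographic) order on this type. *)
Lemma le_disjoint_union (n : nat) (d : Order.disp_t)
    (I : 'I_n -> finPOrderType d) (i j : 'I_n) (x : I i) (y : I j) :
  (existT I i x <= existT I j y)%O <->
  (i < j)%N \/ exists e : i = j, (ecast i (I i) e x <= y)%O.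
Proof.
rewrite leEsig /= !leEord; split.
  case/andP => ij /implyP ijP; have [ji|] := leqP j i; last by left.
  right; have e : i = j by apply/val_inj/anti_leq; rewrite ij.
  exists e; have := ijP ji; case: j / e y {ij ijP ji} => y.
  by rewrite tagged_asE.
case=> [ij|[e]]; first by rewrite (ltnW ij) leqNgt ij.
by case: j / e y => y xy; rewrite leqnn tagged_asE.
Qed.

(* Main.v *)
(* For a vertex i and L in Sim(A_i), P(L) = A_i f with f an idempotent of A_i,
   and the projective cover of L over A is the left ideal A f.  Let J_m be the
   ideal spanned by the M_p with max(p) >= m, and C_m and D_m the spans of the M_p
   with max(p) = t(p) = m and max(p) = s(p) = m.  A path with maximum m factors
   uniquely through m, so J_m / J_(m+1) = D_m ⊗ C_m over A_m, where D_m is right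
   projective and C_m is left projective.  The standard module of L is
   D_i ⊗ Δ_i(L), i.e. A f / (A τ + J_(i+1)) with τ the kernel of A_i f -> Δ_i(L).
   The submodules J_m f, m >= i, filter A f; the layer of m comes from the
   projective A_m-module C_m f, which has a filtration by standard A_m-modules, and
   D_m ⊗ _ turns it into one by standard A-modules, being exact.  Tensor products
   are avoided: D_m ⊗ F becomes A F + J_(m+1), and exactness is read off a dual
   basis of D_m. *)

Require Import Defs.
From HB Require Import structures.
From mathcomp Require Import all_boot all_order all_algebra all_field.
From Stdlib Require Import Classical_Prop.

Set Implicit Arguments.
Unset Strict Implicit.
Unset Printing Implicit Defensive.

Import Order.TTheory GRing.Theory.
Local Open Scope ring_scope.

(** * Modules, subquotients and filtrations *)

Section ModuleTheory.
Variables (K : fieldType) (A : falgType K).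
Implicit Types M N P : fdmodule A.

(** Acyclicity is what brings questions about A back to the A_i: closed paths are trivial, so e_i A
    e_i = A_i, and a homomorphism between A f and A f' with f, f' idempotents of the same A_i is
    right multiplication by an element of A_i.

    Exactness matters at one point, the kernel of the map from A f_j onto a lifted layer: if u lifts
    the generator of F / F' and x u lies in A F' + J_(m+1), then x must lie in the trace. This is
    tested on the coordinates of x, which lie in A_m. The coordinates are endomorphisms of the whole
    of A, not maps on D_m, so that those of D_m can be composed from those of single arrows, divided
    off one at a time from the left.

    Nothing is known about which P(L) occur in C_m f. Hence arbitrary projective A_m-modules are
    filtered by standard modules, by splitting off one P(L) after another. *)

Lemma act_linear M (a : A) : linear (@act K A M a).
Proof. exact: (act_bilinear M).1. Qed.

Lemma act_linear_l M (x : M) : linear (fun a : A => act a x).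
Proof. exact: (act_bilinear M).2. Qed.

Definition orbit_map M (x : M) : 'Hom(A, M) := linfun (fun a : A => act a x).

Lemma orbit_mapE M (x : M) a : orbit_map x a = act a x.
Proof. exact/linfunE/act_linear_l. Qed.

Lemma act0 M (a : A) : act a (0 : M) = 0.
Proof. by rewrite -act_funE linear0. Qed.
Lemma actZ M (a : A) c (x : M) : act a (c *: x) = c *: act a x.
Proof. by rewrite -!act_funE linearZ. Qed.
Lemma act_sum M (a : A) I (r : seq I) (Q : pred I) (F : I -> M) :
  act a (\sum_(i <- r | Q i) F i) = \sum_(i <- r | Q i) act a (F i).
Proof.
by rewrite -act_funE linear_sum; apply: eq_bigr => i _; rewrite /= act_funE.
Qed.
Lemma actDl M (a b : A) (x : M) : act (a + b) x = act a x + act b x.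
Proof. by rewrite -!orbit_mapE linearD. Qed.
Lemma actBl M (a b : A) (x : M) : act (a - b) x = act a x - act b x.
Proof. by rewrite -!orbit_mapE linearB. Qed.
Lemma act0l M (x : M) : act (0 : A) x = 0.
Proof. by rewrite -orbit_mapE linear0. Qed.
Lemma actZl M c (a : A) (x : M) : act (c *: a) x = c *: act a x.
Proof. by rewrite -!orbit_mapE linearZ. Qed.
Lemma act_suml M I (r : seq I) (Q : pred I) (F : I -> A) (x : M) :
  act (\sum_(i <- r | Q i) F i) x = \sum_(i <- r | Q i) act (F i) x.
Proof.
by rewrite -orbit_mapE linear_sum; apply: eq_bigr => i _; rewrite /= orbit_mapE.
Qed.

Definition regular : fdmodule A := left_mod (regular_bim A).

Lemma hom_linfun M N (f : M -> N) : linear f ->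
  (forall a x, f (act a x) = act a (f x)) -> is_hom (linfun f).
Proof. by move=> lf fa a x; rewrite !(linfunE lf). Qed.

Lemma hom_id M : is_hom (\1%VF : 'End(M)).
Proof. by move=> a x; rewrite !id_lfunE. Qed.

Lemma hom_comp M N P (f : 'Hom(N, P)) (g : 'Hom(M, N)) :
  is_hom f -> is_hom g -> is_hom (f \o g)%VF.
Proof. by move=> hf hg a x; rewrite !comp_lfunE hg hf. Qed.

Lemma hom_orbit M (x : M) : is_hom (orbit_map x : 'Hom(regular, M)).
Proof. by move=> a b; rewrite !orbit_mapE /= actM. Qed.

Lemma limg_fullP (V W : vectType K) (f : 'Hom(V, W)) :
  limg f = fullv <-> forall y, exists x, f x = y.
Proof.
split=> [ff y|ff].
  by have := memvf y; rewrite -ff => /memv_imgP[x _ ->]; exists x.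
apply/eqP; rewrite eqEsubv subvf; apply/subvP => y _.
by have [x <-] := ff y; rewrite memv_img ?memvf.
Qed.

Lemma lker0I (V W : vectType K) (f : 'Hom(V, W)) :
  lker f == 0%VS -> injective f.
Proof. by move/lker0P. Qed.

Lemma quot_pi_eq0 (V : vectType K) (U : {vspace V}) x :
  (quot_pi U x == 0) = (x \in U).
Proof. by rewrite -memv_ker lker_quot_pi. Qed.

Lemma hom_quot M (U : submodule M) :
  is_hom (quot_pi U : 'Hom(M, quot_mod U)).
Proof. by move=> a x; symmetry; apply: quot_act_pi. Qed.

Lemma hom_val M (U : submodule M) :
  is_hom (linfun vsval : 'Hom(sub_mod U, M)).
Proof. by move=> a x; rewrite !lfunE. Qed.

Definition zero_submod M : submodule M.
Proof.
by apply: (@SubModule _ _ M 0%VS) => a x; rewrite !memv0 => /eqP ->; rewrite act0.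
Defined.

Definition full_submod M : submodule M.
Proof. by apply: (@SubModule _ _ M fullv) => a x _; rewrite memvf. Defined.

Definition preim_submod M N (f : 'Hom(M, N)) (hf : is_hom f) (U : submodule N) :
  submodule M.
Proof.
apply: (@SubModule _ _ M (f @^-1: U)%VS) => a x.
by rewrite -!memv_preim hf; apply: submodP.
Defined.

Definition img_submod M N (f : 'Hom(M, N)) (hf : is_hom f) (U : submodule M) :
  submodule N.
Proof.
apply: (@SubModule _ _ N (f @: U)%VS) => a _ /memv_imgP[x xU ->].
by rewrite -hf memv_img ?submodP.
Defined.

Lemma iso_sym M N : iso M N -> iso N M.
Proof.
case=> f [hf /eqP kf lf]; exists (f^-1)%VF.
have fK := lker0_lfunK kf.
have fVK y : f (f^-1%VF y) = y by apply: limg_lfunVK; rewrite lf memvf.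
split.
- by move=> a y; apply: (lker0I kf); rewrite hf !fVK.
- apply/eqP/lker0P => x y e; by rewrite -(fVK x) e fVK.
- by apply/limg_fullP => x; exists (f x); rewrite fK.
Qed.

Lemma iso_trans M N P : iso M N -> iso N P -> iso M P.
Proof.
case=> f [hf /eqP kf lf] [g [hg /eqP kg lg]]; exists (g \o f)%VF; split.
- exact: hom_comp.
- by apply/eqP/lker0P => x y; rewrite !comp_lfunE => /(lker0I kg)/(lker0I kf).
- apply/limg_fullP => z; have [y <-] := (limg_fullP g).1 lg z.
  by have [x <-] := (limg_fullP f).1 lf y; exists x; rewrite comp_lfunE.
Qed.

(* Elementwise form of "V / W is isomorphic to N". *)
Definition factor M (W V : {vspace M}) N : Prop :=
  exists q : 'Hom(M, N),
  [/\ forall a x, x \in V -> q (act a x) = act a (q x),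
      forall x, x \in V -> (q x == 0) = (x \in W) &
      forall y, exists2 x, x \in V & q x = y].

Lemma factorP M (W V : submodule M) N : (W <= V)%VS ->
  iso (subquot V W) N <-> factor W V N.
Proof.
move=> WV; pose U := SubModule (@sub_in_stable _ _ M V W).
have Uin (x : sub_mod V) : (x \in (U : {vspace _})) = (val x \in W).
  by rewrite /= /sub_in_space -memv_preim lfunE.
split=> [[f [hf /eqP kf lf]]|[q [qa qk qs]]].
  (* [vsproj V] is the identity on V; its values elsewhere are harmless, since [factor] tests q on V
     only. *)
  exists (f \o quot_pi U \o linfun (vsproj V))%VF.
  have qE x : (f \o quot_pi U \o linfun (vsproj V))%VF x = f (quot_pi U (vsproj V x)).
    by rewrite comp_lfunE comp_lfunE (lfunE (vsproj V)).
  split=> [a x xV|x xV|y].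
  - rewrite !qE -hf; congr (f _).
    transitivity (quot_pi U (act a (vsproj V x : sub_mod V))); last exact: hom_quot.
    by congr (quot_pi _ _); apply: val_inj; rewrite /= !vsprojK //; apply: submodP.
  - by rewrite qE -memv_ker (eqP kf) memv0 quot_pi_eq0 Uin /= vsprojK.
  - have [z <-] := (limg_fullP f).1 lf y.
    exists (val (quot_repr U z)); first exact: subvsP.
    by rewrite qE vsvalK quot_reprK.
pose f : 'Hom(subquot V W, N) := (q \o linfun vsval \o quot_repr U)%VF.
have fE (x : sub_mod V) : f (quot_pi U x) = q (val x).
  rewrite comp_lfunE comp_lfunE (lfunE vsval) /=; apply/eqP.
  rewrite -subr_eq0 -linearB qk.
    by rewrite -opprB rpredN -linearB -Uin; apply: quot_piK.
  by apply: rpredB; apply: subvsP.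
exists f; split.
- move=> a z; rewrite -[z](quot_reprK (U := U)); set w : sub_mod V := quot_repr U z.
  have -> : act a (quot_pi U w : subquot V W) = quot_pi U (act a w).
    by symmetry; apply: hom_quot.
  by rewrite !fE /= qa //; apply: subvsP.
- apply/eqP/lker0P => z z'; rewrite -[z](quot_reprK (U := U)) -[z'](quot_reprK (U := U)).
  rewrite !fE => /eqP; rewrite -subr_eq0 -linearB qk; last first.
    by apply: rpredB; apply: subvsP.
  by move=> zz; apply: quot_pi_eq; rewrite Uin.
- apply/limg_fullP => y; have [x xV <-] := qs y.
  by exists (quot_pi U (Subvs xV)); rewrite fE.
Qed.

Lemma factor_quot M (U : submodule M) : factor U fullv (quot_mod U).
Proof.
exists (quot_pi U); split=> [a x _|x _|y]; first exact: hom_quot.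
  exact: quot_pi_eq0.
by exists (quot_repr U y); rewrite ?memvf ?quot_reprK.
Qed.

Section Chain.
Variables (J : Type) (R : J -> Prop) (D : J -> fdmodule A).

(** The ends are compared as spaces, because two submodules with the same space may differ in their
    stability proofs. Without indices, concatenation and transport along homomorphisms are plain
    inductions. *)
Inductive chain M : submodule M -> submodule M -> Prop :=
| chain_refl (W U : submodule M) : W = U :> {vspace M} -> chain W U
| chain_step (W V U : submodule M) j :
    R j -> (W <= V)%VS -> factor W V (D j) -> chain V U -> chain W U.

Lemma chain_trans M (W V U : submodule M) : chain W V -> chain V U -> chain W U.
Proof.
elim=> {W V} [W V e|W V V' j Rj WV F _ IH] VU; last first.
  by apply: chain_step Rj WV F _; apply: IH.
case: VU e => {V U} [V U e1 e2|V V' U j Rj VV' F c e].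
  by apply: chain_refl; rewrite e2.
by apply: (chain_step (V := V') Rj); rewrite ?e.
Qed.

Lemma chain1 M (W U : submodule M) j :
  R j -> (W <= U)%VS -> factor W U (D j) -> chain W U.
Proof. by move=> Rj WU F; apply: chain_step Rj WU F _; apply: chain_refl. Qed.

Lemma chain_img M N (f : 'Hom(M, N)) (hf : is_hom f) (W U : submodule M) :
  lker f = 0%VS -> chain W U -> chain (img_submod hf W) (img_submod hf U).
Proof.
move=> /eqP kf; elim=> {W U} [W U e|W V U j Rj WV [q [qa qk qs]] _ IH].
  by apply: chain_refl; rewrite /= e.
apply: chain_step Rj _ _ IH; first exact: limgS.
have fK := lker0_lfunK kf.
exists (q \o f^-1)%VF; split=> [a _ /memv_imgP[x xV ->]|_ /memv_imgP[x xV ->]|y].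
- by rewrite -hf !comp_lfunE !fK qa.
- rewrite comp_lfunE fK qk //=; apply/idP/memv_imgP => [xW|[z zW /(lker0I kf) -> //]].
  by exists x.
- by have [x xV <-] := qs y; exists (f x); rewrite ?memv_img // comp_lfunE fK.
Qed.

Lemma chain_preim M N (f : 'Hom(M, N)) (hf : is_hom f) (W U : submodule N) :
  limg f = fullv -> chain W U -> chain (preim_submod hf W) (preim_submod hf U).
Proof.
move=> lf; elim=> {W U} [W U e|W V U j Rj WV [q [qa qk qs]] _ IH].
  by apply: chain_refl; rewrite /= e.
apply: chain_step Rj _ _ IH; first exact: lpreimS.
exists (q \o f)%VF; split=> [a x|x|y].
- by rewrite -memv_preim => xV; rewrite !comp_lfunE hf qa.
- by rewrite /= -!memv_preim => xV; rewrite comp_lfunE qk.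
- have [x xV <-] := qs y; have [z zx] := (limg_fullP f).1 lf x.
  by exists z; rewrite -?memv_preim ?comp_lfunE zx.
Qed.

End Chain.

Lemma chain_weaken (J : Type) (R R' : J -> Prop) (D : J -> fdmodule A) M
    (W U : submodule M) : (forall j, R j -> R' j) -> chain R D W U -> chain R' D W U.
Proof.
move=> RR'; elim=> {W U} [W U e|W V U j Rj WV F _ IH]; first exact: chain_refl.
exact: chain_step (RR' j Rj) WV F IH.
Qed.

Lemma standard_filteredP d (I : finPOrderType d) (P : I -> fdmodule A) i M
    (U : submodule M) :
  standard_filtered P i U <->
  chain (fun j => (i < j)%O) (standard P) (zero_submod M) U.
Proof.
split=> [[m [F [F0 Fm FS]]]|].
  have : forall r, (r <= m)%N -> chain (fun j => (i < j)%O) (standard P) (F r) U.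
    move=> r rm; rewrite -(subKn rm); move: (m - r)%N (leq_subr r m) => {r rm}.
    elim=> [_|r IH rm]; first by rewrite subn0; apply: chain_refl.
    have lt : (m - r.+1 < m)%N by rewrite ltn_subrL (leq_ltn_trans _ rm).
    have [le [j ij /(factorP _ le) fj]] := FS _ lt.
    apply: (@chain_step _ (fun j => (i < j)%O) _ _ _ _ _ j ij le fj).
    by rewrite -subSn // subSS; apply/IH/ltnW.
  move/(_ 0%N isT) => c; apply: chain_trans c; exact: chain_refl.
suff : forall W V : submodule M, chain (fun j => (i < j)%O) (standard P) W V ->
    exists (m : nat) (F : nat -> submodule M),
    [/\ F 0%N = W, F m = V :> {vspace M} &
        forall r, (r < m)%N -> (F r <= F r.+1)%VS /\
          exists2 j, (i < j)%O & iso (subquot (F r.+1) (F r)) (standard P j)].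
  move=> h /h[m [F [F0 Fm FS]]]; exists m, F; split=> //.
  by rewrite F0.
move=> W V; elim=> {W V} [W V e|W V V' j ij WV /(factorP _ WV) F _ [m [G [G0 Gm GS]]]].
  by exists 0%N, (fun=> W).
exists m.+1, (fun r => if r is r'.+1 then G r' else W); split=> // [[_|r rm]].
  by rewrite G0; split=> //; exists j.
exact: GS.
Qed.

End ModuleTheory.

(** * Projective modules and covers *)

Section Projectives.
Variables (K : fieldType) (A : falgType K).
Implicit Types M N P X L : fdmodule A.

Section FreeModule.
Variable n : nat.

Definition free_act (a : A) (x : {ffun 'I_n -> A}) : {ffun 'I_n -> A} :=
  [ffun i => a * x i].

Fact free_act_bilinear : is_bilinear free_act.
Proof.
split=> [a c x y|x c a b]; apply/ffunP => i; rewrite !ffunE.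
  by rewrite mulrDr scalerAr.
by rewrite mulrDl scalerAl.
Qed.
Fact free_act1 x : free_act 1 x = x.
Proof. by apply/ffunP => i; rewrite ffunE mul1r. Qed.
Fact free_actM a b x : free_act (a * b) x = free_act a (free_act b x).
Proof. by apply/ffunP => i; rewrite !ffunE mulrA. Qed.

Definition free_module : fdmodule A :=
  FDModule free_act_bilinear free_act1 free_actM.
End FreeModule.

Definition dual_basis P (T : finType) (x : T -> P) (psi : T -> 'Hom(P, regular A)) :=
  (forall t, is_hom (psi t)) /\ forall u, u = \sum_t act (psi t u : A) (x t).

(** Dual basis lemma: the psi are the coordinates of a section of the surjection from a free module;
    conversely, a lift of f is obtained by sending each x t to a preimage of f (x t). *)
Lemma projectiveP P :
  projective P <-> exists (T : finType) (x : T -> P) psi, dual_basis x psi.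
Proof.
split=> [prP|[T [x [psi [ph pE]]]] M N g f hg lg hf].
  pose n := \dim {:P}; pose b := vbasis {:P}.
  pose g0 (z : free_module n) : P := \sum_(i < n) act ((z : {ffun 'I_n -> A}) i) b`_i.
  have lg0 : linear g0.
    move=> c y z; rewrite /g0 scaler_sumr -big_split; apply: eq_bigr => i _.
    by rewrite !ffunE actDl actZl.
  have hg : is_hom (linfun g0).
    apply: hom_linfun => // a z; rewrite /g0 act_sum; apply: eq_bigr => i _.
    by rewrite ffunE actM.
  have [|h hh hE] := prP _ _ _ \1%VF hg _ (@hom_id _ _ P).
    apply/limg_fullP => y; exists ([ffun i => coord b i y *: 1] : free_module n).
    rewrite (linfunE lg0) [RHS](coord_vbasis (memvf y)); apply: eq_bigr => i _.
    by rewrite ffunE actZl act1.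
  pose ev (i : 'I_n) (z : free_module n) : regular A := (z : {ffun 'I_n -> A}) i.
  have lev i : linear (ev i) by move=> c y z; rewrite /ev !ffunE.
  exists 'I_n, (fun i : 'I_n => b`_i), (fun i : 'I_n => linfun (ev i) \o h)%VF.
  split=> [i|u].
    apply: hom_comp hh; apply: hom_linfun => // a z; by rewrite /ev ffunE.
  move/lfunP/(_ u): hE; rewrite comp_lfunE id_lfunE (linfunE lg0) => {1}->.
  by apply: eq_bigr => i _; rewrite comp_lfunE (linfunE (lev i)).
pose h u := \sum_t act (psi t u : A) (g^-1%VF (f (x t))).
have lh : linear h.
  move=> c u v; rewrite /h scaler_sumr -big_split; apply: eq_bigr => t _.
  by rewrite linearP actDl actZl.
exists (linfun h).
  apply: hom_linfun => // a u; rewrite /h act_sum; apply: eq_bigr => t _.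
  by rewrite ph actM.
apply/lfunP => u; rewrite comp_lfunE (linfunE lh) /h {1}(pE u) !linear_sum.
by apply: eq_bigr => t _; rewrite /= hf hg limg_lfunVK // lg memvf.
Qed.

Lemma projective_regular : projective (regular A).
Proof.
apply/projectiveP; exists unit, (fun=> 1), (fun=> \1%VF); split=> [t|u].
  exact: hom_id.
by rewrite (bigD1 tt) //= big1 => [|[]//]; rewrite addr0 id_lfunE mulr1.
Qed.

Lemma projective_retract X N (i : 'Hom(N, X)) (r : 'Hom(X, N)) :
  is_hom i -> is_hom r -> (forall u, r (i u) = u) -> projective X -> projective N.
Proof.
move=> hi hr ri prX M M' g f hg lg hf.
have [h hh hE] := prX _ _ g (f \o r)%VF hg lg (hom_comp hf hr).
exists (h \o i)%VF; first exact: hom_comp.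
apply/lfunP => u; move/lfunP/(_ (i u)): hE.
by rewrite !comp_lfunE ri.
Qed.

Lemma simple_quotient X : {:X}%VS <> 0%VS ->
  exists L (q : 'Hom(X, L)), [/\ simple_module L, is_hom q & limg q = fullv].
Proof.
have [m] := ubnP (\dim {:X}); elim: m X => // m IH X ltm X0.
have [[U [U0 Uf]]|nU] := classic (exists U : submodule X,
    U <> 0%VS :> {vspace X} /\ U <> fullv :> {vspace X}).
  have piS : limg (quot_pi U) = fullv.
    by apply/limg_fullP => y; exists (quot_repr U y); rewrite quot_reprK.
  have dE : (\dim U + \dim {:quot_mod U} = \dim {:X})%N.
    by rewrite -(limg_ker_dim (quot_pi U) fullv) capfv lker_quot_pi piS.
  have [||L [q [sL hq lq]]] := IH (quot_mod U).
  - rewrite -ltnS; apply: leq_trans ltm; rewrite ltnS -dE -[X in (X < _)%N]add0n.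
    by rewrite ltn_add2r lt0n dimv_eq0; apply/eqP.
  - move=> q0; apply: Uf; apply/eqP; rewrite eqEdim subvf -dE q0 dimv0 addn0 /=.
    exact: leqnn.
  exists L, (q \o quot_pi U)%VF; split=> //.
    apply: hom_comp hq _; exact: hom_quot.
  by rewrite limg_comp piS.
exists X, \1%VF; split; [|exact: hom_id|exact: lim1g].
split=> // U; have [->|U0] := eqVneq (U : {vspace X}) 0%VS; first by left.
have [->|Uf] := eqVneq (U : {vspace X}) fullv; first by right.
by case: nU; exists U; split; apply/eqP.
Qed.

Lemma simple_cyclic L (x : L) : simple_module L -> x <> 0 ->
  limg (orbit_map x) = fullv.
Proof.
move=> [_ sL] x0; have [e|//] := sL (img_submod (hom_orbit x) (full_submod _)).
case: x0; apply/eqP; rewrite -memv0 -e /=; apply/memv_imgP.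
by exists 1; rewrite ?memvf // orbit_mapE act1.
Qed.

Lemma cover_surj P L X (p : 'Hom(P, L)) (h : 'Hom(X, P)) :
  (forall U : submodule P, (U + lker p)%VS = fullv -> U = fullv :> {vspace P}) ->
  is_hom h -> limg (p \o h)%VF = fullv -> limg h = fullv.
Proof.
move=> sup hh lph; apply: (sup (img_submod hh (full_submod _))).
apply/eqP; rewrite eqEsubv subvf; apply/subvP => y _ /=.
have [x xy] := (limg_fullP _).1 lph (p y); rewrite comp_lfunE in xy.
rewrite -[y](subrK (h x)) addrC; apply: memv_add; first exact/memv_img/memvf.
by rewrite memv_ker linearB /= xy subrr.
Qed.

(* P is generated by g, and s splits the resulting surjection A -> P; so s g is
   an idempotent and P is isomorphic to A (s g). *)
Lemma cover_split P L : simple_module L -> projective_cover P L ->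
  exists (g : P) (s : 'Hom(P, regular A)) (p : 'Hom(P, L)),
  [/\ is_hom s, forall u, act (s u : A) g = u, is_hom p, p g <> 0 &
    forall U : submodule P, (U + lker p)%VS = fullv -> U = fullv :> {vspace P}].
Proof.
move=> sL [prP [p [hp lp sup]]].
have [y y0] : exists y : L, y <> 0.
  exists (vpick {:L}); apply/eqP; rewrite vpick0; apply/eqP; exact: sL.1.
have [g gy] := (limg_fullP p).1 lp y.
have lg : limg (orbit_map g : 'Hom(regular A, P)) = fullv.
  apply: (cover_surj sup (hom_orbit g)).
  suff -> : (p \o orbit_map g)%VF = orbit_map y by exact: simple_cyclic.
  by apply/lfunP => a; rewrite comp_lfunE !orbit_mapE hp gy.
have [s hs sE] := prP _ _ _ _ (hom_orbit g) lg (@hom_id _ _ P).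
exists g, s, p; split=> // [u|]; last by rewrite gy.
by move/lfunP/(_ u): sE; rewrite comp_lfunE id_lfunE orbit_mapE.
Qed.

Lemma chain_sub (J : Type) (R : J -> Prop) (D : J -> fdmodule A) M
    (W V W' V' : submodule M) : W = W' :> {vspace M} -> V = V' :> {vspace M} ->
  chain R D W V -> chain R D W' V'.
Proof.
move=> eW eV c; apply: (chain_trans (V := W)); first exact: chain_refl.
by apply: chain_trans c _; apply: chain_refl.
Qed.

(** If L_i is a simple quotient of X, the lift X -> P_i is onto because P_i is a cover, and splits
    because P_i is projective. The kernel is again projective and of smaller dimension, while P_i is
    filtered by its trace with [standard P i] on top. *)
Lemma projective_chain d (I : finPOrderType d) (L P : I -> fdmodule A) :
  is_Sim L -> (forall i, projective_cover (P i) (L i)) ->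
  (forall i, standard_filtered P i (trace_submod P i)) ->
  forall X, projective X ->
    chain (fun=> True) (standard P) (zero_submod X) (full_submod X).
Proof.
move=> [simpL _ simL] covP filP X.
have [m] := ubnP (\dim {:X}); elim: m X => // m IH X ltm prX.
have [X0|X0] := eqVneq {:X}%VS 0%VS; first by apply: chain_refl; rewrite /= X0.
have [N [q [sN hq lq]]] := simple_quotient (elimN eqP X0).
have [i [f [hf kf lf]]] := simL N sN.
have [prP [p [hp lp sup]]] := covP i.
have [h hh hE] := prX _ _ p (f \o q)%VF hp lp (hom_comp hf hq).
have lh : limg h = fullv.
  by apply: (cover_surj sup hh); rewrite -hE limg_comp lq.
have [s hs sE] := prP _ _ h \1%VF hh lh (@hom_id _ _ _).
have hsK u : h (s u) = u by move/lfunP/(_ u): sE; rewrite comp_lfunE id_lfunE.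
pose kh : submodule X := preim_submod hh (zero_submod (P i)).
have khE x : (x \in (kh : {vspace X})) = (h x == 0).
  by rewrite /= -memv_preim memv0.
have dE : (\dim kh + \dim {:P i} = \dim {:X})%N.
  by rewrite -(limg_ker_dim h fullv) capfv -lpreim0 lh.
have P0 : (0 < \dim {:P i})%N.
  rewrite lt0n; apply/eqP => /eqP; rewrite dimv_eq0 => /eqP P0.
  by apply: (simpL i).1; rewrite -lp P0 limg0.
(* The projection of X onto the kernel of h along the image of s; it exhibits the kernel as a
   retract of X. *)
pose r : 'Hom(X, sub_mod kh) := (linfun (vsproj kh) \o (\1 - (s \o h)))%VF.
have rE x : val (r x) = x - s (h x).
  rewrite comp_lfunE (lfunE (vsproj kh)) /= vsprojK.
    by rewrite add_lfunE opp_lfunE id_lfunE comp_lfunE.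
  by rewrite khE add_lfunE opp_lfunE id_lfunE comp_lfunE linearB /= hsK subrr.
have hr : is_hom r.
  by move=> a x; apply: val_inj; rewrite /= !rE hh hs actB.
have c1 : chain (fun=> True) (standard P) (zero_submod X) kh.
  have prK : projective (sub_mod kh).
    apply: (projective_retract (@hom_val _ _ X kh) hr _ prX) => u; apply: val_inj.
    rewrite rE (lfunE vsval) /=; have := subvsP u.
    by rewrite khE => /eqP ->; rewrite linear0 subr0.
  have lt : (\dim {:sub_mod kh} < m)%N.
    rewrite -ltnS; apply: leq_trans ltm; rewrite ltnS -dE dimvf -[X in (X < _)%N]addn0.
    by rewrite ltn_add2l.
  have kv : lker (linfun vsval : 'Hom(sub_mod kh, X)) = 0%VS.
    by apply/eqP/lker0P => x y; rewrite !lfunE /= => /val_inj.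
  have := chain_img (@hom_val _ _ X kh) kv (IH _ lt prK); apply: chain_sub => /=.
    by rewrite limg0.
  apply/vspaceP => x; apply/memv_imgP/idP => [[y _ ->]|xk].
    by rewrite lfunE; apply: (subvsP y).
  by exists (Subvs xk); rewrite ?memvf // lfunE.
have c2 : chain (fun=> True) (standard P) (zero_submod (P i)) (full_submod (P i)).
  apply: (chain_trans (V := trace_submod P i)).
    exact: chain_weaken ((standard_filteredP P i _).1 (filP i)).
  apply: (@chain1 _ _ _ _ _ _ _ _ i) => //; first exact: subvf.
  exact: factor_quot.
have := chain_preim hh lh c2; move/(chain_trans c1).
by apply: chain_sub => //=; apply/vspaceP => x; rewrite -memv_preim !memvf.
Qed.
End Projectives.

Section Factor.
Variables (K : fieldType) (A : falgType K).
Implicit Types M N P : fdmodule A.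

Lemma factor_of_hom P M (U : submodule P) (W V : submodule M) (h : 'Hom(P, M)) :
  is_hom h -> (W <= V)%VS -> (forall x, h x \in V) ->
  (forall v, v \in V -> exists x, v - h x \in W) ->
  (forall x, (h x \in W) = (x \in U)) ->
  factor W V (quot_mod U).
Proof.
move=> hh WV hV hs hU; apply/factorP=> //; apply: iso_sym.
pose Y := SubModule (@sub_in_stable _ _ M V W).
have Yin (x : sub_mod V) : (x \in (Y : {vspace _})) = (val x \in W).
  by rewrite /= /sub_in_space -memv_preim lfunE.
pose h' : 'Hom(P, sub_mod V) := (linfun (vsproj V) \o h)%VF.
have h'E x : val (h' x) = h x.
  by rewrite comp_lfunE (lfunE (vsproj V)) /= vsprojK.
have hh' : is_hom h' by move=> a x; apply: val_inj; rewrite /= !h'E hh.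
pose f : 'Hom(quot_mod U, subquot V W) := (quot_pi Y \o (h' \o quot_repr U))%VF.
have fE x : f (quot_pi U x) = quot_pi Y (h' x).
  rewrite comp_lfunE (comp_lfunE h'); apply: quot_pi_eq.
  rewrite -linearB Yin h'E hU -opprB rpredN; exact: quot_piK.
have hq M' (U' : submodule M') a (x : M') :
    act a (quot_pi U' x : quot_mod U') = quot_pi U' (act a x).
  by symmetry; apply: hom_quot.
exists f; split.
- move=> a z; rewrite -[z](quot_reprK (U := U)); set w : P := quot_repr U z.
  by rewrite hq !fE hq hh'.
- apply/eqP/lker0P => z z'; rewrite -[z](quot_reprK (U := U)) -[z'](quot_reprK (U := U)).
  rewrite !fE => /eqP; rewrite -subr_eq0 -linearB quot_pi_eq0 -linearB Yin h'E hU.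
  exact: quot_pi_eq.
- apply/limg_fullP => y; have [x xW] := hs _ (subvsP (quot_repr Y y)).
  exists (quot_pi U x); rewrite fE -[RHS](quot_reprK (U := Y)); symmetry.
  by apply: quot_pi_eq; rewrite Yin /= h'E.
Qed.

Lemma end_iso_fieldP M : end_iso_field M <->
  {:M}%VS <> 0%VS /\ forall f : 'End(M), is_hom f -> exists c, f = c *: \1%VF.
Proof.
split=> [[psi [pl p1 pM pi pE]]|[M0 sc]].
  have p0 : psi 0 = 0.
    have := pl 1 0 0; rewrite mulr0 addr0 scale1r => e.
    by apply: (addrI (psi 0)); rewrite addr0 -e.
  have pZ c : psi c = c *: \1%VF by have := pl c 1 0; rewrite mulr1 addr0 p0 addr0 p1.
  split=> [M0|f /pE[c ->]]; last by exists c.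
  apply: (elimF eqP (oner_eq0 K)); apply: pi; apply/lfunP => x.
  have : x \in (0%VS : {vspace M}) by rewrite -M0 memvf.
  by rewrite memv0 => /eqP ->; rewrite !linear0.
exists (fun c => c *: \1%VF); split=> [c a b||a b|a b|f].
- by rewrite scalerDl scalerA.
- by rewrite scale1r.
- by rewrite -comp_lfunZl -comp_lfunZr comp_lfun1l scalerA.
- have v0 : vpick {:M} != 0 by rewrite vpick0; apply/eqP.
  move/lfunP/(_ (vpick {:M})); rewrite !scale_lfunE id_lfunE => /eqP.
  by rewrite -subr_eq0 -scalerBl scaler_eq0 (negPf v0) orbF subr_eq0 => /eqP.
- split=> [/sc //|[c ->] a x].
  by rewrite !scale_lfunE !id_lfunE actZ.
Qed.

End Factor.

(** * Idempotents generating the projective covers, and traces *)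

Section Generated.
Variables (K : fieldType) (A : falgType K) (d : Order.disp_t) (I : finPOrderType d).
Variables (P : I -> fdmodule A) (g : forall i, P i) (s : forall i, 'Hom(P i, regular A)).
Hypothesis hs : forall i, is_hom (s i).
Hypothesis sg : forall i u, act (s i u : A) (g i) = u.

Definition gen_idem i : A := s i (g i).
Local Notation f := gen_idem.

Lemma gen_idem_act i u : (s i u : A) * f i = s i u.
Proof. by have := @hs i (s i u) (g i); rewrite sg. Qed.

Lemma gen_idem_gen i : act (f i) (g i) = g i. Proof. exact: sg. Qed.

Lemma gen_idemK i : f i * f i = f i. Proof. exact: gen_idem_act. Qed.

Lemma gen_act_s i c : s i (act c (g i)) = c * f i :> A.
Proof. by rewrite hs. Qed.

(** A homomorphism from P j is determined by the image z of g j, and the possible z are those fixed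
    by the idempotent f j. So the trace is the submodule generated by such z, of which this lemma
    and the next are the two halves. *)
Lemma mem_trace i j z : ~~ (j <= i)%O -> act (f j) z = z -> z \in trace_space P i.
Proof.
move=> ji fz; pose h : 'Hom(P j, P i) := (orbit_map z \o s j)%VF.
have hE u : h u = act (s j u : A) z by rewrite comp_lfunE orbit_mapE.
have hh : is_hom h by move=> a x; rewrite !hE hs actM.
have := proj1 (trace_spaceP (trace_space P i)) (subvv _) j h ji hh.
by move/subvP; apply; rewrite -fz -hE memv_img ?memvf.
Qed.

Lemma trace_sub i (U : {vspace P i}) : (forall a x, x \in U -> act a x \in U) ->
  (forall j z, ~~ (j <= i)%O -> act (f j) z = z -> z \in U) ->
  (trace_space P i <= U)%VS.
Proof.
move=> sU fU; apply/trace_spaceP => j h ji hh; apply/subvP => _ /memv_imgP[x _ ->].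
by rewrite -(sg x) hh; apply/sU/(fU j) => //; rewrite -hh gen_idem_gen.
Qed.

(* Otherwise the quotient of A by this ideal has a simple quotient, isomorphic
   to some L j, on which the idempotent f j acts as zero. *)
Lemma idem_ideal_full (L : I -> fdmodule A) (p : forall i, 'Hom(P i, L i)) :
  is_Sim L -> (forall i, is_hom (p i)) -> (forall i, p i (g i) <> 0) ->
  (1 : A) \in (\sum_j {:A} * <[f j]> * {:A})%VS.
Proof.
move=> [_ _ simL] hp pg0; set V := (\sum_j _)%VS.
have sV (a x : regular A) : x \in V -> act (a : A) x \in V.
  move=> /memv_sumP[v vV ->]; rewrite act_sum; apply: memv_suml => j _.
  apply: (subvP (sumv_sup j isT (subvv _))).
  suff : (<[a]> * ({:A} * <[f j]> * {:A}) <= {:A} * <[f j]> * {:A})%VS.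
    by move/subvP; apply; apply: memv_mul (memv_line _) (vV j isT).
  by rewrite !prodvA; do 2?[apply: prodvSl]; apply: subvf.
pose VS : submodule (regular A) := SubModule sV.
have [q0|q0] := eqVneq {:quot_mod VS}%VS 0%VS.
  have : quot_pi VS 1 \in (0%VS : {vspace quot_mod VS}) by rewrite -q0 memvf.
  by rewrite memv0 quot_pi_eq0.
have [N [q [sN hq lq]]] := simple_quotient (elimN eqP q0).
have [j [h [hh /eqP kh lh]]] := simL N sN.
have zero (y : L j) : act (f j) y = 0.
  have [z <-] := (limg_fullP h).1 lh y; have [w <-] := (limg_fullP q).1 lq z.
  rewrite -[w](quot_reprK (U := VS)) -hh -hq; set b : regular A := quot_repr VS w.
  have -> : act (f j) (quot_pi VS b : quot_mod VS) = quot_pi VS (act (f j) b).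
    by symmetry; apply: hom_quot.
  suff /eqP -> : quot_pi VS (act (f j) b) == 0 by rewrite !linear0.
  rewrite quot_pi_eq0 /=; apply: (subvP (sumv_sup j isT (subvv _))).
  rewrite memv_mul ?memvf //.
  by rewrite -[X in X \in _]mul1r memv_mul ?memvf ?memv_line.
by case: (pg0 j); rewrite -gen_idem_gen hp zero.
Qed.

End Generated.

(** * Quasi-heredity of an algebra with a layered ideal chain *)

Section Restriction.
Variables (K : fieldType) (A B : falgType K) (v : A -> B).
Hypotheses (v_lin : linear v) (v1 : v 1 = 1) (vM : forall x y, v (x * y) = v x * v y).
Variable M : fdmodule B.

Fact pull_bilinear : is_bilinear (fun (x : A) (m : M) => act (v x) m).
Proof.
by split=> [x|m c x y]; [exact: act_linear | rewrite v_lin act_linear_l].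
Qed.
Fact pull1 (m : M) : act (v 1) m = m. Proof. by rewrite v1 act1. Qed.
Fact pullM x y (m : M) : act (v (x * y)) m = act (v x) (act (v y) m).
Proof. by rewrite vM actM. Qed.

Definition pull : fdmodule A := FDModule pull_bilinear pull1 pullM.
End Restriction.

Section LeftIdeal.
Variables (K : fieldType) (A : falgType K) (f : A).

Fact lideal_stable (a : A) (x : regular A) :
  x \in ({:A} * <[f]>)%VS -> act a x \in ({:A} * <[f]>)%VS.
Proof.
case/memv_cosetP => b _ ->; apply/memv_cosetP; exists (a * b); rewrite ?memvf //.
exact: mulrA.
Qed.

Definition lideal : submodule (regular A) := SubModule lideal_stable.
Definition lideal_mod : fdmodule A := sub_mod lideal.
Definition lgen : lideal_mod.
Proof.
exists f; apply/memv_cosetP; exists 1; rewrite ?memvf //; exact: esym (mul1r f).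
Defined.
Definition lsub (U : submodule (regular A)) : submodule lideal_mod :=
  SubModule (@sub_in_stable _ _ (regular A) lideal U).

Lemma mem_lsub U x : (x \in (lsub U : {vspace _})) = (val x \in (U : {vspace A})).
Proof. by rewrite /= /sub_in_space -memv_preim lfunE. Qed.

Hypothesis ff : f * f = f.

Lemma lideal_idem (x : lideal_mod) : (val x : A) * f = val x.
Proof.
have /memv_cosetP[b _ ->] : (val x : A) \in ({:A} * <[f]>)%VS := subvsP x.
by rewrite -mulrA ff.
Qed.

Lemma orbit_lgen a : val (orbit_map lgen a) = a * f :> A.
Proof. by rewrite orbit_mapE. Qed.

Lemma orbit_lgenK (x : lideal_mod) : orbit_map lgen (val x) = x.
Proof. by apply: val_inj; rewrite orbit_lgen; apply: lideal_idem. Qed.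

Lemma lideal_projective : projective lideal_mod.
Proof.
apply: (projective_retract (@hom_val _ _ _ lideal) (hom_orbit lgen) _
  (@projective_regular _ A)) => u.
by rewrite (lfunE vsval) orbit_lgenK.
Qed.

End LeftIdeal.

Section Stratified.
Variables (K : fieldType) (n : nat) (S : 'I_n -> falgType K) (A : falgType K).
(** [inj] is the non-unital inclusion of A_i in A and [out] the projection of A onto A_i. That [out]
    is compression by e_i means e_i A e_i = A_i; that it is also multiplicative means that e_i A e_j
    A e_i = 0 for j different from i. *)
Variables (inj : forall i, S i -> A) (out : forall i, A -> S i).
Local Notation e i := (inj (1 : S i)).

Hypothesis inj_lin : forall i, linear (@inj i).
Hypothesis injM : forall i (x y : S i), inj (x * y) = inj x * inj y.
Hypothesis out_lin : forall i, linear (out i).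
Hypothesis out1 : forall i, out i 1 = 1.
Hypothesis outM : forall i x y, out i (x * y) = out i x * out i y.
Hypothesis injK : forall i (x : S i), out i (inj x) = x.
Hypothesis outE : forall i a, inj (out i a) = e i * a * e i.
Hypothesis sum_e : \sum_i e i = 1.
Hypothesis e_orth : forall i j, i != j -> e i * e j = 0.

Lemma inj0 i : inj (0 : S i) = 0. Proof. exact: (linear0_of (@inj_lin i)). Qed.
Lemma out0 i : out i 0 = 0. Proof. exact: (linear0_of (@out_lin i)). Qed.
Lemma outD i x y : out i (x + y) = out i x + out i y.
Proof. by have := @out_lin i 1 x y; rewrite !scale1r. Qed.
Lemma mule_l i (x : S i) : e i * inj x = inj x. Proof. by rewrite -injM mul1r. Qed.
Lemma mule_r i (x : S i) : inj x * e i = inj x. Proof. by rewrite -injM mulr1. Qed.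
Lemma out_orth i j (x : S i) : i != j -> out j (inj x) = 0.
Proof.
move=> ij; rewrite -[out j _]injK outE -(mule_l x) !mulrA e_orth ?mul0r ?out0 //.
by rewrite eq_sym.
Qed.

(** * Simple modules come from the vertices *)

Section Restrict.
Variables (i : 'I_n) (M : fdmodule A) (eM : forall m : M, act (e i) m = m).

Fact restr_bilinear : is_bilinear (fun (x : S i) (m : M) => act (inj x) m).
Proof.
by split=> [x|m c x y]; [exact: act_linear | rewrite inj_lin act_linear_l].
Qed.
Fact restrM (x y : S i) (m : M) : act (inj (x * y)) m = act (inj x) (act (inj y) m).
Proof. by rewrite injM actM. Qed.

Definition restr : fdmodule (S i) := FDModule restr_bilinear eM restrM.
End Restrict.

Definition vpull i := pull (@out_lin i) (out1 i) (@outM i).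

Lemma vpull_simple i (L : fdmodule (S i)) : simple_module L -> simple_module (vpull L).
Proof.
move=> [L0 sL]; split=> // U.
have sU (a : S i) (x : L) : x \in (U : {vspace L}) -> act a x \in (U : {vspace L}).
  by move=> xU; have := @submodP _ _ _ U (inj a) x xU; rewrite /= injK.
exact: (sL (SubModule sU)).
Qed.

Lemma vpull_iso i j (L : fdmodule (S i)) (L' : fdmodule (S j)) :
  simple_module L -> iso (vpull L) (vpull L') ->
  exists ij : i = j, iso (ecast i (fdmodule (S i)) ij L) L'.
Proof.
move=> [L0 _] [f [hf /eqP kf lf]].
have [ij|ij] := eqVneq i j; last first.
  (* e_i acts as the identity on the first module and as zero on the second, so f vanishes although
     it is injective. *)
  case: L0; apply/eqP; rewrite -subv0; apply/subvP => x _; rewrite memv0.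
  apply/eqP/(lker0I kf); rewrite linear0.
  have := hf (e i) x; rewrite /= injK act1 out_orth // act0l; exact.
case: j / ij L' f hf kf lf => L' f hf kf lf; exists erefl; exists f; split=> //.
  by move=> a x; have := hf (inj a) x; rewrite /= injK.
exact/eqP.
Qed.

(* A simple module M with e_i M nonzero has M = A e_i M, so that for j different
   from i, e_j M nonzero would imply M = A e_j M and
   e_i M = (e_i A e_j A e_i) M = 0. *)
Lemma simple_vertex (M : fdmodule A) : simple_module M ->
  exists i, forall m : M, act (e i) m = m.
Proof.
move=> sM; have x0 : vpick {:M} <> 0 by apply/eqP; rewrite vpick0; apply/eqP/(sM.1).
set x := vpick _ in x0.
have [i /eqP yi0] : exists i, act (e i) x != 0.
  apply/existsP; rewrite -negb_forall; apply/negP => /forallP h0; apply: x0.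
  by rewrite -[x]act1 -sum_e act_suml big1 // => i _; apply/eqP.
have cyc (y z : M) : y <> 0 -> exists a, act a y = z.
  move=> y0; have [a az] := (limg_fullP _).1 (simple_cyclic sM y0) z.
  by exists a; rewrite -az orbit_mapE.
have ej0 j (m : M) : i != j -> act (e j) m = 0.
  move=> ij; have [//|/eqP z0] := eqVneq (act (e j) m) 0; case: (yi0).
  have [a az] := cyc _ (act (e i) x) z0.
  have [c cz] := cyc (act (e i) x) m yi0.
  have -> : act (e i) x = act (e i * (a * e j * c) * e i) x.
    by rewrite !actM cz az -actM mule_l.
  by rewrite -outE !outM out_orth ?(eq_sym _ i) // mulr0 mul0r inj0 act0l.
exists i => m; rewrite -[RHS]act1 -sum_e act_suml (bigD1 i) //= big1 ?addr0 // => j ji.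
by apply: ej0; rewrite eq_sym.
Qed.

Lemma simple_pull (M : fdmodule A) : simple_module M ->
  exists i (L : fdmodule (S i)), simple_module L /\ iso M (vpull L).
Proof.
move=> sM; have [i eM] := simple_vertex sM.
have actE a (m : M) : act (inj (out i a)) m = act a m.
  by rewrite outE !actM !eM.
exists i, (restr eM); split; [split; first exact: sM.1|].
  move=> U; have sU a (x : M) : x \in (U : {vspace M}) -> act a x \in (U : {vspace M}).
    by move=> xU; rewrite -actE; apply: (@submodP _ _ _ U (out i a) x xU).
  exact: (sM.2 (SubModule sU)).
exists \1%VF; split; last exact: lim1g.
  by move=> a x; rewrite !id_lfunE /= actE.
by apply/eqP/lker0P => x y; rewrite !id_lfunE.
Qed.

Variables (d : Order.disp_t) (I : 'I_n -> finPOrderType d).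
Variable L : forall i, I i -> fdmodule (S i).
Hypothesis simL : forall i, is_Sim (@L i).

Local Notation T := {i : 'I_n & I i}.
Definition sim_pull (t : T) : fdmodule A := vpull (L (tagged t)).

Lemma is_Sim_pull : is_Sim sim_pull.
Proof.
split=> [t|[i x] [j y]|M /simple_pull[i [N [sN MN]]]].
- by apply: vpull_simple; case: (simL (tag t)).
- rewrite /sim_pull /=; case: (simL i) => sL _ _ /(vpull_iso (sL x))[ij h].
  case: j / ij y h => y h; case: (simL i) => _ Linj _.
  by rewrite (Linj _ _ h).
- case: (simL i) => _ _ /(_ N sN)[x [f [hf kf lf]]]; exists (existT _ i x).
  apply: iso_trans MN _; exists f; split=> // a m; exact: hf.
Qed.

(* For the tensor algebra J k is the ideal J_k and C m the space C_m introduced at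
   the top.  For (d, phi) in right_basis i, the d and the restrictions of the phi
   form a dual basis of D_i, and phi is the coordinate tensored with C_i, seen as a
   map on J_i / J_(i+1). *)
Variables (J : nat -> {vspace A}) (C : 'I_n -> {vspace A}).
Hypothesis J_left : forall k a u, u \in J k -> a * u \in J k.
Hypothesis J_right : forall k a u, u \in J k -> u * a \in J k.
Hypothesis J_mono : forall k, (J k.+1 <= J k)%VS.
Hypothesis J_end : J n = 0%VS.
Hypothesis e_C : forall i, e i \in C i.
Hypothesis C_J : forall i, (C i <= J i)%VS.
Hypothesis C_e : forall i x, x \in C i -> e i * x = x.
Hypothesis C_l : forall i (y : S i) x, x \in C i -> inj y * x \in C i.
Hypothesis C_r : forall i j (y : S j) x, x \in C i -> x * inj y \in C i.

Hypothesis right_basis : forall i, exists r : seq (A * 'End(A)),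
  [/\ forall t u, t \in r -> t.2 u \in C i,
      forall t u, t \in r -> u \in J i.+1 -> t.2 u = 0,
      forall u, u \in J i -> u - \sum_(t <- r) t.1 * t.2 u \in J i.+1 &
      forall t u x, t \in r -> x \in C i -> t.2 (u * e i * x) = t.2 (u * e i) * x].

Hypothesis left_basis : forall i,
  exists (X : finType) (c : X -> A) (chi : X -> 'Hom(A, S i)),
  [/\ forall t, c t \in C i,
      forall t y x, x \in C i -> chi t (inj y * x) = y * chi t x &
      forall x, x \in C i -> x = \sum_t inj (chi t x) * c t].

Lemma J_le k l : (k <= l)%N -> (J l <= J k)%VS.
Proof.
move/subnK <-; elim: (l - k)%N => [|m IH]; first exact: subvv.
by rewrite addSn; apply: subv_trans (J_mono _) IH.
Qed.

Lemma e_J i : e i \in J i. Proof. by apply: (subvP (C_J i)); apply: e_C. Qed.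

Lemma inj_J (i : 'I_n) k (x : S i) : (k <= i)%N -> inj x \in J k.
Proof.
by move=> ki; apply: (subvP (J_le ki)); rewrite -mule_l; apply/J_right/e_J.
Qed.

(* By downward induction on k, since an element of J k is a combination of
   elements of A e_k A modulo J (k + 1). *)
Lemma J_ind k (U : {vspace A}) : (forall a u, u \in U -> a * u \in U) ->
  (forall (i : 'I_n) b, (k <= i)%N -> e i * b \in U) -> (J k <= U)%VS.
Proof.
move=> Ul; have [kn|/ltnW nk _] := leqP k n; last first.
  by apply: subv_trans (J_le nk) _; rewrite J_end sub0v.
rewrite -(subKn kn); move: (n - k)%N (leq_subr k n) => m; elim: m => [_ _|m IH mn eU].
  by rewrite subn0 J_end sub0v.
have lt : (n - m.+1 < n)%N by rewrite ltn_subrL (leq_ltn_trans _ mn).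
have eS : ((n - m.+1).+1 = n - m)%N by rewrite -subSn // subSS.
have [r [rC _ rJ _]] := right_basis (Ordinal lt).
apply/subvP => u uJ; rewrite -[u](subrK (\sum_(t <- r) t.1 * t.2 u)); apply: rpredD.
  have := rJ _ uJ; rewrite /= eS; apply: subvP; apply: IH (ltnW mn) _ => i b mi.
  by apply: eU; apply: leq_trans mi; rewrite -eS.
rewrite big_seq; apply: rpred_sum => t tr; apply: Ul.
by rewrite -(C_e (rC t u tr)); apply: eU.
Qed.

(** J k is generated by the e_j with j >= k, all of which [out i] kills; its kernel is an ideal. *)
Lemma out_J (i : 'I_n) k u : (i < k)%N -> u \in J k -> out i u = 0.
Proof.
move=> ik; pose V : {vspace A} := lker (linfun (out i)).
have memV x : (x \in V) = (out i x == 0) by rewrite memv_ker (linfunE (@out_lin i)).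
suff : (J k <= V)%VS by move/subvP => /[apply]; rewrite memV => /eqP.
apply: J_ind => [a x|j b kj]; rewrite !memV outM; first by move/eqP->; rewrite mulr0.
rewrite out_orth ?mul0r //; apply: contraTneq kj => ->; by rewrite -ltnNge.
Qed.

Variable P : forall i, I i -> fdmodule (S i).
Variable g : forall i (x : I i), P x.
Variable s : forall i (x : I i), 'Hom(P x, regular (S i)).
Hypothesis hs : forall i (x : I i), is_hom (s x).
Hypothesis sg : forall i (x : I i) u, act (s x u : S i) (g x) = u.

Variable p : forall i (x : I i), 'Hom(P x, L x).
Hypothesis hp : forall i (x : I i), is_hom (p x).
Hypothesis pg0 : forall i (x : I i), p x (g x) <> 0.

Local Notation fi i x := (gen_idem (@g i) (@s i) x).

Definition lidem (t : T) : A := inj (fi (tag t) (tagged t)).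
Definition PA (t : T) : fdmodule A := lideal_mod (lidem t).
Definition gA (t : T) : PA t := lgen (lidem t).
Definition sA (t : T) : 'Hom(PA t, regular A) := linfun vsval.

Lemma lidemK t : lidem t * lidem t = lidem t.
Proof. by rewrite -injM (gen_idemK (@hs _) (@sg _)). Qed.

Lemma sAE t (u : PA t) : sA t u = val u. Proof. by rewrite /sA lfunE. Qed.

Lemma hsA t : is_hom (sA t). Proof. exact: (@hom_val _ _ _ (lideal (lidem t))). Qed.

Lemma sgA t u : act (sA t u : A) (gA t) = u.
Proof. by rewrite sAE -orbit_mapE (orbit_lgenK (lidemK t)). Qed.

Lemma gen_idemA t : gen_idem gA sA t = lidem t. Proof. exact: sAE. Qed.

Lemma nle_tag (m : 'I_n) (j : I m) (t : T) : ~~ (t <= existT I m j)%O ->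
  (m < tag t)%N \/ exists2 j', t = existT I m j' & ~~ (j' <= j)%O.
Proof.
case: t => m' j' /= /negP nle; have [le|] := leqP m' m; last by left.
right; have [mm|ne] := eqVneq m' m; last first.
  by case: nle; apply/le_disjoint_union; left; rewrite ltn_neqAle le andbT.
case: m / mm j nle {le} => j nle; exists j' => //; apply/negP => jj.
by apply: nle; apply/le_disjoint_union; right; exists erefl.
Qed.

Lemma tag_nle (m : 'I_n) (j : I m) (t : T) : (m < tag t)%N -> ~~ (t <= existT I m j)%O.
Proof.
case: t => m' j' /= lt; apply/negP => /le_disjoint_union[|[e _]].
  by rewrite ltnNge ltnW.
by rewrite e ltnn in lt.
Qed.

Lemma tagged_nle (m : 'I_n) (j j' : I m) : ~~ (j' <= j)%O ->
  ~~ (existT I m j' <= existT I m j)%O.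
Proof.
apply: contraNN => /le_disjoint_union[|[e]]; first by rewrite ltnn.
by rewrite (eq_axiomK e).
Qed.

Lemma tag_lt (m : 'I_n) (j : I m) (t : T) : (m < tag t)%N -> (existT I m j < t)%O.
Proof.
move=> lt; rewrite lt_neqAle; apply/andP; split.
  by apply: contraTneq lt => <- /=; rewrite ltnn.
by case: t lt => m' j' /= lt; apply/le_disjoint_union; left.
Qed.

Lemma tagged_lt (m : 'I_n) (j j' : I m) : (j < j')%O -> (existT I m j < existT I m j')%O.
Proof.
rewrite !lt_neqAle => /andP[ne le]; apply/andP; split.
  by apply: contraNneq ne => /eqP; rewrite -tag_eqE /tag_eq eqxx /= tagged_asE.
by apply/le_disjoint_union; right; exists erefl.
Qed.

(** P x embedded in A as the part A_i f of A f. This is one of the two maps to which the lifting of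
    filtrations is applied; the other is [layer_val]. *)
Definition injs i (x : I i) : 'Hom(P x, A) := linfun (fun u => inj (s x u : S i)).

Lemma injsE i (x : I i) u : injs x u = inj (s x u : S i).
Proof. by apply: linfunE => c a b; rewrite linearP inj_lin. Qed.

Lemma injs_act i (x : I i) (a : S i) u : injs x (act a u) = inj a * injs x u.
Proof. by rewrite !injsE hs injM. Qed.

Lemma injs_inj i (x : I i) : injective (injs x).
Proof.
move=> u v; rewrite !injsE => /(congr1 (out i)); rewrite !injK => uv.
by rewrite -(sg u) uv sg.
Qed.

Lemma injs_lidem i (x : I i) u : injs x u * lidem (existT I i x) = injs x u.
Proof. by rewrite injsE -injM /= (gen_idem_act (@hs i) (@sg i)). Qed.

Lemma injs_gen i (x : I i) : injs x (g x) = lidem (existT I i x).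
Proof. exact: injsE. Qed.

(** * Lifting submodules from a vertex algebra to A *)

Section Lift.
Variables (m : 'I_n) (X : fdmodule (S m)) (inc : 'Hom(X, A)).

Fact lift_stable (W : {vspace X}) (a : A) (x : regular A) :
  x \in ({:A} * (inc @: W) + J m.+1)%VS ->
  act a x \in ({:A} * (inc @: W) + J m.+1)%VS.
Proof.
case/memv_addP => y yW [z zJ ->]; rewrite /= mulrDr; apply: memv_add.
  suff : (<[a]> * ({:A} * (inc @: W)) <= {:A} * (inc @: W))%VS.
    by move/subvP; apply; apply: memv_mul (memv_line _) yW.
  by rewrite prodvA; apply: prodvSl; apply: subvf.
exact: J_left.
Qed.

Definition lift_sub (W : {vspace X}) : submodule (regular A) :=
  SubModule (@lift_stable W).

Lemma lift_sub_ind (W : {vspace X}) (U : {vspace A}) :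
  (forall a w, w \in W -> a * inc w \in U) -> (J m.+1 <= U)%VS ->
  (lift_sub W <= U)%VS.
Proof.
move=> WU JU; rewrite subv_add JU andbT; apply/prodvP => a _ _ /memv_imgP[w wW ->].
exact: WU.
Qed.

Lemma mem_lift_sub (W : {vspace X}) a w : w \in W ->
  a * inc w \in (lift_sub W : {vspace A}).
Proof.
by move=> wW; apply: (subvP (addvSl _ _)); rewrite memv_mul ?memvf ?memv_img.
Qed.

Lemma J_lift_sub (W : {vspace X}) : (J m.+1 <= lift_sub W)%VS.
Proof. exact: addvSr. Qed.

End Lift.

(** There are two sorts of indices not below x. Those at vertices above i have idempotents
    generating J_(i+1). Those at i itself, say j, contribute elements of f_j A f, which lies in e_i
    A e_i = A_i, and hence only the trace over A_i. *)
Lemma mem_traceA i (x : I i) (u : PA (existT I i x)) :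
  (u \in trace_space PA (existT I i x)) =
  (val u \in (lift_sub (injs x) (trace_space (@P i) x) : {vspace A})).
Proof.
set t := existT I i x; set G := lift_sub _ _.
have ind (b : A) : b \in (G : {vspace A}) -> orbit_map (gA t) b \in trace_space PA t.
  rewrite memv_preim; apply: subvP => {b}; apply: lift_sub_ind => [a w|].
    rewrite -memv_preim => wT; rewrite orbit_mapE actM; apply: trace_stable.
    rewrite -orbit_mapE; move: w wT.
    pose U := ((orbit_map (gA t) \o injs x) @^-1: trace_space PA t)%VS.
    have memU w : (w \in U) = (orbit_map (gA t) (injs x w) \in trace_space PA t).
      by rewrite /U -memv_preim comp_lfunE.
    move=> w wT; rewrite -memU; apply: subvP wT; apply: (trace_sub (@sg i)).
      move=> c z; rewrite !memU injs_act !orbit_mapE actM; exact: trace_stable.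
    move=> j z jx fz; rewrite memU; apply: (mem_trace (g := gA) hsA (j := existT I i j)).
      exact: tagged_nle.
    by rewrite gen_idemA orbit_mapE -actM -injs_act fz.
  apply: J_ind => [a b|j b ij].
    rewrite -!memv_preim !orbit_mapE actM; exact: trace_stable.
  have ml : linear (fun c : S j => inj c * b).
    by move=> k c1 c2; rewrite inj_lin mulrDl scalerAl.
  pose psi := (orbit_map (gA t) \o linfun (fun c : S j => inj c * b))%VF.
  have psiE c : psi c = orbit_map (gA t) (inj c * b).
    by rewrite comp_lfunE (linfunE ml).
  rewrite -memv_preim -psiE memv_preim.
  (* The idempotents f_y of A_j generate A_j as an ideal, so that e_j b is a sum of elements a f_y c
     b; each lies in the trace because j > i. *)
  have := idem_ideal_full (@sg j) (simL j) (@hp j) (@pg0 j); apply: subvP.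
  apply/subv_sumP => y _; apply/prodvP => _ v /memv_cosetP[a _ ->] _.
  rewrite -memv_preim psiE -mulrA injM -mulrA orbit_mapE actM; apply: trace_stable.
  apply: (mem_trace (g := gA) hsA (j := existT I j y)); first exact: tag_nle.
  by rewrite gen_idemA -actM mulrA -injM mulrA (gen_idemK (@hs j) (@sg j)).
apply/idP/idP => [|uG]; last by rewrite -(orbit_lgenK (lidemK t) u); apply: ind.
move=> uT; rewrite -(mem_lsub (f := lidem t)); apply: subvP uT.
apply: (trace_sub sgA); first by move=> a z; apply: submodP.
move=> t' z nle; rewrite gen_idemA => fz; rewrite mem_lsub.
have fv : lidem t' * val z = val z by rewrite -[in RHS]fz.
have [lt|[y ty yx]] := nle_tag nle.
  apply: (subvP (J_lift_sub _ _)); rewrite -fv; apply: J_right; exact: inj_J.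
rewrite {}ty in fz fv; have vf := lideal_idem (lidemK t) z.
have bE : val z = inj (out i (val z)).
  rewrite outE -fv -vf -!mulrA; rewrite !mule_r !mulrA mule_l; by [].
have sE : injs x (act (out i (val z)) (g x)) = val z.
  by rewrite injs_act injs_gen -bE.
rewrite -sE -[injs x _]mul1r; apply: mem_lift_sub.
apply: (mem_trace (g := @g i) (@hs i) yx).
apply: injs_inj; rewrite injs_act sE; exact: fv.
Qed.

(** Such a u lies in e_i A e_i, that is, in A_i. It is applied to the coordinates of elements of A
    e_i. *)
Lemma C_out i (u : A) x : u * e i = u -> u \in C i -> u * x = inj (out i u) * x.
Proof. by move=> ue uC; rewrite outE C_e // ue. Qed.

Section LiftFactor.
Variables (m : 'I_n) (X : fdmodule (S m)) (inc : 'Hom(X, A)) (f : A).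
Hypothesis hinc : forall (a : S m) w, inc (act a w) = inj a * inc w.
Hypothesis inc_inj : injective inc.
Hypothesis incC : forall w, inc w \in C m.
Hypothesis incf : forall w, inc w * f = inc w.
Lemma inc_lideal w : inc w \in (lideal f : {vspace A}).
Proof. by apply/memv_cosetP; exists (inc w); rewrite ?memvf ?incf. Qed.

(** A coordinate sends a w to phi(a e_m) w, where phi(a e_m) lies in e_m A e_m = A_m and W is stable
    under A_m. This is the substitute for the injectivity of D_m ⊗ W -> D_m ⊗ X. *)
Lemma right_basis_lift (W : submodule X) (phi : 'End(A)) :
  (forall u, phi u \in C m) -> (forall u, u \in J m.+1 -> phi u = 0) ->
  (forall u x, x \in C m -> phi (u * e m * x) = phi (u * e m) * x) ->
  forall u, u \in (lift_sub inc W : {vspace A}) -> phi u \in (inc @: W)%VS.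
Proof.
move=> phiC phi0 phiM u; rewrite memv_preim; apply: subvP => {u}.
apply: lift_sub_ind => [a w wW|]; last first.
  by apply/subvP => u uJ; rewrite -memv_preim phi0 // mem0v.
rewrite -memv_preim -(C_e (incC w)) mulrA phiM //.
have pe : phi (a * e m) * e m = phi (a * e m) by rewrite -phiM ?e_C // -mulrA mule_l.
by rewrite (C_out _ pe) // -hinc memv_img // submodP.
Qed.

(** The functor D_m ⊗ _ applied to 0 -> W -> V -> Δ_m(j) -> 0. If y in V lifts the generator of
    Δ_m(j), right multiplication by [inc y] maps A f_j onto the lift of V modulo the lift of W, and
    its kernel has to be the trace. *)
Lemma lift_factor (W V : submodule X) (j : I m) : (W <= V)%VS ->
  factor W V (standard (@P m) j) ->
  factor (lsub f (lift_sub inc W)) (lsub f (lift_sub inc V))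
    (standard PA (existT I m j)).
Proof.
move=> WV [q [qa qk qs]]; set t := existT I m j.
pose tr := trace_submod (@P m) j; pose pi := quot_pi tr.
have hpi a z : act a (pi z : standard (@P m) j) = pi (act a z).
  by symmetry; apply: hom_quot.
have [y0 y0V qy0] := qs (pi (g j)).
(* Multiplying by the idempotent preserves the image in Δ_m(j) and gives f_j y = y, so that A f_j
   [inc y] is all of A [inc y]. *)
pose y := act (fi m j) y0.
have yV : y \in (V : {vspace X}) by apply: submodP.
have qy : q y = pi (g j) by rewrite qa // qy0 hpi gen_idem_gen.
have qact a : q (act a y) = pi (act a (g j)) by rewrite qa // qy hpi.
have actW a : (act a y \in (W : {vspace X})) = (act a (g j) \in (tr : {vspace _})).
  by rewrite -qk; [rewrite qact quot_pi_eq0 | apply: submodP].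
pose u := inc y.
have tu : lidem t * u = u.
  by rewrite /u -hinc /y -actM (gen_idemK (@hs m) (@sg m)).
pose u' : lideal_mod f := Subvs (inc_lideal y).
pose h : 'Hom(PA t, lideal_mod f) := (orbit_map u' \o sA t)%VF.
have hE x : val (h x) = val x * u :> A.
  by rewrite comp_lfunE orbit_mapE sAE.
apply: (factor_of_hom (h := h)).
- apply: hom_comp (hom_orbit u') (@hsA t).
- apply/subvP => x; rewrite !mem_lsub; apply: subvP; apply: addvS (subvv _).
  exact/prodvSr/limgS.
- by move=> x; rewrite mem_lsub hE; apply: mem_lift_sub.
- move=> v; rewrite mem_lsub => vV.
  have /memv_addP[_ /memv_cosetP[a _ ->] [r rW vE]] :
      (val v : A) \in ({:A} * <[u]> + lift_sub inc W)%VS.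
    apply: subvP vV; apply: lift_sub_ind => [b w wV|]; last first.
      by apply: subv_trans (J_lift_sub _ _) (addvSr _ _).
    have [z qz] : exists z, pi z = q w by exists (quot_repr tr (q w)); apply: quot_reprK.
    (* c y and w have the same image under q, so w - c y lies in W. *)
    pose c : S m := s j z.
    rewrite -[w](subrK (act c y)) linearD /= mulrDr addrC; apply: memv_add.
      by rewrite hinc mulrA memv_mul ?memvf ?memv_line.
    apply: mem_lift_sub; rewrite -qk ?linearB /= ?qact ?sg ?qz ?subrr //.
    by apply: rpredB => //; apply: submodP.
  exists (orbit_map (gA t) a); rewrite mem_lsub linearB /= hE orbit_lgen.
  by rewrite -mulrA tu -[vsval v]/(val v) vE addrC addKr.
move=> x; rewrite mem_lsub hE mem_traceA; apply/idP/idP; last first.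
  have -> : val x * u = amulr u (val x) by rewrite lfunE.
  rewrite memv_preim; apply: subvP; apply: lift_sub_ind => [a w wT|]; last first.
    apply/subvP => r rJ; rewrite -memv_preim lfunE /=.
    by apply: (subvP (J_lift_sub _ _)); apply: J_right.
  rewrite -memv_preim lfunE /= -mulrA injsE -hinc; apply: mem_lift_sub.
  by rewrite actW sg.
(* Let c in A_m be a coordinate of x. The same coordinate of x u is c u, so c y lies in W and c g_j
   in the trace over A_m; summing over the dual basis puts x = x f_j in the lift of this trace,
   modulo J_(m+1). *)
move=> xuW; have [r [rC r0 rJ rM]] := right_basis m.
have xt : val x * lidem t = val x := lideal_idem (lidemK t) x.
have te : lidem t * e m = lidem t by rewrite mule_r.
have xe : val x * e m = val x by rewrite -xt -mulrA te.
have xJ : (val x : A) \in J m by rewrite -xe; apply/J_left/e_J.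
rewrite -xt -[val x](subrK (\sum_(k <- r) k.1 * k.2 (val x))) mulrDl; apply: rpredD.
  by apply: (subvP (J_lift_sub _ _)); apply/J_right/rJ.
rewrite mulr_suml big_seq; apply: rpred_sum => k kr.
pose c := out m (k.2 (val x)).
have ke : k.2 (val x) * e m = k.2 (val x) by rewrite -xe -rM ?e_C // -mulrA mule_l.
rewrite -mulrA (C_out _ ke) ?rC // -/c -injs_gen -injs_act; apply: mem_lift_sub.
rewrite -actW; have : k.2 (val x * u) \in (inc @: W)%VS.
  by apply: right_basis_lift xuW; auto.
rewrite -xe rM ?incC // xe (C_out _ ke) ?rC // -/c -hinc => /memv_imgP[w wW /inc_inj ->].
exact: wW.
Qed.

Lemma lift_chain (R : I m -> Prop) (R' : T -> Prop) (W V : submodule X) :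
  (forall j, R j -> R' (existT I m j)) -> chain R (standard (@P m)) W V ->
  chain R' (standard PA) (lsub f (lift_sub inc W)) (lsub f (lift_sub inc V)).
Proof.
move=> RR'; elim=> {W V} [W V WV|W V U j Rj WV F _ IH].
  by apply: chain_refl; apply/vspaceP => x; rewrite !mem_lsub /= WV.
apply: chain_step (RR' j Rj) _ (lift_factor WV F) IH.
apply/subvP => x; rewrite !mem_lsub; apply: subvP; apply: addvS (subvv _).
exact/prodvSr/limgS.
Qed.

End LiftFactor.

(** * The layers of the ideal chain *)

Section LayerModule.
Variables (k : 'I_n) (i : 'I_n) (y : S i).
Local Notation f := (inj y).

Definition layer : {vspace A} := (C k * <[f]>)%VS.

Lemma layer_C x : x \in layer -> x \in C k.
Proof. by case/memv_cosetP => c cC ->; apply: C_r. Qed.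

Fact layer_stable (a : S k) x : x \in layer -> inj a * x \in layer.
Proof.
case/memv_cosetP => c cC ->; apply/memv_cosetP; exists (inj a * c); first exact: C_l.
exact: mulrA.
Qed.

Definition layer_act (a : S k) (x : subvs_of layer) : subvs_of layer :=
  Subvs (layer_stable a (subvsP x)).

Fact layer_bilinear : is_bilinear layer_act.
Proof.
split=> [a c x x'|x c a b]; apply: val_inj; rewrite /=.
  by rewrite mulrDr scalerAr.
by rewrite inj_lin mulrDl scalerAl.
Qed.
Fact layer_act1 x : layer_act 1 x = x.
Proof. by apply: val_inj; apply/C_e/layer_C/subvsP. Qed.
Fact layer_actM a b x : layer_act (a * b) x = layer_act a (layer_act b x).
Proof. by apply: val_inj; rewrite /= injM mulrA. Qed.

Definition layer_mod : fdmodule (S k) := FDModule layer_bilinear layer_act1 layer_actM.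

Definition layer_val : 'Hom(layer_mod, A) := linfun vsval.

Lemma layer_valE x : layer_val x = val x. Proof. exact: lfunE. Qed.

Hypothesis yy : y * y = y.

Lemma layer_idem x : x \in layer -> x * f = x.
Proof. by case/memv_cosetP => c _ ->; rewrite -mulrA -injM yy. Qed.

(** Multiplying a dual basis of C_k by f on the right gives one of C_k f, since f acts as the
    identity there. *)
Lemma layer_projective : projective layer_mod.
Proof.
have [X [c [chi [cC chiM cE]]]] := left_basis k.
apply/projectiveP; exists X, (fun t => vsproj layer (c t * f)).
exists (fun t => (chi t \o layer_val)%VF); split=> [t a x|u].
  by rewrite !comp_lfunE !layer_valE /= chiM //; apply/layer_C/subvsP.
apply: val_inj; rewrite -[LHS]layer_valE -[RHS]layer_valE linear_sum layer_valE /=.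
have /layer_C uC := subvsP u; rewrite -[LHS](layer_idem (subvsP u)) {1}(cE _ uC) mulr_suml.
apply: eq_bigr => t _; rewrite layer_valE comp_lfunE layer_valE /= vsprojK ?mulrA //.
by apply/memv_cosetP; exists (c t).
Qed.

End LayerModule.

Definition J_sub k : submodule (regular A) := @SubModule _ _ (regular A) (J k) (@J_left k).

Hypothesis covP : forall i (x : I i), projective_cover (P x) (L x).
Hypothesis filP : forall i (x : I i), standard_filtered (@P i) x (trace_submod (@P i) x).

(** Downward induction on k. The step lifts a standard filtration of the projective A_k-module C_k
    f, and the lift of all of C_k f is J_k f by the dual basis of D_k. Every index at k exceeds t,
    because k lies above the vertex of t. *)
Lemma J_chain (t : T) k : (tag t < k)%N ->
  chain (fun t' => (t < t')%O) (standard PA) (zero_submod (PA t))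
    (lsub (lidem t) (J_sub k)).
Proof.
have [nk _|kn] := leqP n k.
  apply: chain_refl; apply/vspaceP => x; rewrite mem_lsub memv0.
  apply/eqP/idP => [->|]; first by rewrite linear0 mem0v.
  by move/(subvP (J_le nk)); rewrite J_end memv0 => /eqP x0; apply: val_inj.
rewrite -(subKn (ltnW kn)); move: (n - k)%N (leq_subr k n) => {kn k} m.
elim: m => [_ _|m IH mn tk].
  apply: chain_refl; apply/vspaceP => x; rewrite mem_lsub memv0 subn0 /= J_end memv0.
  by apply/eqP/eqP => [->|x0]; [rewrite linear0 | apply: val_inj].
have lt : (n - m.+1 < n)%N by rewrite ltn_subrL (leq_ltn_trans _ mn).
have eS : ((n - m.+1).+1 = n - m)%N by rewrite -subSn // subSS.
pose k := Ordinal lt; have tk' : (tag t < n - m)%N by rewrite -eS leqW.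
apply: (chain_trans (IH (ltnW mn) tk')).
pose y : S (tag t) := fi (tag t) (tagged t).
have yy : y * y = y := gen_idemK (@hs (tag t)) (@sg (tag t)) (tagged t).
have c := projective_chain (simL k) (@covP k) (@filP k) (layer_projective (k := k) yy).
pose inc : 'Hom(layer_mod k y, A) := layer_val k y.
have hinc (a : S k) w : inc (act a w) = inj a * inc w by rewrite /inc !layer_valE.
have injv : injective inc by move=> u v; rewrite /inc !layer_valE => /val_inj.
have incC w : inc w \in C k by rewrite /inc layer_valE; apply/layer_C/subvsP.
have incf w : inc w * lidem t = inc w.
  by rewrite /inc layer_valE; apply: (layer_idem yy); apply: subvsP.
have RR' (j : I k) : True -> (t < existT I k j)%O.
  move=> _; rewrite [t](_ : _ = existT I (tag t) (tagged t)); last by case: (t).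
  exact: tag_lt.
have := lift_chain (R' := fun t' => (t < t')%O) hinc injv incC incf RR' c.
apply: chain_sub; apply/vspaceP => x.
  by rewrite !mem_lsub /= limg0 prodv0 add0v eS.
rewrite !mem_lsub; apply/idP/idP => [|xJ].
  apply: subvP; apply: lift_sub_ind => [a w _|]; last exact: J_mono.
  by apply: J_left; apply: (subvP (C_J k)).
have [r [rC _ rJ _]] := right_basis k.
rewrite -[val x](lideal_idem (lidemK t)).
rewrite -[val x](subrK (\sum_(q <- r) q.1 * q.2 (val x))).
rewrite mulrDl; apply: rpredD; first by apply: (subvP (J_lift_sub _ _)); apply/J_right/rJ.
rewrite mulr_suml big_seq; apply: rpred_sum => q qr; rewrite -mulrA.
have ql : q.2 (val x) * lidem t \in layer k y.
  by apply/memv_cosetP; exists (q.2 (val x)); rewrite ?rC.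
have -> : q.2 (val x) * lidem t = inc (Subvs ql) by rewrite /inc layer_valE.
by apply: mem_lift_sub; apply: memvf.
Qed.

(** The vertex i itself is treated apart: C_i f = A_i f is P x, of which only the trace is lifted,
    with the filtration given over A_i. Below it lies J_(i+1) f. *)
Lemma trace_filtered (t : T) : standard_filtered PA t (trace_submod PA t).
Proof.
case: t => i x; apply/standard_filteredP; set t := existT _ _ _.
apply: (chain_trans (J_chain (t := t) (ltnSn _))).
have c := (standard_filteredP (@P i) x _).1 (filP x).
have xC w : injs x w \in C i.
  by rewrite injsE -[s x w]mulr1 injM; apply/C_l/e_C.
have := lift_chain (R' := fun t' => (t < t')%O) (@injs_act i x) (@injs_inj i x) xC
  (@injs_lidem i x) (@tagged_lt i x) c.
apply: chain_sub; apply/vspaceP => u; first by rewrite !mem_lsub /= limg0 prodv0 add0v.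
by rewrite mem_lsub -mem_traceA.
Qed.

(** [out i] kills J_(i+1) and sends A τ to A_i τ, so membership in the trace over A can be tested
    over A_i. *)
Lemma out_trace i (x : I i) b :
  b \in (lift_sub (injs x) (trace_space (@P i) x) : {vspace A}) ->
  exists2 z, z \in trace_space (@P i) x & out i b = s x z.
Proof.
pose U := (linfun (out i) @^-1: (s x @: trace_space (@P i) x))%VS.
have memU u : (u \in U) = (out i u \in (s x @: trace_space (@P i) x)%VS).
  by rewrite -memv_preim (linfunE (@out_lin i)).
move=> bG; suff : b \in U by rewrite memU => /memv_imgP.
move: bG; apply: subvP; apply: lift_sub_ind => [a w wT|].
  rewrite memU outM injsE injK.
  have -> : out i a * s x w = s x (act (out i a) w) by rewrite hs.
  by rewrite memv_img // trace_stable.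
by apply/subvP => u uJ; rewrite memU (out_J (ltnSn i) uJ) mem0v.
Qed.

(** An endomorphism h is given by the image of the generator, represented by some b in f A f = f A_i
    f. Right multiplication by b then induces an endomorphism of the standard module over A_i, which
    is a scalar, and so is h. *)
Lemma end_iso_standardA (t : T) :
  end_iso_field (standard (@P (tag t)) (tagged t)) -> end_iso_field (standard PA t).
Proof.
case: t => i x /=; set t := existT _ _ _.
move=> /end_iso_fieldP[D0 Dsc]; apply/end_iso_fieldP.
pose tr := trace_submod (@P i) x; pose pi := quot_pi tr.
have hpi a z : act a (pi z : standard (@P i) x) = pi (act a z).
  by symmetry; apply: hom_quot.
pose trA := trace_submod PA t; pose piA := quot_pi trA.
have hpiA a z : act a (piA z : standard PA t) = piA (act a z).
  by symmetry; apply: hom_quot.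
have gtr : g x \notin trace_space (@P i) x.
  apply/negP => gT; apply: D0; apply/eqP; rewrite -subv0; apply/subvP => z _.
  rewrite memv0 -[z](quot_reprK (U := tr)) quot_pi_eq0 /= -(sg (quot_repr _ z)).
  exact: trace_stable.
split=> [D0A|h hh].
  have : piA (gA t) \in (0%VS : {vspace standard PA t}) by rewrite -D0A memvf.
  rewrite memv0 quot_pi_eq0 /= mem_traceA => /out_trace[z zT].
  rewrite /= injK => e; case/negP: gtr; rewrite -(gen_idem_gen (@sg i)) /gen_idem.
  by rewrite -[s x (g x)]/(fi i x) e sg.
pose b : PA t := act (lidem t) (quot_repr trA (h (piA (gA t)))).
have pib : piA b = h (piA (gA t)).
  rewrite -hpiA quot_reprK -hh hpiA; congr (h (piA _)).
  by apply: val_inj; apply: lidemK.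
have fb : lidem t * val b = val b by rewrite /b /= mulrA lidemK.
have bf : val b * lidem t = val b by apply: (lideal_idem (lidemK t)).
have bE : val b = inj (out i (val b)).
  by rewrite outE -fb -bf -!mulrA !mule_r !mulrA mule_l.
pose z := act (out i (val b)) (g x).
have sz : s x z = out i (val b) :> S i.
  by rewrite (gen_act_s (@g i) (@hs i)) -[in RHS]bf outM injK.
have fz : act (fi i x) z = z.
  rewrite /z -actM; congr (act _ _).
  by rewrite -[in RHS]fb outM injK.
(* Right multiplication by b preserves the trace over A because h is well defined on the quotient;
   [out_trace] carries this to A_i. *)
have ztr w : w \in trace_space (@P i) x -> act (s x w : S i) z \in trace_space (@P i) x.
  move=> wT; have : act (injs x w) b \in trA.
    rewrite -quot_pi_eq0 -hpiA pib -hh hpiA.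
    have /eqP -> : piA (act (injs x w) (gA t)) == 0.
      rewrite quot_pi_eq0 /= mem_traceA /= injs_lidem -[injs x w]mul1r.
      exact: mem_lift_sub.
    by rewrite linear0.
  rewrite /= mem_traceA => /out_trace[z' z'T].
  rewrite /= outM injsE injK -sz => e.
  by rewrite -(sg z) -actM e sg.
pose phi : 'End(standard (@P i) x) :=
  (pi \o (orbit_map z \o s x) \o quot_repr tr)%VF.
have phiE w : phi (pi w) = pi (act (s x w : S i) z).
  rewrite /phi comp_lfunE (comp_lfunE pi) (comp_lfunE _ (s x)) orbit_mapE.
  apply: quot_pi_eq; rewrite -actBl -linearB; apply: ztr.
  by rewrite -opprB rpredN; apply: quot_piK.
have hphi : is_hom phi.
  move=> a w; rewrite -[w](quot_reprK (U := tr)) -/pi hpi !phiE hpi; congr (pi _).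
  by rewrite hs actM.
have [c cE] := Dsc phi hphi; exists c.
have zc : z - c *: g x \in trace_space (@P i) x.
  rewrite -[trace_space _ _]/(submod_space tr) -quot_pi_eq0 linearB linearZ /= -/pi.
  have := phiE (g x); rewrite cE scale_lfunE id_lfunE => ->.
  by rewrite -[s x (g x)]/(fi i x) fz subrr.
have bc : piA b = c *: piA (gA t).
  apply/eqP; rewrite -subr_eq0 -linearZ -linearB quot_pi_eq0 /= mem_traceA.
  have -> : val (b - c *: gA t) = injs x (z - c *: g x).
    have -> : injs x (z - c *: g x) = injs x z - c *: lidem t.
      by rewrite linearB linearZ /= injs_gen.
    by rewrite injsE sz -bE.
  by rewrite -[injs x _]mul1r; apply: mem_lift_sub.
apply/lfunP => y; rewrite scale_lfunE id_lfunE -[y](quot_reprK (U := trA)) -/piA.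
rewrite -(sgA (quot_repr trA y)) -hpiA hh -pib bc actZ.
by [].
Qed.

Hypothesis p_sup : forall i (x : I i) (U : submodule (P x)),
  (U + lker (p x))%VS = fullv -> U = fullv :> {vspace P x}.

(** For superfluity of the kernel, a supplement U of it in A f is restricted to A_i f: its preimage
    in P x supplements the kernel of p, hence is everything and contains the generator. *)
Lemma coverA (t : T) : projective_cover (PA t) (sim_pull t).
Proof.
split; first exact: lideal_projective (lidemK t).
case: t => i x; set t := existT _ _ _.
pose q0 (u : PA t) : sim_pull t := act (out i (val u)) (p x (g x)).
have q0l : linear q0.
  move=> c u v; rewrite /q0; have -> : val (c *: u + v) = c *: val u + val v by [].
  by rewrite out_lin; apply: (@act_linear_l _ _ (L x) (p x (g x))).
have q0E := linfunE q0l; pose q : 'Hom(PA t, sim_pull t) := linfun q0.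
have hq : is_hom q.
  by apply: hom_linfun => // a u; rewrite /q0 /= outM actM.
have qE u : q u = p x (act (out i (val u)) (g x)) by rewrite /q q0E /q0 hp.
exists q; split=> //.
  apply/limg_fullP => y; have [sL _ _] := simL i.
  have [a ay] := (limg_fullP _).1 (simple_cyclic (sL x) (@pg0 i x)) y.
  exists (orbit_map (gA t) (inj a)); rewrite qE orbit_lgen /= -injM injK.
  by rewrite actM (gen_idem_gen (@sg i)) hp -orbit_mapE.
move=> U UK.
pose th := (orbit_map (gA t) \o injs x)%VF.
have thE w : th w = orbit_map (gA t) (injs x w) by rewrite comp_lfunE.
have vth w : val (th w) = injs x w by rewrite thE orbit_lgen injs_lidem.
have sV (a : S i) (w : P x) : w \in (th @^-1: U)%VS -> act a w \in (th @^-1: U)%VS.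
  by rewrite -!memv_preim !thE injs_act !orbit_mapE actM; apply: submodP.
have Vf : SubModule sV = fullv :> {vspace P x}.
  apply: p_sup; apply/eqP; rewrite eqEsubv subvf; apply/subvP => w _.
  have /memv_addP[u uU [k kK wE]] : th w \in (U + lker q)%VS by rewrite UK memvf.
  (* w' corresponds to e_i u, which lies in U, and w - w' to e_i k, which is in the kernel. *)
  pose w' := act (out i (val u)) (g x).
  rewrite -[w](subrK w') addrC; apply: memv_add.
    rewrite /= -memv_preim.
    have -> : th w' = act (e i) u; last exact: (@submodP _ _ _ U (e i) u uU).
    apply: val_inj; rewrite vth injs_act injs_gen outE -[LHS]mulrA mule_l -mulrA.
    by rewrite (lideal_idem (lidemK t)).
  rewrite memv_ker linearB /= {1}/w' -(sg w) !hp -actBl.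
  have -> : s x w = out i (val u) + out i (val k) :> S i.
    rewrite -outD; have -> : val u + val k = val (th w) by rewrite wE.
    by rewrite vth injsE injK.
  by rewrite addrC addKr; move: kK; rewrite memv_ker qE hp.
have gU : th (g x) \in (U : {vspace PA t}).
  by rewrite memv_preim; move: (memvf (g x)); rewrite -Vf.
apply/eqP; rewrite eqEsubv subvf; apply/subvP => u _; rewrite -(sgA u); apply: submodP.
by have -> : gA t = th (g x) by apply: val_inj; rewrite vth injs_gen.
Qed.

Theorem quasi_hereditary_pull :
  (forall i (x : I i), end_iso_field (standard (@P i) x)) ->
  quasi_hereditary sim_pull.
Proof.
move=> endP; split; first exact: is_Sim_pull.
exists PA; first exact: coverA.
by move=> t; split; [apply: end_iso_standardA | apply: trace_filtered].
Qed.

End Stratified.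

(** All choices are indexed by finite types, the vertices and the simple modules, so that no choice
    axiom is involved. *)
Lemma choose_covers (K : fieldType) (n : nat) (S : 'I_n -> falgType K)
    (d : Order.disp_t) (I : 'I_n -> finPOrderType d)
    (L : forall i, I i -> fdmodule (S i)) :
  (forall i, quasi_hereditary (@L i)) ->
  exists (P : forall i, I i -> fdmodule (S i)) (g : forall i (x : I i), P i x)
    (s : forall i (x : I i), 'Hom(P i x, regular (S i)))
    (p : forall i (x : I i), 'Hom(P i x, L i x)),
  [/\ forall i (x : I i), projective_cover (P i x) (L i x),
      forall i (x : I i), end_iso_field (standard (P i) x) /\
        standard_filtered (P i) x (trace_submod (P i) x) &
      forall i (x : I i), [/\ is_hom (s i x), forall u, act (s i x u : S i) (g i x) = u,
        is_hom (p i x), p i x (g i x) <> 0 &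
        forall U : submodule (P i x), (U + lker (p i x))%VS = fullv ->
          U = fullv :> {vspace P i x}]].
Proof.
move=> qh.
have [P PP] : exists P : forall i, I i -> fdmodule (S i), forall i,
    (forall x, projective_cover (P i x) (L i x)) /\
    forall x, end_iso_field (standard (P i) x) /\
      standard_filtered (P i) x (trace_submod (P i) x).
  pose cond i (P : I i -> fdmodule (S i)) :=
    (forall x, projective_cover (P x) (L i x)) /\
    forall x, end_iso_field (standard P x) /\ standard_filtered P x (trace_submod P x).
  have ex (i : 'I_n) : exists P, cond i P.
    by have [_ [P cP fP]] := qh i; exists P.
  exact: fin_all_exists ex.
pose T : finType := {i : 'I_n & I i}.
have [g /fin_all_exists[s /fin_all_exists[p gsp]]] := fin_all_exists (fun t : T =>
  cover_split (let: And3 sL _ _ := proj1 (qh (tag t)) in sL (tagged t))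
    (proj1 (PP (tag t)) (tagged t))).
exists P, (fun i x => g (existT _ i x)), (fun i x => s (existT _ i x)).
exists (fun i x => p (existT _ i x)); split=> [i x|i x|i x].
- exact: (PP i).1.
- exact: (PP i).2.
- exact: (gsp (existT _ i x)).
Qed.

(** * Paths *)

Section Paths.
Variables (n : nat) (Q : quiver n).

Lemma arrows_inj i j : injective (@arrows n Q i j).
Proof. by move=> p q e; apply: Some_inj; rewrite -!decodeK e. Qed.

Lemma target_le_max i j (p : qpath Q i j) : (j <= path_max p)%N.
Proof. by case: p => //= a p; apply: leq_maxl. Qed.

Lemma path_max_lt i j (p : qpath Q i j) : (path_max p < n)%N.
Proof. by elim: p => //= a p lt; rewrite gtn_max ltn_ord. Qed.

Lemma path_max_cat i j l (p : qpath Q j l) (q : qpath Q i j) :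
  path_max (qcat p q) = maxn (path_max p) (path_max q).
Proof.
elim: p => [|a p IH] /=; last by rewrite IH maxnA.
by apply/esym/maxn_idPr/target_le_max.
Qed.

(* The part of p after its passage through the vertex of largest index. *)
Lemma path_after_max (m : 'I_n) i j (p : qpath Q i j) : path_max p = m ->
  exists q : qpath Q m j, path_max q = m.
Proof.
elim: p => [|a p IH] /= pm.
  have -> : m = i by apply: val_inj.
  by exists (qtriv i).
have [lt|ge] := ltnP (path_max p) (target a).
  have -> : m = target a by apply: val_inj; rewrite /= -pm; apply/maxn_idPl/ltnW.
  by exists (qtriv (target a)).
have pm' : path_max p = m by rewrite -pm; apply/esym/maxn_idPr.
have [q qm] := IH pm'; exists (qcons a q); rewrite /= qm; apply/maxn_idPr.
by rewrite -pm'.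
Qed.

End Paths.

Section AcyclicPaths.
Variables (n : nat) (Q : acyclic_quiver n).

Lemma closed_path i (p : qpath Q i i) : p = qtriv i.
Proof. by apply: arrows_inj; rewrite (@aq_acyclic _ Q _ p). Qed.

End AcyclicPaths.

(** * Left projectivity of tensor products *)

Section LeftProjective.
Variables (K : fieldType).

(** For dual bases (x, psi) of M and (y, chi) of N, m ⊗ u is the sum of the m chi_t'(u) ⊗ y_t';
    expanding m chi_t'(u) in the x_t gives a dual basis x_t ⊗ y_t'. *)
Lemma tens_left_projective (A B C : falgType K) (M : bimodule A B) (N : bimodule B C) :
  projective (left_mod M) -> projective (left_mod N) -> projective (left_mod (tens M N)).
Proof.
move=> /projectiveP[T [x [psi [hpsi xE]]]] /projectiveP[T' [y [chi [hchi yE]]]].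
apply/projectiveP.
pose f (t : T) (t' : T') (m : M) (u : N) : A := psi t (ract m (chi t' u)).
have fb t t' : is_bilinear (f t t').
  split=> [m c u v|u c m m']; rewrite /f.
    by rewrite linearP (ract_bilinear M).1 linearP.
  by rewrite (ract_bilinear M).2 linearP.
have fbal t t' : balanced (f t t').
  move=> m b u; rewrite /f -ractM.
  by have -> : chi t' (lact b u) = b * chi t' u by apply: hchi.
exists (T * T')%type, (fun t => tens_pure (x t.1) (y t.2)).
exists (fun t => tens_lift (f t.1 t.2)).
have [pr pl] := tens_pure_bilinear M N.
split=> [[t t'] a z|z] /=.
  move: z; apply: tens_ext_lin => [c u v|c u v|m u].
  - by rewrite (tens_lact_bilinear M N).1 linearP.
  - by rewrite linearP mulrDr scalerAr.
  rewrite tens_lactE !(tens_liftE (fb t t') (fbal t t')) /f lract.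
  exact: hpsi.
have sl : linear (fun z : tens M N =>
    \sum_(t : T * T') act (tens_lift (f t.1 t.2) z : A)
      (tens_pure (x t.1) (y t.2) : left_mod (tens M N))).
  apply: linear_sumf => t c u v; rewrite linearP; exact: act_linear_l.
move: z; apply: (tens_ext_lin _ sl) => // m u.
rewrite -(pair_bigA _ (fun t t' => act (tens_lift (f t t') (tens_pure m u) : A)
  (tens_pure (x t) (y t') : left_mod (tens M N)))) exchange_big /=.
rewrite {1}(yE u) -(linfunE (pr m)) linear_sum; apply: eq_bigr => t' _.
rewrite /= (linfunE (pr m)) -tens_pure_balanced {1}(xE (ract m (chi t' u))).
rewrite -(linfunE (pl (y t'))) linear_sum; apply: eq_bigr => t _.
rewrite /= (linfunE (pl (y t'))) (tens_liftE (fb t t') (fbal t t')) /f.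
by rewrite [RHS]tens_lactE.
Qed.

Variables (n : nat) (Q : quiver n) (S : species K Q).

Lemma ext_left_projective i j l (p : qpath Q i j) (N : bimodule (S l) (S j)) :
  projective (left_mod N) -> projective (left_mod (path_bim S p)) ->
  projective (left_mod (ext_bim N p (path_bim S p))).
Proof. by case: p N => [|a q] N //; apply: tens_left_projective. Qed.

Lemma path_left_projective i j (p : qpath Q i j) :
  (forall a, a \in arrows p -> projective (left_mod (sp_bim S a))) ->
  projective (left_mod (path_bim S p)).
Proof.
elim: p => [_|a p IH pP]; first exact: projective_regular.
apply: (ext_left_projective (pP a (mem_head _ _))).
by apply: IH => b bp; apply: pP; rewrite inE bp orbT.
Qed.

End LeftProjective.

(** * Algebras graded by the paths of a quiver *)

Section TensorAlgebra.
Variables (K : fieldType) (n : nat) (Q : acyclic_quiver n.+1) (S : species K Q).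
Local Notation PT := {ij : 'I_n.+1 * 'I_n.+1 & qpath Q ij.1 ij.2}.
Local Notation tagp p :=
  (existT (fun ij : 'I_n.+1 * 'I_n.+1 => qpath Q ij.1 ij.2) (_, _) p).

(* An algebra graded by the paths of Q like the tensor algebra: working with an
   abstract A keeps the unfolding of the direct sum out of unification. *)
Variable A : falgType K.
Variable tinj : forall i j (p : qpath Q i j), path_bim S p -> A.
Variable tproj : forall i j (p : qpath Q i j), A -> path_bim S p.
Hypothesis tinj_linear : forall i j (p : qpath Q i j), linear (@tinj i j p).
Hypothesis tproj_linear : forall i j (p : qpath Q i j), linear (@tproj i j p).
Hypothesis tinjK : forall i j (p : qpath Q i j) x, tproj p (tinj (p := p) x) = x.
Hypothesis tproj_neq : forall i j (p : qpath Q i j) i' j' (p' : qpath Q i' j') x,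
  tagp p != tagp p' -> tproj p' (tinj (p := p) x) = 0.
Hypothesis tdecomp : forall x, x = \sum_(t : PT) tinj (tproj (tagged t) x).
Hypothesis tmul_inj : forall i j l (p : qpath Q j l) (q : qpath Q i j) x y,
  tinj (p := p) x * tinj (p := q) y = tinj (path_mul x y).
Hypothesis tmul_inj0 : forall i j j' l (p : qpath Q j l) (q : qpath Q i j') x y,
  j != j' -> tinj (p := p) x * tinj (p := q) y = 0.
Hypothesis sum_tinj1 : \sum_i tinj (p := qtriv i) (1 : S i) = 1.
Hypothesis tproj1 : forall i, tproj (qtriv i) 1 = (1 : S i).
Hypothesis tprojM : forall i x y,
  tproj (qtriv i) (x * y) = (tproj (qtriv i) x : S i) * tproj (qtriv i) y.

Lemma tinj_pcast i j (p q : qpath Q i j) (e : p = q) (x : path_bim S p) :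
  tinj (pcast e x) = tinj x.
Proof. by case: q / e. Qed.

Lemma graded_ext (W : vectType K) (f g : A -> W) : linear f -> linear g ->
  (forall i j (p : qpath Q i j) x, f (tinj (p := p) x) = g (tinj (p := p) x)) -> f =1 g.
Proof.
move=> lf lg fg x; rewrite -(linfunE lf) -(linfunE lg) [x]tdecomp !linear_sum.
by apply: eq_bigr => -[[i j] p] _ /=; rewrite (linfunE lf) (linfunE lg).
Qed.

Definition vout i (x : A) : S i := tproj (qtriv i) x.
Lemma vout_linear i : linear (@vout i). Proof. exact: (@tproj_linear i i (qtriv i)). Qed.

Definition path_pred := forall i j, qpath Q i j -> bool.
Implicit Types R : path_pred.

(* The sum of the M_p with R p. *)
Definition path_span R : {vspace A} :=
  (\bigcap_(t : PT | ~~ R _ _ (tagged t))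
     lker (linfun (fun x : A => tproj (tagged t) x)))%VS.

Lemma path_spanP R (x : A) :
  x \in path_span R <-> forall i j (p : qpath Q i j), ~~ R i j p -> tproj p x = 0.
Proof.
have mem (t : PT) : (x \in lker (linfun (fun x : A => tproj (tagged t) x))) =
    (tproj (tagged t) x == 0).
  by rewrite memv_ker linfunE //; apply: tproj_linear.
rewrite memvE; split=> [/subv_bigcapP h i j p Rp|h].
  by have := h (tagp p) Rp; rewrite -memvE mem => /eqP.
by apply/subv_bigcapP => t Rt; rewrite -memvE mem; apply/eqP/h.
Qed.

Lemma mem_path_span R i j (p : qpath Q i j) x :
  R i j p -> tinj (p := p) x \in path_span R.
Proof.
move=> Rp; apply/path_spanP => i' j' p' Rp'; apply: tproj_neq.
apply/eqP => e; case/negP: Rp'.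
by rewrite -[R i' j' p']/(R (tag (tagp p')).1 (tag (tagp p')).2 (tagged (tagp p'))) -e.
Qed.

Lemma path_span_sub R (U : {vspace A}) :
  (forall i j (p : qpath Q i j) x, R i j p -> tinj (p := p) x \in U) ->
  (path_span R <= U)%VS.
Proof.
move=> RU; apply/subvP => x /path_spanP xR; rewrite [x]tdecomp.
apply: rpred_sum => -[[i j] p] _; have [Rp|Rp] := boolP (R i j p); first exact: RU.
by rewrite /= xR // (linear0_of (@tinj_linear _ _ _)) mem0v.
Qed.

Lemma path_span_mul R1 R2 R3 :
  (forall i j l (p : qpath Q j l) (q : qpath Q i j), R1 _ _ p -> R2 _ _ q ->
     R3 _ _ (qcat p q)) ->
  forall u v, u \in path_span R1 -> v \in path_span R2 -> u * v \in path_span R3.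
Proof.
move=> R123 u v uR vR; have -> : u * v = amulr v u by rewrite lfunE.
rewrite memv_preim; apply: subvP uR; apply: path_span_sub => j l p x Rp.
rewrite -memv_preim lfunE /=.
have -> : tinj (p := p) x * v = amull (tinj (p := p) x) v by rewrite lfunE.
rewrite memv_preim; apply: subvP vR; apply: path_span_sub => i j' q y Rq.
rewrite -memv_preim lfunE /=.
have [e|ne] := eqVneq j j'; last by rewrite tmul_inj0 // mem0v.
by case: j' / e q y Rq => q y Rq; rewrite tmul_inj; apply/mem_path_span/R123.
Qed.

Definition vinj i (x : S i) : A := tinj (p := qtriv i) x.
Local Notation e i := (vinj (1 : S i)).

Lemma vinj_linear i : linear (@vinj i).
Proof. exact: (@tinj_linear i i (qtriv i)). Qed.

Lemma e_mull i i' j (p : qpath Q i' j) y :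
  e i * tinj (p := p) y = if i == j then tinj (p := p) y else 0.
Proof.
have [ij|ij] := eqVneq i j; last exact: tmul_inj0.
by case: j / ij p y => p y; rewrite tmul_inj path_mul_triv lact1.
Qed.

Lemma e_mulr i i' j (p : qpath Q i' j) y :
  tinj (p := p) y * e i = if i' == i then tinj (p := p) y else 0.
Proof.
have [ij|ij] := eqVneq i' i; last exact: tmul_inj0.
case: i / ij; rewrite tmul_inj -(tinj_pcast (qcat_triv p)) path_mul_trivr.
by rewrite ract1.
Qed.

Lemma vinjM i (x y : S i) : vinj (x * y) = vinj x * vinj y.
Proof. by rewrite tmul_inj. Qed.

Lemma vinjK i (x : S i) : vout i (vinj x) = x.
Proof. exact: (@tinjK i i (qtriv i)). Qed.

Lemma sum_e : \sum_i e i = 1 :> A. Proof. exact: sum_tinj1. Qed.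

Lemma e_orth i j : i != j -> e i * e j = 0.
Proof. by move=> ij; rewrite tmul_inj0. Qed.

(** By acyclicity the trivial path is the only one from i to i. *)
Lemma vinj_out i (a : A) : vinj (vout i a) = e i * a * e i.
Proof.
move: a; apply: graded_ext => [c u v|c u v|i' j p x].
- by rewrite vout_linear vinj_linear.
- by rewrite mulrDr mulrDl scalerAl scalerAr.
rewrite e_mull; have [ij|ij] := eqVneq i j; last first.
  rewrite mul0r /vout (tproj_neq (p' := qtriv i)) ?(linear0_of (@vinj_linear i)) //.
  by apply: contraNneq ij => /(congr1 (fun t : PT => (tag t).2)) /= ->.
rewrite e_mulr; have [ij'|ij'] := eqVneq i' i; last first.
  rewrite /vout (tproj_neq (p' := qtriv i)) ?(linear0_of (@vinj_linear i)) //.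
  by apply: contraNneq ij' => /(congr1 (fun t : PT => (tag t).1)) /= ->.
case: j / ij p x => p x; case: i / ij' p x => p x.
move: x; rewrite (closed_path p) => x; congr (tinj (p := qtriv i') _); exact: vinjK.
Qed.

Definition max_ge (k : nat) : path_pred := fun i j p => (k <= path_max p)%N.
Definition max_at_target (m : 'I_n.+1) : path_pred :=
  fun i j p => (path_max p == m) && (j == m).
Definition trivial_at (m : 'I_n.+1) : path_pred :=
  fun i j p => nilp (arrows p) && (j == m).

Definition Jspan k := path_span (max_ge k).
Definition Cspan m := path_span (max_at_target m).

Lemma path_spanT (x : A) : x \in path_span (fun _ _ _ => true).
Proof. exact/path_spanP. Qed.

Lemma Jspan_left k a u : u \in Jspan k -> a * u \in Jspan k.
Proof.
apply: path_span_mul (path_spanT a) => i j l p q _.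
by rewrite /max_ge path_max_cat leq_max orbC => ->.
Qed.

Lemma Jspan_right k a u : u \in Jspan k -> u * a \in Jspan k.
Proof.
move=> uJ; apply: path_span_mul uJ (path_spanT a) => i j l p q kp _.
by rewrite /max_ge path_max_cat leq_max (kp : (_ <= _)%N).
Qed.

Lemma Jspan_mono k : (Jspan k.+1 <= Jspan k)%VS.
Proof. by apply: path_span_sub => i j p x kp; apply/mem_path_span/ltnW. Qed.

Lemma Jspan_end : Jspan n.+1 = 0%VS.
Proof.
apply/eqP; rewrite -subv0; apply: path_span_sub => i j p x.
by rewrite /max_ge leqNgt path_max_lt.
Qed.

Lemma vinj_trivial m (x : S m) : vinj x \in path_span (trivial_at m).
Proof. by apply: mem_path_span; apply/andP. Qed.

Lemma e_Cspan m : e m \in Cspan m.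
Proof. by apply: mem_path_span; apply/andP. Qed.

Lemma Cspan_Jspan m : (Cspan m <= Jspan m)%VS.
Proof.
apply: path_span_sub => i j p x /andP[/eqP pm _]; apply: mem_path_span.
by rewrite /max_ge pm.
Qed.

Lemma e_mull_Cspan m x : x \in Cspan m -> e m * x = x.
Proof.
move=> xC; apply/eqP; rewrite -subr_eq0.
have lE y : (amull (e m) - \1)%VF y = e m * y - y.
  by rewrite add_lfunE opp_lfunE lfunE id_lfunE.
rewrite -lE -memv_ker; apply: subvP xC; apply: path_span_sub => i j p y /andP[_ jm].
by rewrite memv_ker lE e_mull (eq_sym m) jm subrr.
Qed.

Lemma Cspan_left m (y : S m) x : x \in Cspan m -> vinj y * x \in Cspan m.
Proof.
apply: path_span_mul (vinj_trivial y) => i j l p q.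
by case: p => [|a p] /andP[].
Qed.

Lemma Cspan_right m j (y : S j) x : x \in Cspan m -> x * vinj y \in Cspan m.
Proof.
move=> xC; apply: path_span_mul xC (vinj_trivial y) => i i' l p q.
by case: q p => [|a q] p pC /andP[] // _ _; rewrite qcat_triv.
Qed.

(** * Division by an arrow *)

Section ArrowDivision.
Variables (a : Q) (psi : sp_bim S a -> S (source a)).
Hypothesis psi_linear : linear psi.
Hypothesis psiM : forall m b, psi (ract m b) = psi m * b.

Definition div_bim i (q : qpath Q i (source a)) :
    path_bim S (qcons a q) -> path_bim S q :=
  ext_lift (fun m x => lact (psi m) x).

Lemma div_bim_bilinear i (q : qpath Q i (source a)) :
  is_bilinear (fun m (x : path_bim S q) => lact (psi m) x).
Proof.
have [lr ll] := lact_bilinear (path_bim S q).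
by split=> [m|x c m m']; [exact: lr | rewrite psi_linear ll].
Qed.

Lemma div_bim_pure i (q : qpath Q i (source a)) m x :
  div_bim (ext_pure m x : path_bim S (qcons a q)) = lact (psi m) x.
Proof.
apply: ext_liftE; first exact: div_bim_bilinear.
by move=> m' b y; rewrite psiM lactM.
Qed.

Lemma div_bim_linear i (q : qpath Q i (source a)) : linear (@div_bim i q).
Proof. exact/ext_lift_linear/div_bim_bilinear. Qed.

(* Division on the left by M_a: x y |-> psi x y for x in M_a; it vanishes on the
   paths not ending in the arrow a. *)
Definition adiv (u : A) : A :=
  \sum_i \sum_(q : qpath Q i (source a)) tinj (div_bim (tproj (qcons a q) u)).

Lemma adiv_linear : linear adiv.
Proof.
apply: linear_sumf => i; apply: linear_sumf => q c u v.
by rewrite tproj_linear div_bim_linear tinj_linear.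
Qed.

Lemma adiv_cons i (q : qpath Q i (source a)) z :
  adiv (tinj (p := qcons a q) z) = tinj (div_bim z).
Proof.
have z0 i' (q' : qpath Q i' (source a)) : tagp (qcons a q) != tagp (qcons a q') ->
    tinj (div_bim (tproj (qcons a q') (tinj (p := qcons a q) z))) = 0.
  move=> ne; rewrite (tproj_neq _ ne) (linear0_of (@div_bim_linear _ _)).
  exact: linear0_of (@tinj_linear _ _ _).
rewrite /adiv (bigD1 i) //= (bigD1 q) //= tinjK !big1 ?addr0 // => [i' ne|q' ne].
  rewrite big1 // => q' _; apply: z0.
  by apply: contraNneq ne => /(congr1 (fun t : PT => (tag t).1)) /= ->.
apply: z0; apply: contraNneq ne => /(congr1 (fun t : PT => arrows (tagged t))) /=.
by case=> /arrows_inj ->.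
Qed.

Lemma adiv_other i j (p : qpath Q i j) z : ohead (arrows p) != Some a ->
  adiv (tinj (p := p) z) = 0.
Proof.
move=> pa; rewrite /adiv big1 // => i' _; rewrite big1 // => q _.
rewrite tproj_neq; last first.
  by apply: contraNneq pa => /(congr1 (fun t : PT => arrows (tagged t))) /= ->.
by rewrite (linear0_of (@div_bim_linear _ _)) (linear0_of (@tinj_linear _ _ _)).
Qed.

(** For p trivial this may fail: the product then ends in the last arrow of q, whereas [adiv] kills
    M_p. *)
Lemma adiv_mul i i' j (p : qpath Q i j) (q : qpath Q i' i) z y : arrows p != [::] ->
  adiv (tinj (p := p) z * tinj (p := q) y) = adiv (tinj (p := p) z) * tinj (p := q) y.
Proof.
case: p z => [|b p] z // _; rewrite tmul_inj.
have [ab|ab] := eqVneq b a; last first.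
  rewrite !adiv_other ?mul0r //= ; by apply: contraNneq ab => -[->].
move: (esym ab) => {ab} ba; case: b / ba p z => p z.
have E : adiv (tinj (path_mul z y)) =
    tinj (div_bim (path_mul z y : path_bim S (qcons a (qcat p q)))).
  exact: (@adiv_cons _ (qcat p q)).
rewrite [LHS]E adiv_cons tmul_inj; congr tinj.
have [mr ml] := path_mul_bilinear S (qcons a p) q.
have [mr' ml'] := path_mul_bilinear S p q.
move: z {E}; apply: ext_ext => [c u v|c u v|m x].
- by rewrite ml (@div_bim_linear _ (qcat p q)).
- by rewrite div_bim_linear ml'.
rewrite path_mul_cons (@div_bim_pure _ (qcat p q)) div_bim_pure.
by rewrite (path_mul_spec S p q).2.
Qed.

End ArrowDivision.

Definition is_adiv a (D : 'End(A)) : Prop := exists psi : sp_bim S a -> S (source a),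
  [/\ linear psi, forall m b, psi (ract m b) = psi m * b & D =1 adiv psi].

Lemma is_adiv_span a (D : 'End(A)) R R' : is_adiv a D ->
  (forall i (q : qpath Q i (source a)), R _ _ (qcons a q) -> R' _ _ q) ->
  forall u, u \in path_span R -> D u \in path_span R'.
Proof.
move=> [psi [pl pM DE]] RR' u; rewrite memv_preim; apply: subvP.
apply: path_span_sub => i j p x Rp; rewrite -memv_preim DE.
have [pa|pa] := eqVneq (ohead (arrows p)) (Some a); last by rewrite adiv_other ?mem0v.
case: p x Rp pa => //= b p x Rp [/esym ba]; case: b / ba p x Rp => p x Rp.
by rewrite (adiv_cons pl); apply: mem_path_span; apply: RR'.
Qed.

Definition starts_at (m : 'I_n.+1) : path_pred := fun i j p => i == m.

(** The dangerous case is the component of u at the trivial path of m. There the product ends in the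
    last arrow of a path to m, which is not a. *)
Lemma is_adiv_mul a (D : 'End(A)) (m : 'I_n.+1) u v : is_adiv a D -> target a != m ->
  u \in path_span (starts_at m) -> D (u * v) = D u * v.
Proof.
move=> [psi [pl pM DE]] am.
pose U := lker ((D \o amulr v) - (amulr v \o D))%VF.
have memU w : (w \in U) = (D (w * v) == D w * v).
  by rewrite memv_ker add_lfunE opp_lfunE !comp_lfunE !lfunE /= subr_eq0.
move=> uR; apply/eqP; rewrite -memU; apply: subvP uR.
apply: path_span_sub => i j p x /eqP im.
rewrite memU !DE; apply/eqP; move: v {U memU}.
apply: graded_ext => [c v w|c v w|i' j' q y].
- by rewrite mulrDr -scalerAr adiv_linear.
- by rewrite mulrDr scalerAr.
have [ij|ij] := eqVneq i j'; last first.
  rewrite tmul_inj0 // (linear0_of (adiv_linear pl)).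
  have [pa|pa] := eqVneq (ohead (arrows p)) (Some a); last by rewrite adiv_other ?mul0r.
  case: p x im ij pa => //= b p x im ij [/esym ba]; case: b / ba p x im ij => p x im ij.
  by rewrite (adiv_cons pl) tmul_inj0.
case: j' / ij q y => q y.
case: p x => [|b p] x; last exact: adiv_mul.
rewrite [X in _ = X * _]adiv_other // mul0r tmul_inj adiv_other //=.
case: q {y x} im => //= b q bm; apply: contraNneq am => -[<-]; exact/eqP.
Qed.

(** For a dual basis (x, psi) of the right module M_a, m ⊗ y is the sum of the x_t ⊗ psi_t(m) y, and
    psi_t(m) y is the quotient computed by [adiv]. *)
Lemma arrow_right_dual a : projective (right_mod (sp_bim S a)) ->
  exists r : seq (A * 'End(A)), (forall t, t \in r -> is_adiv a t.2) /\
    forall i (q : qpath Q i (source a)) z,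
      tinj (p := qcons a q) z = \sum_(t <- r) t.1 * t.2 (tinj (p := qcons a q) z).
Proof.
move=> /projectiveP[T [x [psi0 [hpsi0 xE]]]].
pose psi t (m : sp_bim S a) : S (source a) := psi0 t m.
have pl t : linear (psi t) by move=> c u v; rewrite /psi linearP.
have pM t m b : psi t (ract m b) = psi t m * b by apply: (hpsi0 t b m).
pose xa t : A := tinj (p := qcons a (qtriv (source a))) (x t).
exists [seq (xa t, linfun (adiv (psi t))) | t <- enum T]; split.
  move=> _ /mapP[t _ ->]; exists (psi t); split=> //=.
  exact/linfunE/adiv_linear.
move=> i q z; rewrite big_map big_enum /=.
have -> : \sum_t xa t * linfun (adiv (psi t)) (tinj (p := qcons a q) z) =
    \sum_t xa t * adiv (psi t) (tinj (p := qcons a q) z).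
  by apply: eq_bigr => t _; rewrite (linfunE (adiv_linear (pl t))).
move: z; apply: ext_ext => [c u v||m y].
- by rewrite tinj_linear.
- apply: linear_sumf => t c u v.
  by rewrite tinj_linear (adiv_linear (pl t)) mulrDr scalerAr.
have xay t w : xa t * tinj (p := q) w = tinj (p := qcons a q) (ext_pure (x t) w).
  have x1 : x t = ext_pure (p := qtriv (source a)) (x t : sp_bim S a) (1 : S (source a)).
    by rewrite /= ract1.
  rewrite tmul_inj {1}x1; congr (tinj (p := qcons a q) _).
  rewrite (path_mul_cons (p := qtriv (source a)) (q := q) (x t)).
  by rewrite path_mul_triv lact1.
rewrite {1}(xE m) -(linfunE ((ext_pure_bilinear (sp_bim S a) q).2 y)).
rewrite linear_sum -(linfunE (@tinj_linear _ _ (qcons a q))) linear_sum.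
apply: eq_bigr => t _; rewrite (adiv_cons (pl t)) (div_bim_pure (pl t) (pM t)) xay.
rewrite /= (linfunE (@tinj_linear _ _ (qcons a q))).
rewrite (linfunE ((ext_pure_bilinear (sp_bim S a) q).2 y)).
by rewrite -ext_pure_balanced.
Qed.

Definition path_proj R (x : A) : A :=
  \sum_(t : PT) if R _ _ (tagged t) then tinj (tproj (tagged t) x) else 0.

Lemma path_proj_linear R : linear (path_proj R).
Proof.
apply: linear_sumf => t c x y.
by case: ifP; rewrite ?tproj_linear ?tinj_linear // scaler0 addr0.
Qed.

Lemma path_proj_inj R i j (p : qpath Q i j) x :
  path_proj R (tinj (p := p) x) = if R _ _ p then tinj (p := p) x else 0.
Proof.
rewrite /path_proj (bigD1 (tagp p)) //= tinjK big1 ?addr0 // => -[[i' j'] p'] ne.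
rewrite tproj_neq 1?eq_sym // (linear0_of (@tinj_linear _ _ _)).
by case: ifP.
Qed.

(** The coordinate on D_m ⊗ C_m belonging to the trivial path of D_m, with basis element e_m. *)
Definition cproj m : 'End(A) := linfun (path_proj (max_at_target m)).

Lemma cprojE m i j (p : qpath Q i j) x : cproj m (tinj (p := p) x) =
  if (path_max p == m) && (j == m) then tinj (p := p) x else 0.
Proof. by rewrite (linfunE (@path_proj_linear _)) path_proj_inj. Qed.

Lemma cproj_mem m u : cproj m u \in Cspan m.
Proof.
rewrite [u]tdecomp linear_sum; apply: rpred_sum => -[[i j] p] _ /=.
by rewrite cprojE; case: ifP => [pm|_]; [apply: mem_path_span | apply: mem0v].
Qed.

Lemma cproj_mul m u v : u \in path_span (starts_at m) -> v \in Cspan m ->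
  cproj m (u * v) = cproj m u * v.
Proof.
pose U v := lker ((cproj m \o amulr v) - (amulr v \o cproj m))%VF.
have memU w v' : (w \in U v') = (cproj m (w * v') == cproj m w * v').
  by rewrite memv_ker add_lfunE opp_lfunE !comp_lfunE !lfunE /= subr_eq0.
pose V u := lker ((cproj m \o amull u) - amull (cproj m u))%VF.
have memV w v' : (w \in V v') = (cproj m (v' * w) == cproj m v' * w).
  by rewrite memv_ker add_lfunE opp_lfunE !comp_lfunE !lfunE /= subr_eq0.
move=> uR vC; apply/eqP; rewrite -memU; apply: subvP uR.
apply: path_span_sub => i j p x /eqP im.
rewrite memU -memV; apply: subvP vC.
apply: path_span_sub => i' j' q y /andP[/eqP qm /eqP jm].
rewrite memV; apply/eqP; move: (esym im) (esym jm) => {im jm} im jm.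
case: i / im p x => p x; case: j' / jm q y qm => q y qm.
rewrite tmul_inj !cprojE path_max_cat qm.
have [jm|jm] := eqVneq j m; last by rewrite !andbF mul0r.
move: (esym jm) => {jm} jm; case: j / jm p x => p x.
by move: x; rewrite (closed_path p) /= => x; rewrite maxnn eqxx tmul_inj.
Qed.

(** * The dual basis of D_m *)

Section RightBasis.
Variable m : 'I_n.+1.
Hypothesis right_proj : forall a : Q,
  (exists (i j : 'I_n.+1) (p : qpath Q i j), path_max p = i /\ a \in arrows p) ->
  projective (right_mod (sp_bim S a)).

(** Division is required only by arrows a with target below m that end a path of maximum m. Cutting
    this path at m leaves one that contains a and has its maximum at its start, so M_a is right
    projective. All other arrows get the empty family. *)
Lemma arrow_family (a : Q) : exists r : seq (A * 'End(A)),
  (forall t, t \in r -> is_adiv a t.2 /\ (target a < m)%N) /\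
  forall i (q : qpath Q i (source a)) z, path_max (qcons a q) = m -> (target a < m)%N ->
    tinj (p := qcons a q) z = \sum_(t <- r) t.1 * t.2 (tinj (p := qcons a q) z).
Proof.
have [[am [i [q qm]]]|no] := classic ((target a < m)%N /\
    exists i (q : qpath Q i (source a)), path_max (qcons a q) = m).
  have [p pm] : exists p : qpath Q m (source a), path_max p = m.
    apply: (path_after_max (p := q)); move: qm => /= /eqP; rewrite eqn_leq geq_max.
    case/andP=> /andP[_ le]; rewrite leq_max leqNgt am /= => ge.
    by apply/eqP; rewrite eqn_leq le.
  have [|r [rD rE]] := @arrow_right_dual a.
    apply: right_proj; exists m, (target a), (qcons a p); split; last exact: mem_head.
    by rewrite /= pm; apply/maxn_idPr/ltnW.
  by exists r; split=> // t tr; split=> //; apply: rD.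
exists [::]; split=> // i q z qm am; case: no; split=> //.
by exists i, q.
Qed.

(** Induction on the length of paths: the family for N + 1 consists of (e_m, [cproj m]) and of the
    family for N preceded by division by an arrow with target below m. *)
Lemma right_family_size N : exists r : seq (A * 'End(A)),
  [/\ forall t u, t \in r -> t.2 u \in Cspan m,
      forall t u, t \in r -> u \in Jspan m.+1 -> t.2 u = 0,
      forall t u x, t \in r -> u \in path_span (starts_at m) -> x \in Cspan m ->
        t.2 (u * x) = t.2 u * x &
      forall i j (p : qpath Q i j) z, path_max p = m -> (size (arrows p) < N)%N ->
        tinj (p := p) z = \sum_(t <- r) t.1 * t.2 (tinj (p := p) z)].
Proof.
elim: N => [|N [r [rC r0 rM rE]]]; first by exists [::].
have [ra raP] := fin_all_exists arrow_family.
have raD a t : t \in ra a -> is_adiv a t.2 by move=> /(raP a).1[].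
have raT a t : t \in ra a -> (target a < m)%N by move=> /(raP a).1[].
pose rA := [seq t | a <- enum Q, t <- ra a].
have rAP t : t \in rA -> exists2 a, is_adiv a t.2 & (target a < m)%N.
  by case/allpairsPdep => a [t' [_ t'r ->]]; exists a; [apply: raD | apply: raT t'r].
pose r' := (e m, cproj m) :: [seq (t.1 * t'.1, (t'.2 \o t.2)%VF) | t <- rA, t' <- r].
exists r'; split=> [t u|t u|t u x|i j p z pm pN].
- rewrite inE => /predU1P[->|/allpairsP[[t1 t2] [/= _ t2r ->]]]; first exact: cproj_mem.
  by rewrite comp_lfunE rC.
- rewrite inE => /predU1P[->|/allpairsP[[t1 t2] [/= /rAP[a aD am] t2r ->]]] uJ /=.
    have : u \in lker (cproj m); last by rewrite memv_ker => /eqP.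
    apply: subvP uJ; apply: path_span_sub => i j p x pm; rewrite memv_ker cprojE.
    by rewrite gtn_eqF.
  rewrite comp_lfunE (r0 _ _ t2r) //; apply: (is_adiv_span aD) uJ => i q.
  by rewrite /max_ge /= leq_max leqNgt ltnS ltnW.
- rewrite inE => /predU1P[->|/allpairsP[[t1 t2] [/= /rAP[a aD am] t2r ->]]] uR xC /=.
    exact: cproj_mul.
  have am' : target a != m by apply: contraTneq am => ->; rewrite ltnn.
  rewrite !comp_lfunE (is_adiv_mul _ aD am') // rM //.
  exact: (is_adiv_span aD) uR.
rewrite big_cons /= cprojE pm eqxx /= big_allpairs_dep /=.
have adiv0 a t : t \in ra a -> ohead (arrows p) != Some a -> t.2 (tinj (p := p) z) = 0.
  by move=> tr pa; have [psi [pl _ ->]] := raD a t tr; apply: adiv_other.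
(* If p ends at m, it lies in C_m and [cproj] reproduces it, while the divisions, by arrows with
   target below m, all vanish on it. Otherwise [cproj] vanishes and only division by the last arrow
   of p contributes. *)
have [jm|jm] := eqVneq j m.
  have mj : (m == j) = true by rewrite jm eqxx.
  rewrite e_mull mj big_seq big1 ?addr0 // => t tA.
  apply: big1 => t' _; rewrite comp_lfunE.
  case/allpairsPdep: tA => a [t0 [_ t0r ->]]; rewrite (adiv0 a) ?linear0 ?mulr0 //.
  have am := raT a t0 t0r; case: (p) jm => //= b q bm; apply: contraTneq am => -[<-].
  by rewrite bm ltnn.
rewrite mulr0 add0r.
case: p z pm pN jm adiv0 => [|b q] z pm pN jm adiv0.
  by case/eqP: jm; apply: val_inj.
have bm : (target b < m)%N.
  by rewrite ltn_neqAle jm -pm leq_maxl.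
have qm : path_max q = m.
  by move: (pm) => /=; case: leqP => // _ eb; rewrite eb ltnn in bm.
rewrite big_allpairs_dep /= big_enum /= (bigD1 b) //= [X in _ + X]big1 ?addr0 => [|a ab].
  rewrite {1}((raP b).2 i q z pm bm) [LHS]big_seq [RHS]big_seq; apply: eq_bigr => t tr.
  have [psi [pl pM DE]] := raD b t tr.
  have tz : t.2 (tinj (p := qcons b q) z) = tinj (div_bim psi z).
    by rewrite DE (adiv_cons pl).
  rewrite tz {1}(rE _ _ q _ qm pN) mulr_sumr; apply: eq_bigr => t' _.
  by rewrite comp_lfunE tz mulrA.
rewrite big_seq; apply: big1 => t tr; apply: big1 => t' _.
rewrite comp_lfunE (adiv0 a) ?linear0 ?mulr0 //=.
by apply: contraNneq ab => -[->].
Qed.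

Lemma right_family : exists r : seq (A * 'End(A)),
  [/\ forall t u, t \in r -> t.2 u \in Cspan m,
      forall t u, t \in r -> u \in Jspan m.+1 -> t.2 u = 0,
      forall u, u \in Jspan m -> u - \sum_(t <- r) t.1 * t.2 u \in Jspan m.+1 &
      forall t u x, t \in r -> x \in Cspan m -> t.2 (u * e m * x) = t.2 (u * e m) * x].
Proof.
(* With n + 1 vertices a path has at most n + 1 arrows, and the length bound is strict. *)
have [r [rC r0 rM rE]] := right_family_size n.+2; exists r; split=> // [u uJ|t u x tr xC].
  pose D := (\1 - \sum_(t <- r) (amull t.1 \o t.2))%VF.
  have DE w : D w = w - \sum_(t <- r) t.1 * t.2 w.
    rewrite add_lfunE opp_lfunE id_lfunE sum_lfunE; congr (_ - _).
    by apply: eq_bigr => t _; rewrite comp_lfunE lfunE.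
  rewrite -DE memv_preim; apply: subvP uJ; apply: path_span_sub => i j p x.
  rewrite /max_ge leq_eqVlt => /orP[/eqP pm|pm]; rewrite -memv_preim DE.
    by rewrite -rE ?subrr ?mem0v // ltnS; apply: acyclic_size; apply: aq_acyclic.
  have xJ : tinj (p := p) x \in Jspan m.+1 by apply: mem_path_span.
  by rewrite big_seq big1 ?subr0 // => t tr; rewrite (r0 t) ?mulr0.
apply: rM => //; apply: path_span_mul (path_spanT u) (vinj_trivial 1).
move=> i j l p q _; case: q p => [|b q] p /andP[] // _ im; exact: im.
Qed.
End RightBasis.

(** * The dual basis of C_m *)

Section LeftBasis.
Variable m : 'I_n.+1.
Hypothesis left_proj : forall a : Q,
  (exists (i j : 'I_n.+1) (p : qpath Q i j), path_max p = j /\ a \in arrows p) ->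
  projective (left_mod (sp_bim S a)).

Lemma tproj_act i (p : qpath Q i m) (s : S m) u :
  tproj p (vinj s * u) = lact s (tproj p u).
Proof.
have [lr ll] := lact_bilinear (path_bim S p).
move: u; apply: graded_ext => [c u v|c u v|i' j q y].
- by rewrite mulrDr -scalerAr tproj_linear.
- by rewrite tproj_linear lr.
have [mj|mj] := eqVneq m j; last first.
  rewrite tmul_inj0 // (linear0_of (@tproj_linear _ _ _)) tproj_neq.
    by rewrite (linear0_of (lr _)).
  by apply: contraNneq mj => /(congr1 (fun t : PT => (tag t).2)) /= ->.
case: j / mj q y => q y; rewrite tmul_inj.
have [e|ne] := eqVneq (tagp q) (tagp p); last first.
  by rewrite !(tproj_neq _ ne) (linear0_of (lr _)).
have ei : i' = i := congr1 (fun t : PT => (tag t).1) e.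
case: i / ei p e lr ll => p e _ _.
have eq : q = p by apply: arrows_inj; apply: (congr1 (fun t : PT => arrows (tagged t)) e).
by case: p / eq {e}; rewrite !tinjK.
Qed.

(** C_m is the direct sum of the M_p over the paths p to m with maximum m. Every arrow of such a p
    has a left projective bimodule, so M_p is left projective; the dual bases of the M_p are put
    together. *)
Lemma left_family :
  exists (X : finType) (c : X -> A) (chi : X -> 'Hom(A, S m)),
  [/\ forall t, c t \in Cspan m,
      forall t y x, x \in Cspan m -> chi t (vinj y * x) = y * chi t x &
      forall x, x \in Cspan m -> x = \sum_t vinj (chi t x) * c t].
Proof.
pose Y : finType := {i : 'I_n.+1 & qpath Q i m}.
(* Paths to m with a larger maximum get an empty basis; the implication from T records that a basis
   element only occurs for maximum m. *)
have dual (y : Y) : exists (T : finType) (x : T -> path_bim S (tagged y))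
    (psi : T -> 'Hom(left_mod (path_bim S (tagged y)), regular (S m))),
    [/\ T -> path_max (tagged y) = m, forall t, is_hom (psi t) &
      path_max (tagged y) = m -> forall u, u = \sum_t lact (psi t u) (x t)].
  have [pm|pm] := eqVneq (path_max (tagged y)) m; last first.
    by exists void, (of_void _), (of_void _); split=> // /eqP; rewrite (negPf pm).
  have pP a : a \in arrows (tagged y) -> projective (left_mod (sp_bim S a)).
    by move=> ap; apply: left_proj; exists (tag y), m, (tagged y).
  have [T [x [psi [hpsi xE]]]] := (projectiveP _).1 (path_left_projective pP).
  by exists T, x, psi.
have [T /fin_all_exists[x /fin_all_exists[psi xpsi]]] := fin_all_exists dual.
exists {y : Y & T y}, (fun t => tinj (p := tagged (tag t)) (x (tag t) (tagged t))).
exists (fun t => linfun (fun u => psi (tag t) (tagged t) (tproj (tagged (tag t)) u))).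
have chiE (y : Y) (t : T y) u : linfun (fun u => psi y t (tproj (tagged y) u)) u =
    psi y t (tproj (tagged y) u).
  by apply: linfunE => c v w; rewrite tproj_linear linearP.
split=> [[y t]|[y t] s u uC|u uC] /=.
- have [pm _ _] := xpsi y; apply: mem_path_span.
  by rewrite /max_at_target (pm t) !eqxx.
- rewrite !chiE tproj_act; have [_ hpsi _] := xpsi y; exact: hpsi.
rewrite -(sig_big_dep (fun _ => true) (fun _ _ => true) (fun y t =>
  vinj (linfun (fun u => psi y t (tproj (tagged y) u)) u) *
    tinj (p := tagged y) (x y t))) /=.
pose F (y : Y) := tinj (p := tagged y) (tproj (tagged y) u).
have FE y : \sum_(t : T y) vinj (linfun (fun u => psi y t (tproj (tagged y) u)) u) *
    tinj (p := tagged y) (x y t) = F y.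
  have [T0 _ xE] := xpsi y; have [pm|pm] := eqVneq (path_max (tagged y)) m.
    rewrite /F {1}(xE pm (tproj (tagged y) u)).
    rewrite -(linfunE (@tinj_linear _ _ (tagged y))) linear_sum.
    apply: eq_bigr => t _; rewrite /= chiE tmul_inj.
    by rewrite (linfunE (@tinj_linear _ _ (tagged y))).
  rewrite big1 => [|t _]; last by case/eqP: pm; apply: T0 t.
  rewrite /F ((path_spanP _ u).1 uC).
    by rewrite (linear0_of (@tinj_linear _ _ _)).
  by rewrite /max_at_target (negPf pm).
rewrite (eq_bigr F) => [|y _]; last exact: FE.
pose G (v : A) := \sum_(y : Y) tinj (tproj (tagged y) v).
have Gl : linear G by apply: linear_sumf => y c v w; rewrite tproj_linear tinj_linear.
have memG v : (v \in lker (\1 - linfun G)%VF) = (v - G v == 0).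
  by rewrite memv_ker add_lfunE opp_lfunE id_lfunE (linfunE Gl).
apply/eqP; rewrite -subr_eq0 -[X in _ - X]/(G u) -memG; apply: subvP uC.
apply: path_span_sub => i j p z /andP[_ /eqP jm]; rewrite memG {memG}.
move: (esym jm) => {jm}jm; move: (jm) p z; case: j / jm => _ p z.
rewrite /G (bigD1 (existT (fun i => qpath Q i m) i p)) //= tinjK big1 ?addr0 ?subrr //.
move=> -[i' p'] ne; rewrite tproj_neq ?(linear0_of (@tinj_linear _ _ _)) //.
apply: contraNneq ne => e /=; have ei : i = i' := congr1 (fun t : PT => (tag t).1) e.
case: i' / ei p' e => p' e.
have -> // : p' = p.
by apply: arrows_inj; apply: esym (congr1 (fun t : PT => arrows (tagged t)) e).
Qed.
End LeftBasis.

Lemma vout1 i : vout i 1 = 1. Proof. exact: tproj1. Qed.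
Lemma voutM i x y : vout i (x * y) = vout i x * vout i y. Proof. exact: tprojM. Qed.

Theorem quasi_hereditary_graded (d : Order.disp_t) (I : 'I_n.+1 -> finPOrderType d)
    (L : forall i, I i -> fdmodule (S i)) :
  (forall i, quasi_hereditary (@L i)) ->
  (forall a : Q,
    (exists (i j : 'I_n.+1) (p : qpath Q i j), path_max p = i /\ a \in arrows p) ->
    projective (right_mod (sp_bim S a))) ->
  (forall a : Q,
    (exists (i j : 'I_n.+1) (p : qpath Q i j), path_max p = j /\ a \in arrows p) ->
    projective (left_mod (sp_bim S a))) ->
  quasi_hereditary (sim_pull vout_linear vout1 voutM L).
Proof.
move=> qh right_proj left_proj; have [P [g [s [p [covP stdP gsp]]]]] := choose_covers qh.
apply: (quasi_hereditary_pull vinj_linear vinjM vout_linear vout1 voutM vinjK vinj_out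
  sum_e e_orth (fun i => (qh i).1) Jspan_left Jspan_right Jspan_mono Jspan_end e_Cspan
  Cspan_Jspan e_mull_Cspan Cspan_left Cspan_right
  (fun m => right_family m right_proj) (fun m => left_family m left_proj)
  (P := P) (g := g) (s := s) _ _ (p := p) _ _ covP) => i x.
- by case: (gsp i x).
- by case: (gsp i x).
- by case: (gsp i x).
- by case: (gsp i x).
- exact: (stdP i x).2.
- by case: (gsp i x).
- exact: (stdP i x).1.
Qed.

End TensorAlgebra.

(** * The tensor algebra *)

Section Transport.
Variables (K : fieldType) (A : falgType K).
Implicit Types M N : fdmodule A.

Lemma simple_iso M N : iso M N -> simple_module M -> simple_module N.
Proof.
move=> [f [hf /eqP kf lf]] [M0 sM]; split=> [N0|U].
  apply: M0; apply/eqP; rewrite -dimv_eq0 -(limg_dim_eq (f := f)) ?lf ?N0 ?dimv0 //.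
  by rewrite (eqP kf) capv0.
have UE : U = (f @: (f @^-1: U))%VS :> {vspace N} by rewrite lpreimK // lf subvf.
have [e|e] := sM (preim_submod hf U); rewrite /= in e; rewrite UE e; last by right.
by left; rewrite limg0.
Qed.

Lemma cover_iso P M N : iso M N -> projective_cover P M -> projective_cover P N.
Proof.
move=> [f [hf /eqP kf lf]] [prP [p [hp lp sup]]]; split=> //; exists (f \o p)%VF.
split=> [||U]; first exact: hom_comp.
  by rewrite limg_comp lp.
suff -> : lker (f \o p)%VF = lker p by exact: sup.
by apply/vspaceP => x; rewrite !memv_ker comp_lfunE -memv_ker (eqP kf) memv0.
Qed.

(** Serves to pass from [sim_pull] to [inflate]: the actions agree, but the module records carry
    different proofs. *)
Lemma quasi_hereditary_iso (d : Order.disp_t) (I : finPOrderType d)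
    (L L' : I -> fdmodule A) : (forall i, iso (L i) (L' i)) ->
  quasi_hereditary L -> quasi_hereditary L'.
Proof.
move=> LL' [[sL injL surL] [P covP stdP]]; split; last first.
  by exists P => // i; apply: cover_iso (covP i).
split=> [i|i j ij|M /surL[i Mi]]; first exact: simple_iso (sL i).
  by apply: injL; apply: iso_trans (LL' i) (iso_trans ij (iso_sym (LL' j))).
by exists i; apply: iso_trans Mi (LL' i).
Qed.

End Transport.

Theorem theorem4p5 (k : closedFieldType) (n : nat) (Q : acyclic_quiver n.+1)
    (S : species k Q) (d : Order.disp_t) (I : 'I_n.+1 -> finPOrderType d)
    (L : forall i : 'I_n.+1, I i -> fdmodule (S i))
    (S_qh : forall i : 'I_n.+1, quasi_hereditary (L i))
    (right_proj : forall a : Q,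
      (exists (i j : 'I_n.+1) (p : qpath Q i j),
          path_max p = i /\ a \in arrows p) ->
      projective (right_mod (sp_bim S a)))
    (left_proj : forall a : Q,
      (exists (i j : 'I_n.+1) (p : qpath Q i j),
          path_max p = j /\ a \in arrows p) ->
      projective (left_mod (sp_bim S a))) :
  quasi_hereditary
    (fun x : {i : 'I_n.+1 & I i} =>
       inflate (L (tag x) (tagged x)) : fdmodule (tensor_algebra S)).
Proof.
pose TA : falgType k := tensor_algebra S.
have decomp (x : TA) :
    x = \sum_(t : {ij : 'I_n.+1 * 'I_n.+1 & qpath Q ij.1 ij.2})
      ta_inj (ta_proj (tagged t) x).
  by rewrite {1}[x]dsum_decomp; apply: eq_bigr => -[[i j] p].
have := quasi_hereditary_graded (A := TA)
  (@ta_inj_linear _ _ _ S) (@ta_proj_linear _ _ _ S)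
  (@ta_injK _ _ _ S) (@ta_inj_neq _ _ _ S) decomp (@ta_mul_inj _ _ _ S)
  (@ta_mul_inj0 _ _ _ S) erefl (@ta_vertex1 _ _ _ S) (@ta_vertexM _ _ _ S)
  S_qh right_proj left_proj.
apply: quasi_hereditary_iso => x; exists \1%VF; split; last exact: lim1g.
  by move=> a u; rewrite !id_lfunE.
by apply/eqP/lker0P => u v; rewrite !id_lfunE.
Qed.
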